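(* Let $H$ be a $K$-bialgebra and $A$ an $H$-module-algebra. The Hopf-Hochschild cohomology modules $HH^*_{\mathrm{Hopf}}(A,A)=\bigoplus_n HH^n_{\mathrm{Hopf}}(A,A)$ of $A$ admit the structure of a $G$-algebra, in which the product $\cup$ and the bracket $[-,-]$ are induced by the cochain-level operations $$x\cup y=(-1)^{\deg x}\pi\{x,y\},\qquad [x,y]=x\{y\}-(-1)^{|x||y|}y\{x\}$$ on $\mathrm{CH}^*_{\mathrm{Hopf}}(A,A)$.
   Context: Conventions. $K$ is a fixed field; vector spaces and tensor products are over $K$. $H$ is a $K$-bialgebra (associative, unital, coassociative, counital) with counit $\varepsilon$ and Sweedler notation $\Delta(b)=\sum b_{(1)}\otimes b_{(2)}$, etc. $A$ is an associative unital $K$-algebra with unit $1$. $A$ is an $H$-module-algebra: $A$ is an $H$-module with $b(a_1a_2)=\sum(b_{(1)}a_1)(b_{(2)}a_2)$ and $b(1)=\varepsilon(b)1$. Write $a_{i,j}=a_i\otimes\cdots\otimes a_j$ for elements of $A$ (empty if $j<i$). Crossed product algebra. $X=A\otimes A\otimes H$ with the associative unital multiplication $(a_1\otimes a_1'\otimes b^1)(a_2\otimes a_2'\otimes b^2)=\sum a_1(b^1_{(1)}a_2)\otimes(b^1_{(3)}a_2')a_1'\otimes b^1_{(2)}b^2$. $A$ is an $X$-module by $(a\otimes a'\otimes b)a_0=a(ba_0)a'$, and $A^{\otimes(n+2)}$ is an $X$-module by $(a\otimes a'\otimes b)(a_0\otimes\cdots\otimes a_{n+1})=\sum a(b_{(1)}a_0)\otimes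 b_{(2)}a_1\otimes\cdots\otimes b_{(n+1)}a_n\otimes(b_{(n+2)}a_{n+1})a'$. Hopf-Hochschild cohomology. $\mathrm{CB}_n(A)=A^{\otimes(n+2)}$ ($n\ge0$) with $d_n^{\mathrm{CB}}=\sum_{j=0}^n(-1)^j\partial_j:\mathrm{CB}_n(A)\to\mathrm{CB}_{n-1}(A)$, where $\partial_j(a_0\otimes\cdots\otimes a_{n+1})=a_0\otimes\cdots\otimes a_ja_{j+1}\otimes\cdots\otimes a_{n+1}$; this is a chain complex of $X$-modules. The Hopf-Hochschild cochain complex is $(\mathrm{CH}^*_{\mathrm{Hopf}}(A,A),d_{\mathrm{CH}})=\mathrm{Hom}_X((\mathrm{CB}_*(A),d^{\mathrm{CB}}),A)$, i.e. $\mathcal{C}(n)=\mathrm{CH}^n_{\mathrm{Hopf}}(A,A)=\mathrm{Hom}_X(A^{\otimes(n+2)},A)$ and $d^n_{\mathrm{CH}}(f)=f\circ d^{\mathrm{CB}}_{n+1}$. Its $n$th cohomology module is $HH^n_{\mathrm{Hopf}}(A,A)$. Structure maps. For $f\in\mathcal{C}(k)$, $g_i\in\mathcal{C}(n_i)$, $N_i=n_1+\cdots+n_i$, $N_0=0$, $N=N_k$, define $\gamma(f;g_1,\dots,g_k)\in\mathcal{C}(N)$ by $\gamma(f;g_1,\dots,g_k)(a_{0,N+1})=f(a_0\otimes g_1(1\otimes a_{1,N_1}\otimes1)\otimes\cdots\otimes g_k(1\otimes a_{N_{k-1}+1,N_k}\otimes1)\otimes a_{N+1})$ (if $n_i=0$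 the corresponding factor is $g_i(1\otimes1)$); $\mathrm{Id}\in\mathcal{C}(1)$ is $\mathrm{Id}(a_0\otimes a_1\otimes a_2)=a_0a_1a_2$; $\pi\in\mathcal{C}(2)$ is $\pi(a_0\otimes a_1\otimes a_2\otimes a_3)=a_0a_1a_2a_3$. Brace operations. For $x$ of degree $n$ put $\deg x=n$, $|x|=n-1$. Define $x\{x_1,\dots,x_n\}=\sum(-1)^{\varepsilon}\gamma(x;\mathrm{Id},\dots,\mathrm{Id},x_1,\mathrm{Id},\dots,\mathrm{Id},x_n,\mathrm{Id},\dots,\mathrm{Id})$, the sum over all substitutions of $x_1,\dots,x_n$ into $\gamma(x;\dots)$ in the given order, with $\varepsilon=\sum_p|x_p|i_p$, where $i_p$ is the total number of inputs of the composite in front of $x_p$ (each preceding $\mathrm{Id}$ counts $1$, each preceding $x_q$ counts $\deg x_q$). An empty sum is $0$. $G$-algebra (Gerstenhaber algebra). A $G$-algebra $(V,\cup,[-,-])$ is a graded vector space $V=\bigoplus V^n$ with a degree $0$ associative product $\cup$ and a degree $-1$ graded Lie bracket $[-,-]:V^m\otimes V^n\to V^{m+n-1}$ (a graded Lie bracket with respect to the grading $|\cdot|=\deg-1$) such that $x\cup y=(-1)^{\deg x\deg y}y\cup x$ and $[x,y\cup z]=[x,y]\cup z+(-1)^{|x|\deg y}y\cup[x,z]$. *)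

(* Defs.v *)
From HB Require Import structures.
From mathcomp Require Import all_boot all_order all_algebra.
From mathcomp Require Import generic_quotient ring_quotient.
From mathcomp Require Import boolp functions.
From mathcomp.multinomials Require Import freeg.

Set Implicit Arguments.
Unset Strict Implicit.
Unset Printing Implicit Defensive.

Import GRing.Theory.
Local Open Scope ring_scope.
Local Open Scope quotient_scope.

(* Quotient of a vector space by a linear subspace. *)
Section QuotientSpace.
Variables (K : pzRingType) (V : lmodType K) (S : {pred V}).

Definition subspace_pred of submod_closed S : {pred V} := S.
Variable hS : submod_closed S.
HB.instance Definition _ :=
  GRing.isSubmodClosed.Build K V (subspace_pred hS) hS.

Definition qspace := Quotient.quot (subspace_pred hS).
HB.instance Definition _ := GRing.Zmodule.on qspace.
HB.instance Definition _ :
  EqQuotient V (Quotient.equiv (subspace_pred hS)) qspace := EqQuotient.on qspace.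

Definition qscale (a : K) (u : qspace) : qspace := \pi_qspace (a *: repr u).

Fact pi_eqE (u v : V) : (\pi_qspace u == \pi_qspace v) = (u - v \in S).
Proof. exact/esym/(Quotient.idealrBE (subspace_pred hS)). Qed.

Fact piD (u v : V) : \pi_qspace (u + v) = \pi_qspace u + \pi_qspace v.
Proof. exact: (Quotient.pi_add (subspace_pred hS)). Qed.

Fact qscale_pi a (u : V) : qscale a (\pi_qspace u) = \pi_qspace (a *: u).
Proof.
apply/eqP; rewrite pi_eqE -scalerBr.
by apply: (@rpredZ _ _ (subspace_pred hS)); rewrite -pi_eqE reprK.
Qed.

Fact pi_surj (u : qspace) : exists v, u = \pi_qspace v.
Proof. by exists (repr u); rewrite reprK. Qed.

Fact qscaleA a b u : qscale a (qscale b u) = qscale (a * b) u.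
Proof. by have [v ->] := pi_surj u; rewrite !qscale_pi scalerA. Qed.
Fact qscale1 : left_id 1 qscale.
Proof. by move=> u; have [v ->] := pi_surj u; rewrite qscale_pi scale1r. Qed.
Fact qscaleDr : right_distributive qscale +%R.
Proof.
move=> a u v; have [x ->] := pi_surj u; have [y ->] := pi_surj v.
by rewrite -piD !qscale_pi scalerDr piD.
Qed.
Fact qscaleDl u : {morph qscale^~ u : a b / a + b}.
Proof.
by have [v ->] := pi_surj u => a b; rewrite !qscale_pi scalerDl piD.
Qed.

HB.instance Definition _ := GRing.Zmodule_isLmodule.Build K qspace
  qscaleA qscale1 qscaleDr qscaleDl.

Lemma pi_linear : linear \pi_qspace.
Proof. by move=> a u v; rewrite piD -qscale_pi. Qed.
End QuotientSpace.

Section FreeModule.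
Variables (K : fieldType) (T : choiceType).

Definition freemod := {freeg T / K}.
HB.instance Definition _ := GRing.Lmodule.on freemod.
Definition fgen (x : T) : freemod := << x >>.
Definition flift (W : lmodType K) (f : T -> W) (u : freemod) : W := fglift f u.

Fact freemod_ind (P : freemod -> Prop) :
  P 0 -> (forall k x u, P u -> P (k *: fgen x + u)) -> forall u, P u.
Proof.
move=> P0 PS; elim/freeg_ind_dom0 => [|k x u _ _ IHu]; first exact: P0.
suff -> : << k *g x >> = k *: fgen x by exact: PS.
by apply/eqP/freeg_eqP => y; rewrite coeffZ !coeffU mul1r.
Qed.

Variable W : lmodType K.
Implicit Types f g h : T -> W.

Fact flift_gen f x : flift f (fgen x) = f x.
Proof. by rewrite /flift liftU scale1r. Qed.

Fact flift_zmod f : zmod_morphism (flift f).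
Proof. exact: lift_is_additive. Qed.
HB.instance Definition _ f :=
  GRing.isZmodMorphism.Build freemod W (flift f) (flift_zmod f).

Fact flift_scalable f : scalable (flift f).
Proof.
have fZ a x : flift f (a *: fgen x) = a *: f x.
  suff -> : a *: fgen x = << a *g x >> by exact: liftU.
  by apply/eqP/freeg_eqP => y; rewrite coeffZ !coeffU mul1r.
move=> a; elim/freemod_ind => [|k x u IHu].
  by rewrite scaler0 raddf0 scaler0.
by rewrite scalerDr scalerA !raddfD /= IHu !fZ scalerA.
Qed.
HB.instance Definition _ f :=
  GRing.isScalable.Build K freemod W *:%R (flift f) (flift_scalable f).

Fact flift_fun_linear f g h a u :
  (forall x, f x = a *: g x + h x) -> flift f u = a *: flift g u + flift h u.
Proof.
move=> fE; elim/freemod_ind: u => [|k x u IHu].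
  by rewrite !linear0 addr0.
have liftE (q : T -> W) : flift q (k *: fgen x + u) = k *: q x + flift q u.
  by rewrite linearP /= flift_gen.
by rewrite !liftE IHu fE !scalerDr !scalerA [k * a]mulrC addrACA.
Qed.
End FreeModule.

(* The tensor product of the family V is the free vector space on the product
   of the V i modulo the span of the multilinearity relations; dfwith v x is the
   family v with its i-th entry replaced by x : V i.  tlift f is the linear map
   induced by f; it is defined for every f, but is only used for multilinear f, for
   which it has the expected properties (tlift_linear, tlift_pure).  Sweedler sums are written
   with tlift: "sum of f b_(1) b_(2)" is blift f (comul b). *)
Section Tensor.
Variables (K : fieldType) (I : eqType) (V : I -> lmodType K).

Definition famT := {classic (forall i, V i)}.

Inductive tensor_rel : freemod K famT -> Prop :=
| tensor_rel_gen (v : forall i, V i) i a (x y : V i) :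
    tensor_rel (fgen K (dfwith v (a *: x + y))
                - (a *: fgen K (dfwith v x) + fgen K (dfwith v y)))
| tensor_rel0 : tensor_rel 0
| tensor_rel_lin a u w :
    tensor_rel u -> tensor_rel w -> tensor_rel (a *: u + w).

Definition tensor_relb : {pred freemod K famT} :=
  [pred u | `[< tensor_rel u >]].
Fact tensor_rel_submod : submod_closed tensor_relb.
Proof.
split; first by apply/asboolP; exact: tensor_rel0.
by move=> a u w /asboolP hu /asboolP hw; apply/asboolP; exact: tensor_rel_lin.
Qed.

Definition tensor : lmodType K := qspace tensor_rel_submod.
Definition pure (v : forall i, V i) : tensor :=
  \pi_(qspace tensor_rel_submod) (fgen K (v : famT)).

Definition tlift (W : lmodType K) (f : (forall i, V i) -> W) (t : tensor) : W :=
  flift (f : famT -> W) (repr (t : qspace tensor_rel_submod)).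

Definition multilinear (W : lmodType K) (f : (forall i, V i) -> W) :=
  forall v i a (x y : V i),
    f (dfwith v (a *: x + y)) = a *: f (dfwith v x) + f (dfwith v y).

Fact flift_rel (W : lmodType K) (f : (forall i, V i) -> W) :
  multilinear f -> forall u, tensor_rel u -> flift (f : famT -> W) u = 0.
Proof.
move=> fml u; elim=> [v i a x y||a {}u w _ uE _ wE].
- by rewrite linearB linearD linearZ /= !flift_gen fml subrr.
- exact: linear0.
- by rewrite linearP /= uE wE scaler0 addr0.
Qed.

Fact tensor_rel_pi u v :
  \pi_(qspace tensor_rel_submod) u = \pi_(qspace tensor_rel_submod) v ->
  tensor_rel (u - v).
Proof. by move/eqP; rewrite pi_eqE => /asboolP. Qed.

Lemma tlift_linear (W : lmodType K) (f : (forall i, V i) -> W) :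
  multilinear f -> linear (tlift f).
Proof.
move=> fml a u v; apply/eqP; rewrite -subr_eq0 /tlift -linearP -linearB /=.
apply/eqP/(flift_rel fml)/tensor_rel_pi.
by rewrite reprK pi_linear !reprK.
Qed.

Lemma tlift_pure (W : lmodType K) (f : (forall i, V i) -> W) v :
  multilinear f -> tlift f (pure v) = f v.
Proof.
move=> fml; rewrite -[RHS](flift_gen (f : famT -> W)).
apply/eqP; rewrite -subr_eq0 /tlift -linearB /=.
by apply/eqP/(flift_rel fml)/tensor_rel_pi; rewrite reprK.
Qed.

Lemma tlift_fun_linear (W : lmodType K) (f g h : (forall i, V i) -> W) a t :
  (forall v, f v = a *: g v + h v) ->
  tlift f t = a *: tlift g t + tlift h t.
Proof. exact: flift_fun_linear. Qed.

Lemma pure_multilinear : multilinear pure.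
Proof.
move=> v i a x y; rewrite /pure -pi_linear; apply/eqP; rewrite pi_eqE.
by apply/asboolP; exact: tensor_rel_gen.
Qed.

End Tensor.

Definition btensor (K : fieldType) (U V : lmodType K) : lmodType K :=
  tensor (fun i : bool => if i then V else U).

Section BinaryTensor.
Variables (K : fieldType) (U V : lmodType K).

Definition bpure (u : U) (v : V) : btensor U V :=
  pure (fun i : bool =>
    match i return (if i then V else U : lmodType K) with
    | true => v | false => u end).

Definition blift (W : lmodType K) (f : U -> V -> W) (t : btensor U V) : W :=
  tlift (fun w => f (w false) (w true)) t.
End BinaryTensor.
Notation "u '⊗' v" := (bpure u v) (at level 40, left associativity) : ring_scope.

Definition tpow (K : fieldType) (n : nat) (V : lmodType K) : lmodType K :=
  tensor (fun _ : 'I_n => V).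

Section Words.
Variable T : Type.

Definition vcons n (x : T) (w : 'I_n -> T) : 'I_n.+1 -> T :=
  fun i => oapp w x (unlift ord0 i).
Definition vrcons n (w : 'I_n -> T) (y : T) : 'I_n.+1 -> T :=
  fun i => oapp w y (unlift ord_max i).
Definition vbar n (x : T) (w : 'I_n -> T) (y : T) : 'I_n.+2 -> T :=
  vcons x (vrcons w y).
End Words.

(* algType is not used here because MathComp's algebras are nontrivial, which
   would exclude A = 0.  (A bialgebra is nonzero since its counit maps 1 to 1.) *)
HB.mixin Record Lmodule_isAssocAlgebra (K : fieldType) A of GRing.Lmodule K A := {
  amul : A -> A -> A;
  aone : A;
  amulA : associative amul;
  amul1l : left_id aone amul;
  amul1r : right_id aone amul;
  amul_linearl : forall y, linear (amul^~ y);
  amul_linearr : forall x, linear (amul x)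
}.
#[short(type="assocAlgType")]
HB.structure Definition AssocAlgebra (K : fieldType) :=
  {A of GRing.Lmodule K A & Lmodule_isAssocAlgebra K A}.
Notation "x '∗' y" := (amul x y) (at level 40, left associativity) : ring_scope.

Record is_bialgebra (K : fieldType) (H : algType K)
    (comul : {linear H -> btensor H H}) (counit : {linear H -> K^o}) : Prop := {
  comulA : forall b,
    blift (fun b1 b2 => blift (fun b11 b12 => b11 ⊗ (b12 ⊗ b2)) (comul b1))
      (comul b) =
    blift (fun b1 b2 => blift (fun b21 b22 => b1 ⊗ (b21 ⊗ b22)) (comul b2))
      (comul b);
  counitl : forall b, blift (fun b1 b2 => (counit b1 : K) *: b2) (comul b) = b;
  counitr : forall b, blift (fun b1 b2 => (counit b2 : K) *: b1) (comul b) = b;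
  comulM : forall b c,
    comul (b * c) =
    blift (fun b1 b2 => blift (fun c1 c2 => (b1 * c1) ⊗ (b2 * c2)) (comul c))
      (comul b);
  comul1 : comul 1 = 1 ⊗ 1;
  counitM : forall b c, counit (b * c) = counit b * counit c;
  counit1 : counit 1 = 1
}.

Record is_module_algebra (K : fieldType) (H : algType K) (A : assocAlgType K)
    (comul : {linear H -> btensor H H}) (counit : {linear H -> K^o})
    (act : H -> {linear A -> A}) : Prop := {
  act_linear : forall a, linear (fun b => act b a);
  act_one : forall a, act 1 a = a;
  act_mul : forall b c a, act (b * c) a = act b (act c a);
  act_prod : forall b a1 a2,
    act b (a1 ∗ a2) = blift (fun b1 b2 => act b1 a1 ∗ act b2 a2) (comul b);
  act_unit : forall b, act b aone = (counit b : K) *: aone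
}.

Section HopfHochschild.
Variables (K : fieldType) (H : algType K) (A : assocAlgType K).
Variables (comul : {linear H -> btensor H H}) (act : H -> {linear A -> A}).

(* itercomul n b is the sum of b_(1) ⊗ ... ⊗ b_(n+1). *)
Fixpoint itercomul n : H -> tpow n.+1 H :=
  if n is m.+1 then fun b =>
    blift (fun b1 b2 =>
      tlift (fun w => pure (vcons b1 w) : tpow m.+2 H) (itercomul m b2)) (comul b)
  else fun b => pure (fun _ => b).

(* The space X = A ⊗ A ⊗ H underlying the crossed product algebra, with its
   actions on A and on the (n+2)-fold tensor power of A: Hom_X only involves
   these actions, not the product of X. *)
Definition crossed : lmodType K := btensor (btensor A A) H.

Definition crossed_act (x : crossed) (a0 : A) : A :=
  blift (fun aa b => blift (fun a a' => a ∗ act b a0 ∗ a') aa) x.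

Definition CB n : lmodType K := tpow n.+2 A.

Definition crossed_actCB n (x : crossed) (t : CB n) : CB n :=
  blift (fun aa b => blift (fun a a' =>
    tlift (fun h : 'I_n.+2 -> H =>
      tlift (fun v : 'I_n.+2 -> A =>
        pure (vbar (a ∗ act (h ord0) (v ord0))
                   (fun i : 'I_n => act (h (inord i.+1)) (v (inord i.+1)))
                   (act (h ord_max) (v ord_max) ∗ a')) : CB n)
      t) (itercomul n.+1 b)) aa) x.

Definition face n (j : 'I_n.+2) : CB n.+1 -> CB n :=
  tlift (fun a : 'I_n.+3 -> A =>
    pure (fun i : 'I_n.+2 =>
      if (i < j)%N then a (inord i)
      else if i == j then a (inord i) ∗ a (inord i.+1)
      else a (inord i.+1)) : CB n).

(* This is the differential of degree n + 1, from CB_(n+1) to CB_n. *)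
Definition dCB n (t : CB n.+1) : CB n := \sum_(j < n.+2) (-1) ^+ j *: face j t.

Definition hom_crossed n (f : CB n -> A) : Prop :=
  linear f /\ forall x t, f (crossed_actCB x t) = crossed_act x (f t).

Definition dCH n (f : CB n -> A) : CB n.+1 -> A := f \o @dCB n.

Definition cocycle n : {pred CB n -> A} :=
  [pred f | `[< hom_crossed f /\ dCH f = 0 >]].

Definition is_coboundary n : (CB n -> A) -> Prop :=
  if n is m.+1 then fun f => exists2 g, hom_crossed g & f = @dCH m g
  else fun f => f = 0.

Arguments cocycle n : clear implicits.

Fact crossed_act_linear x : linear (crossed_act x).
Proof.
move=> k a b; apply: tlift_fun_linear => v; apply: tlift_fun_linear => w.
by rewrite linearP amul_linearr amul_linearl.
Qed.

Fact hom_crossed_lin n k (f g : CB n -> A) :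
  hom_crossed f -> hom_crossed g -> hom_crossed (k *: f + g).
Proof.
move=> [fl fx] [gl gx].
have E t : (k *: f + g) t = k *: f t + g t by [].
split=> [a u v|x t]; rewrite !E.
  by rewrite fl gl !scalerDr !scalerA [k * a]mulrC addrACA.
by rewrite fx gx crossed_act_linear.
Qed.

Fact hom_crossed0 n : hom_crossed (0 : CB n -> A).
Proof.
have E t : (0 : CB n -> A) t = 0 by [].
split=> [a u v|x t]; rewrite !E; first by rewrite scaler0 addr0.
have := crossed_act_linear x (-1) 0 0.
by rewrite scaler0 addr0 scaleN1r addNr => ->.
Qed.

Fact cocycle_submod n : submod_closed (cocycle n).
Proof.
split; first by apply/asboolP; split; [exact: hom_crossed0 | exact/funext].
move=> k f g /asboolP[fh fd] /asboolP[gh gd]; apply/asboolP; split.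
  exact: hom_crossed_lin.
apply/funext => t.
have -> : dCH (k *: f + g) t = k *: dCH f t + dCH g t by [].
by rewrite fd gd [RHS]/(0 : A) -[RHS](scaler0 A k) -[RHS]addr0.
Qed.
HB.instance Definition _ n := GRing.isSubmodClosed.Build K (CB n -> A)
  (cocycle n) (@cocycle_submod n).

Record cocycles n := Cocycle { cochain_of : CB n -> A; _ : cochain_of \in cocycle n }.
HB.instance Definition _ n := [isSub for @cochain_of n].
HB.instance Definition _ n := [Choice of cocycles n by <:].
HB.instance Definition _ n := [SubChoice_isSubZmodule of cocycles n by <:].
HB.instance Definition _ n := [SubZmodule_isSubLmodule of cocycles n by <:].

Definition coboundary n : {pred cocycles n} :=
  [pred z | `[< is_coboundary (val z) >]].

Fact coboundary_submod n : submod_closed (@coboundary n).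
Proof.
case: n => [|n]; split; try by apply/asboolP.
- move=> k f g /asboolP /= f0 /asboolP /= g0; apply/asboolP => /=.
  by rewrite f0 g0 scaler0 addr0.
- apply/asboolP; exists 0; first exact: hom_crossed0.
  exact/funext.
- move=> k f g /asboolP /= [f' fh fE] /asboolP /= [g' gh gE]; apply/asboolP.
  exists (k *: f' + g'); first exact: hom_crossed_lin.
  by rewrite /= fE gE.
Qed.

Definition HH n : lmodType K := qspace (@coboundary_submod n).

Definition HHclass n (f : CB n -> A) (fZ : f \in cocycle n) : HH n :=
  \pi_(qspace (@coboundary_submod n)) (Cocycle fZ).

End HopfHochschild.
Arguments cocycle [K H A] comul act n.
Arguments HH [K H A] comul act n.

(* The operations below are defined on all functions CB A n -> A, whether or not
   they belong to Hom_X(CB_n, A). *)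
Section Braces.
Variables (K : fieldType) (A : assocAlgType K).

Definition cochain := {n : nat & CB A n -> A}.
Definition mkcochain n (f : CB A n -> A) : cochain := Tagged (fun n => CB A n -> A) f.
Definition deg (x : cochain) : nat := tag x.
Definition sdeg (x : cochain) : int := (deg x)%:Z - 1.

(* The degree N of the composite is an explicit parameter so that substitutions
   with equal total degree have the same type: gamma N f g is meaningful only for
   N = \sum_(i < k) deg (g i), and vbar aone w aone is 1 ⊗ w ⊗ 1.  The index
   \sum_(l < i) deg (g l) + j + 1 is that of the j-th input of g i. *)
Definition gamma N k (f : CB A k -> A) (g : 'I_k -> cochain) : CB A N -> A :=
  tlift (fun a : 'I_N.+2 -> A =>
    f (pure (vbar (a ord0)
      (fun i : 'I_k =>
        tagged (g i) (pure (vbar aone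
          (fun j : 'I_(deg (g i)) =>
             a (inord (\sum_(l < k | (l < i)%N) deg (g l) + j).+1))
          aone)))
      (a ord_max)))).

Arguments gamma N [k] f g _.

Definition Idc : cochain :=
  mkcochain (tlift (fun a : 'I_3 -> A =>
    a (inord 0) ∗ a (inord 1) ∗ a (inord 2)) : CB A 1 -> A).
Definition pic : CB A 2 -> A := tlift (fun a : 'I_4 -> A =>
  a (inord 0) ∗ a (inord 1) ∗ a (inord 2) ∗ a (inord 3)).

(* A substitution of x_1, ..., x_n into the k slots of x is a strictly increasing
   map from 'I_n to 'I_k; the remaining slots receive Idc.  All of them yield a
   composite of degree k - n + \sum_p deg x_p, which is the N to be given to
   brace. *)
Definition insertion n k (s : {ffun 'I_n -> 'I_k}) : bool :=
  [forall p : 'I_n, forall q : 'I_n, (p < q)%N ==> (s p < s q)%N].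

Definition fill n k (xs : n.-tuple cochain) (s : {ffun 'I_n -> 'I_k}) (i : 'I_k) :
    cochain :=
  if [pick p | s p == i] is Some p then tnth xs p else Idc.

Definition brace_sign n k (xs : n.-tuple cochain) (s : {ffun 'I_n -> 'I_k}) : int :=
  \sum_(p < n) sdeg (tnth xs p) * (\sum_(i < k | (i < s p)%N) deg (fill xs s i))%:Z.

Definition brace N k (x : CB A k -> A) n (xs : n.-tuple cochain) : CB A N -> A :=
  \sum_(s : {ffun 'I_n -> 'I_k} | insertion s)
     ((-1) ^ brace_sign xs s : K) *: gamma N x (fill xs s).

Arguments brace N [k] x [n] xs _.

Definition cup m n (x : CB A m -> A) (y : CB A n -> A) : CB A (m + n) -> A :=
  ((-1) ^+ m : K) *: brace (m + n) pic [tuple mkcochain x; mkcochain y].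

(* For m = n = 0 both sums are empty and the bracket is 0, so that the truncated
   predecessor is harmless. *)
Definition bracket m n (x : CB A m -> A) (y : CB A n -> A) : CB A (m + n).-1 -> A :=
  brace (m + n).-1 x [tuple mkcochain y]
  - ((-1) ^ (sdeg (mkcochain x) * sdeg (mkcochain y)) : K) *:
    brace (m + n).-1 y [tuple mkcochain x].
End Braces.

(* The direct sum of the V n: families with finitely many nonzero terms. *)
Section DirectSum.
Variables (K : fieldType) (V : nat -> lmodType K).

Record dsum := DSum {
  dsum_coord :> forall n, V n;
  dsum_finite : exists N, forall n, (N <= n)%N -> dsum_coord n = 0
}.

Fact dsum_eq (u v : dsum) : (forall n, u n = v n) -> u = v.
Proof.
case: u v => [u uf] [v vf] /= e.
have euv : u = v by exact: functional_extensionality_dep.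
by case: _ / euv in vf e *; congr DSum; exact: Prop_irrelevance.
Qed.

HB.instance Definition _ := gen_eqMixin dsum.
HB.instance Definition _ := gen_choiceMixin dsum.

Program Definition dsum0 := @DSum (fun n => 0) _.
Next Obligation. by exists 0%N. Qed.
Program Definition dsumD (u v : dsum) := @DSum (fun n => u n + v n) _.
Next Obligation.
have [M uM] := dsum_finite u; have [N vN] := dsum_finite v.
exists (maxn M N) => n; rewrite geq_max => /andP[Mn Nn].
by rewrite uM // vN // addr0.
Qed.
Program Definition dsumN (u : dsum) := @DSum (fun n => - u n) _.
Next Obligation.
by have [M uM] := dsum_finite u; exists M => n Mn; rewrite uM // oppr0.
Qed.
Program Definition dsumZ (a : K) (u : dsum) := @DSum (fun n => a *: u n) _.
Next Obligation.
by have [M uM] := dsum_finite u; exists M => n Mn; rewrite uM // scaler0.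
Qed.

Fact dsumA : associative dsumD.
Proof. by move=> u v w; apply: dsum_eq => n /=; rewrite addrA. Qed.
Fact dsumC : commutative dsumD.
Proof. by move=> u v; apply: dsum_eq => n /=; rewrite addrC. Qed.
Fact dsum0D : left_id dsum0 dsumD.
Proof. by move=> u; apply: dsum_eq => n /=; rewrite add0r. Qed.
Fact dsumND : left_inverse dsum0 dsumN dsumD.
Proof. by move=> u; apply: dsum_eq => n /=; rewrite addNr. Qed.
HB.instance Definition _ := GRing.isZmodule.Build dsum dsumA dsumC dsum0D dsumND.

Fact dsumZA a b u : dsumZ a (dsumZ b u) = dsumZ (a * b) u.
Proof. by apply: dsum_eq => n /=; rewrite scalerA. Qed.
Fact dsum1Z : left_id 1 dsumZ.
Proof. by move=> u; apply: dsum_eq => n /=; rewrite scale1r. Qed.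
Fact dsumZDr : right_distributive dsumZ +%R.
Proof. by move=> a u v; apply: dsum_eq => n /=; rewrite scalerDr. Qed.
Fact dsumZDl u : {morph dsumZ^~ u : a b / a + b}.
Proof. by move=> a b; apply: dsum_eq => n /=; rewrite scalerDl. Qed.
HB.instance Definition _ := GRing.Zmodule_isLmodule.Build K dsum
  dsumZA dsum1Z dsumZDr dsumZDl.

Program Definition dsum_in n (x : V n) : dsum :=
  @DSum (dfwith (fun m => 0 : V m) x) _.
Next Obligation.
exists n.+1 => m nm; rewrite dfwith_out //.
by apply: contraTneq nm => ->; rewrite ltnn.
Qed.
End DirectSum.

(* The grading is by natural numbers, so V^(-1) = 0 and the bracket of two
   elements of degree 0 vanishes. *)
Record is_G_algebra (K : fieldType) (V : nat -> lmodType K)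
    (cup brk : dsum V -> dsum V -> dsum V) : Prop := {
  G_cup_linearl : forall v, linear (cup^~ v);
  G_cup_linearr : forall u, linear (cup u);
  G_cup_deg : forall m n (x : V m) (y : V n),
    exists z : V (m + n)%N, cup (dsum_in x) (dsum_in y) = dsum_in z;
  G_cupA : associative cup;
  G_cupC : forall m n (x : V m) (y : V n),
    cup (dsum_in x) (dsum_in y) =
    ((-1) ^ (m%:Z * n%:Z) : K) *: cup (dsum_in y) (dsum_in x);
  G_brk_linearl : forall v, linear (brk^~ v);
  G_brk_linearr : forall u, linear (brk u);
  G_brk_deg0 : forall x y : V 0%N, brk (dsum_in x) (dsum_in y) = 0;
  G_brk_deg : forall m n (x : V m) (y : V n), (0 < m + n)%N ->
    exists z : V (m + n).-1, brk (dsum_in x) (dsum_in y) = dsum_in z;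
  G_brk_antisym : forall m n (x : V m) (y : V n),
    brk (dsum_in x) (dsum_in y) =
    - ((-1) ^ ((m%:Z - 1) * (n%:Z - 1)) : K) *: brk (dsum_in y) (dsum_in x);
  G_jacobi : forall m n p (x : V m) (y : V n) (z : V p),
    brk (dsum_in x) (brk (dsum_in y) (dsum_in z)) =
    brk (brk (dsum_in x) (dsum_in y)) (dsum_in z)
    + ((-1) ^ ((m%:Z - 1) * (n%:Z - 1)) : K) *:
      brk (dsum_in y) (brk (dsum_in x) (dsum_in z));
  G_poisson : forall m n p (x : V m) (y : V n) (z : V p),
    brk (dsum_in x) (cup (dsum_in y) (dsum_in z)) =
    cup (brk (dsum_in x) (dsum_in y)) (dsum_in z)
    + ((-1) ^ ((m%:Z - 1) * n%:Z) : K) *: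
      cup (dsum_in y) (brk (dsum_in x) (dsum_in z))
}.

(* Main.v *)
(* A cochain in Hom_X(A^(n+2), A) is determined by its values on 1 ⊗ a ⊗ 1, i.e. by an
   H-equivariant multilinear function of words a_1 ... a_n.  On functions of words, the
   convolution product (F * G)(w) = sum over w = uv of F(u) G(v) is associative, and
   F |-> F{y} (insertion of y with Koszul signs) is a twisted derivation of it.  Words act
   on multilinear functionals by endomorphisms, w |-> L_w; as L is multiplicative,
   L{y} = σ(L) * L_y * L with L_y(w) = L_(y w) and σ a sign twist, so the commutation rules
   for insertions (hence the Jacobi identity) follow from the derivation rule.  With i the
   identity cochain, the product of A is i * i and the differential is
   x |-> i * x - x{i * i} - σ(x) * i; in cohomology, commutativity of the product and the
   Leibniz rule for the bracket hold with the homotopies x{y} and x{y, z}. *)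
Require Import Defs.
From HB Require Import structures.
From mathcomp Require Import all_boot all_order all_algebra.
From mathcomp Require Import generic_quotient boolp functions zify.

Set Implicit Arguments.
Unset Strict Implicit.
Unset Printing Implicit Defensive.

Import GRing.Theory.
Local Open Scope ring_scope.
Local Open Scope quotient_scope.

(** The derivation rule computes insertions into convolution products, and a cochain is in general
    not such a product; this is the reason for passing to operators. A multiadditive [F] is the
    composite of the multiplicative function w |-> L_w with the additive map f |-> (f F)(empty
    word), and insertion commutes with additive maps of the values, so an identity proved for L
    holds for every [F]. Signs depend only on parities and are carried as Booleans; after a case
    distinction on a few parities, each identity is one of abelian groups and is decided by
    reflection. The recurring obstacle is the degree shift: [(m + n).-1] has the wrong value and the
    wrong parity for m = n = 0. The terms concerned vanish, but each such case needs its own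
    argument. Equivariance is preserved by all operations because the iterated coproduct can be cut
    wherever a word is cut. *)

Inductive zexp := ZAtom of nat | ZZero | ZAdd of zexp & zexp | ZOpp of zexp.

(** * Identities in abelian groups by reflection *)

Section ZmodReflection.
Variables (V : zmodType) (env : seq V).

Fixpoint zden (e : zexp) : V :=
  match e with
  | ZAtom i => env`_i
  | ZZero => 0
  | ZAdd e1 e2 => zden e1 + zden e2
  | ZOpp e1 => - zden e1
  end.

Fixpoint zcoef (e : zexp) (i : nat) : int :=
  match e with
  | ZAtom j => if j == i then 1 else 0
  | ZZero => 0
  | ZAdd e1 e2 => zcoef e1 i + zcoef e2 i
  | ZOpp e1 => - zcoef e1 i
  end.

Fact zden_coef e : zden e = \sum_(i < size env) env`_i *~ zcoef e i.
Proof.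
elim: e => [j||e1 IH1 e2 IH2|e IH] /=.
- have [js|js] := ltnP j (size env).
    rewrite (bigD1 (Ordinal js)) //= eqxx big1 ?addr0 // => i.
    by rewrite -val_eqE /= eq_sym => /negPf ->.
  rewrite nth_default // big1 // => i _.
  by rewrite gtn_eqF // (leq_trans _ js).
- by rewrite big1.
- by rewrite IH1 IH2 -big_split; apply: eq_bigr => i _; rewrite mulrzDr.
- by rewrite IH -sumrN; apply: eq_bigr => i _; rewrite mulrNz.
Qed.

(** Integer coefficients on the atoms determine a combination; their comparison is a closed
    computation although the atoms are opaque. *)
Lemma zmod_reflect n e1 e2 : size env = n ->
  all (fun i => zcoef e1 i == zcoef e2 i) (iota 0 n) -> zden e1 = zden e2.
Proof.
move=> <- /allP E; rewrite !zden_coef; apply: eq_bigr => i _; congr (_ *~ _).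
by apply/eqP/E; rewrite mem_iota add0n ltn_ord.
Qed.
End ZmodReflection.

(* Atoms are compared by unification because the same term may occur with
   different paths in the algebraic hierarchy. *)
Ltac zmod_index a env :=
  match env with
  | ?b :: _ => let _ := match goal with _ => unify a b end in constr:(0%N)
  | _ :: ?env' => let n := zmod_index a env' in constr:(n.+1)
  end.
Ltac zmod_env env t :=
  lazymatch t with
  | (?a + ?b)%R => let env1 := zmod_env env a in zmod_env env1 b
  | (- ?a)%R => zmod_env env a
  | 0%R => env
  | _ => match env with
         | _ => let n := zmod_index t env in env
         | _ => constr:(t :: env)
         end
  end.
Ltac zmod_reify env t :=
  lazymatch t with
  | (?a + ?b)%R =>
      let e1 := zmod_reify env a in let e2 := zmod_reify env b in constr:(ZAdd e1 e2)
  | (- ?a)%R => let e := zmod_reify env a in constr:(ZOpp e)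
  | 0%R => constr:(ZZero)
  | _ => let n := zmod_index t env in constr:(ZAtom n)
  end.
Ltac zmod :=
  lazymatch goal with
  | |- @eq ?V ?x ?y =>
    let env0 := constr:(@nil V) in
    let env1 := zmod_env env0 x in let env := zmod_env env1 y in
    let e1 := zmod_reify env x in let e2 := zmod_reify env y in
    apply: (@zmod_reflect _ env _ e1 e2); [reflexivity | vm_compute; reflexivity]
  end.

(** * Convolution of functions on words *)

Section Convolution.
Variables (T : Type) (R : pzRingType).

Definition conv : Type := seq T -> R.
HB.instance Definition _ := GRing.Zmodule.on conv.

Fixpoint convm (F G : seq T -> R) (w : seq T) : R :=
  if w is a :: w' then F [::] * G w + convm (fun u => F (a :: u)) G w'
  else F [::] * G [::].

Definition conv1 (w : seq T) : R := if w is [::] then 1 else 0.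

Fact convmDl F1 F2 G w :
  convm (fun u => F1 u + F2 u) G w = convm F1 G w + convm F2 G w.
Proof.
elim: w F1 F2 => [|a w IH] F1 F2 /=; first by rewrite mulrDl.
by rewrite mulrDl IH addrACA.
Qed.
Fact convmDr F G1 G2 w :
  convm F (fun u => G1 u + G2 u) w = convm F G1 w + convm F G2 w.
Proof.
elim: w F => [|a w IH] F /=; first by rewrite mulrDr.
by rewrite mulrDr IH addrACA.
Qed.
Fact convmZl k F G w : convm (fun u => k * F u) G w = k * convm F G w.
Proof.
elim: w F => [|a w IH] F /=; first by rewrite mulrA.
by rewrite IH mulrDr mulrA.
Qed.
(* Locked: otherwise unification unfolds [(F * G) (a :: w)] into a sum. *)
Fact cmul_key : unit. Proof. exact: tt. Qed.
Definition cmul : conv -> conv -> conv := locked_with cmul_key convm.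
Fact cmulE F G w : cmul F G w = convm F G w.
Proof. by rewrite /cmul unlock. Qed.

Fact cmulA : associative cmul.
Proof.
move=> F G H; apply/funext => w; rewrite !cmulE /cmul unlock.
elim: w F => [|a w IH] F /=; first by rewrite mulrA.
by rewrite convmDl convmZl (IH (fun u => F (a :: u))) mulrDr mulrA addrA.
Qed.
Fact cmul1l : left_id (conv1 : conv) cmul.
Proof.
have Z G w : convm (fun=> 0) G w = 0.
  by elim: w => [|a w IH] /=; rewrite mul0r ?add0r.
by move=> F; apply/funext => -[|a w]; rewrite cmulE /= mul1r ?Z ?addr0.
Qed.
Fact cmul1r : right_id (conv1 : conv) cmul.
Proof.
move=> F; apply/funext => w; rewrite cmulE.
elim: w F => [|a w IH] F /=; first by rewrite mulr1.
by rewrite mulr0 add0r (IH (fun u => F (a :: u))).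
Qed.
Fact cmulDl : left_distributive cmul +%R.
Proof. by move=> F1 F2 G; apply/funext => w; rewrite /cmul unlock -[RHS]convmDl. Qed.
Fact cmulDr : right_distributive cmul +%R.
Proof. by move=> F1 F2 G; apply/funext => w; rewrite /cmul unlock -[RHS]convmDr. Qed.
HB.instance Definition _ := GRing.Zmodule_isPzRing.Build conv
  cmulA cmul1l cmul1r cmulDl cmulDr.

Lemma conv_nil (F G : conv) : (F * G) [::] = F [::] * G [::].
Proof. by rewrite /GRing.mul /= !cmulE. Qed.
Lemma conv_cons (F G : conv) a w :
  (F * G) (a :: w) = F [::] * G (a :: w) + (((fun u => F (a :: u)) : conv) * G) w.
Proof. by rewrite /GRing.mul /= !cmulE. Qed.
End Convolution.

(** The sign has a Boolean exponent, so that it needs no scalars and disappears under case analysis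
    on a parity. *)
Definition sgn (V : zmodType) (b : bool) (x : V) : V := if b then - x else x.

Section Signs.
Variables (V : zmodType).
Implicit Types x y : V.
Lemma sgnD b x y : sgn b (x + y) = sgn b x + sgn b y.
Proof. by rewrite /sgn; case: b; rewrite ?opprD. Qed.
Lemma sgn0 b : sgn b (0 : V) = 0.
Proof. by rewrite /sgn; case: b; rewrite /= ?oppr0. Qed.
Lemma sgnN b x : sgn b (- x) = - sgn b x.
Proof. by rewrite /sgn; case: b. Qed.
Lemma sgn_sgn b c x : sgn b (sgn c x) = sgn (b (+) c) x.
Proof. by rewrite /sgn; case: b; case: c; rewrite /= ?opprK. Qed.
Lemma raddf_sgn (W : zmodType) (h : {additive V -> W}) b x :
  h (sgn b x) = sgn b (h x).
Proof. by rewrite /sgn; case: b; rewrite /= ?raddfN. Qed.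
End Signs.
Lemma sgn_fun (T : Type) (V : zmodType) b (F : T -> V) w : (sgn b F) w = sgn b (F w).
Proof. by rewrite /sgn; case: b. Qed.
Lemma sgnMl (R : pzRingType) b (x y : R) : sgn b x * y = sgn b (x * y).
Proof. by rewrite /sgn; case: b; rewrite /= ?mulNr. Qed.
Lemma sgnMr (R : pzRingType) b (x y : R) : x * sgn b y = sgn b (x * y).
Proof. by rewrite /sgn; case: b; rewrite /= ?mulrN. Qed.
Lemma sgnZ (K : pzRingType) (V : lmodType K) b k (x : V) :
  k *: sgn b x = sgn b (k *: x).
Proof. by rewrite /sgn; case: b; rewrite /= ?scalerN. Qed.
Lemma sgnE (K : pzRingType) (V : lmodType K) (b : bool) (x : V) :
  ((-1) ^+ b : K) *: x = sgn b x.
Proof. by rewrite /sgn; case: b; rewrite /= ?expr1 ?scaleN1r ?expr0 ?scale1r. Qed.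

(** * Insertions into functions on words *)

Section Insertions.
Variable T : Type.

Section General.
Variables V W : zmodType.
Implicit Types (F G : seq T -> V) (f : seq T -> seq T -> V).

(** The only cut of [w] to which a left factor of degree [n] can contribute; a word that is too
    short has no such cut, whence the value 0. *)
Definition cutp n f (w : seq T) : V :=
  if (n <= size w)%N then f (take n w) (drop n w) else 0.

Lemma cutp0 f w : cutp 0 f w = f [::] w.
Proof. by rewrite /cutp take0 drop0. Qed.
Lemma cutpS_nil n f : cutp n.+1 f [::] = 0.
Proof. by []. Qed.
Lemma cutpS_cons n f a w : cutp n.+1 f (a :: w) = cutp n (fun v => f (a :: v)) w.
Proof. by []. Qed.
Lemma cutp_add n f g w :
  cutp n (fun v t => f v t + g v t) w = cutp n f w + cutp n g w.
Proof. by rewrite /cutp; case: leqP; rewrite ?addr0. Qed.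
Lemma eq_cutp n f g w :
  (forall v t, size v = n -> w = v ++ t -> f v t = g v t) ->
  cutp n f w = cutp n g w.
Proof.
rewrite /cutp; case: leqP => // le_nw; apply; last by rewrite cat_take_drop.
by rewrite size_take; case: ltngtP le_nw.
Qed.

(** For [b = true] this is the automorphism (-1)^|w| of the grading by word length. The Boolean is
    the parity of n - 1 for a cochain of degree n that is moved past the word. *)
Definition twist (b : bool) F (w : seq T) : V := sgn (b && odd (size w)) (F w).

(* The insertion F{y} of a cochain y of degree n:
   [ins n y F w] is the sum over w = u v t with |v| = n of (-1)^((n-1)|u|) F(u y(v) t).
   The parity of n - 1 is [~~ odd n]. *)
Fixpoint ins n (y : seq T -> T) F (w : seq T) : V :=
  cutp n (fun v t => F (y v :: t)) w +
  (if w is a :: w' then sgn (~~ odd n) (ins n y (fun u => F (a :: u)) w') else 0).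

(* The brace F{y, z}: y and z are inserted in this order, with signs
   (-1)^((n-1)|u| + (p-1)i), where i is the number of letters in front of the word
   to which z is applied. *)
Fixpoint ins2 n (y : seq T -> T) p (z : seq T -> T) F (w : seq T) : V :=
  cutp n (fun v t => sgn (~~ odd p && odd n) (ins p z (fun u => F (y v :: u)) t)) w +
  (if w is a :: w' then
     sgn (~~ odd n (+) ~~ odd p) (ins2 n y p z (fun u => F (a :: u)) w')
   else 0).
End General.

Section Naturality.
Variables V W : zmodType.
Implicit Types (F G : seq T -> V) (h : {additive V -> W}).

Lemma cutp_nat h n f w : h (cutp n f w) = cutp n (fun v t => h (f v t)) w.
Proof. by rewrite /cutp; case: leqP; rewrite ?raddf0. Qed.
(** [F] enters linearly through its values, which are never fed to another function; this is what
    carries identities from operators to functionals. *)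
Lemma ins_nat h n y F w : h (ins n y F w) = ins n y (fun u => h (F u)) w.
Proof.
elim: w F => [|a w IH] F /=; rewrite raddfD /= cutp_nat ?raddf0 //.
by rewrite raddf_sgn IH.
Qed.
Lemma ins2_nat h n y p z F w :
  h (ins2 n y p z F w) = ins2 n y p z (fun u => h (F u)) w.
Proof.
elim: w F => [|a w IH] F /=; rewrite raddfD /= cutp_nat ?raddf0.
  by congr (_ + _); apply: eq_cutp => v t _ _; rewrite raddf_sgn ins_nat.
rewrite raddf_sgn IH; congr (_ + _).
by apply: eq_cutp => v t _ _; rewrite raddf_sgn ins_nat.
Qed.

Lemma insD n y F G : ins n y (F + G) = ins n y F + ins n y G.
Proof.
apply/funext => w; change (ins n y (F + G) w = ins n y F w + ins n y G w).
elim: w F G => [|a w IH] F G /=.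
  by rewrite (cutp_add n (fun v t => F (y v :: t))) !addr0.
rewrite (cutp_add n (fun v t => F (y v :: t))).
by rewrite (IH (fun u => F (a :: u))) sgnD addrACA.
Qed.
Lemma ins2D n y p z F G : ins2 n y p z (F + G) = ins2 n y p z F + ins2 n y p z G.
Proof.
have E (F' G' : seq T -> V) w :
    cutp n (fun v t => sgn (~~ odd p && odd n) (ins p z (fun u => F' (y v :: u) + G' (y v :: u)) t)) w
  = cutp n (fun v t => sgn (~~ odd p && odd n) (ins p z (fun u => F' (y v :: u)) t)) w
  + cutp n (fun v t => sgn (~~ odd p && odd n) (ins p z (fun u => G' (y v :: u)) t)) w.
  rewrite -cutp_add; apply: eq_cutp => v t _ _.
  by rewrite (insD p z (fun u => F' (y v :: u))) -sgnD.
apply/funext => w.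
change (ins2 n y p z (F + G) w = ins2 n y p z F w + ins2 n y p z G w).
elim: w F G => [|a w IH] F G /=; first by rewrite E !addr0.
by rewrite E (IH (fun u => F (a :: u))) sgnD addrACA.
Qed.
End Naturality.
End Insertions.

(** * Derivation rules for insertions *)

Section Leibniz.
Variables (T : Type) (R : pzRingType).
Local Notation C := (conv T R).
Implicit Types (F G : C) (b : bool).

Lemma convDE F G w : (F + G) w = F w + G w. Proof. by []. Qed.
Lemma convNE F w : (- F) w = - F w. Proof. by []. Qed.
Lemma conv_sgnE b F w : (sgn b F) w = sgn b (F w).
Proof. by rewrite /sgn; case: b. Qed.

Lemma twistM b F G : (twist b (F * G : C) : C) = (twist b F : C) * (twist b G : C).
Proof.
apply/funext => w; rewrite /twist; elim: w F => [|a w IH] F.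
  by rewrite !conv_nil /= andbF.
rewrite !conv_cons sgnD sgnMl sgnMr /= andbF; congr (_ + _).
have -> : b && ~~ odd (size w) = b (+) (b && odd (size w)).
  by clear IH; case: b; case: odd.
rewrite -sgn_sgn IH -conv_sgnE -sgnMl; congr (((_ : C) * _) w).
apply/funext => u; rewrite conv_sgnE sgn_sgn; congr sgn.
by clear IH; case: b; case: odd.
Qed.

Lemma twist_twist b c F : (twist b (twist c F : C) : C) = (twist (b (+) c) F : C).
Proof. by apply/funext => w; rewrite /twist sgn_sgn -andb_addl. Qed.
Lemma twistD b F G : (twist b (F + G : C) : C) = (twist b F : C) + (twist b G : C).
Proof. by apply/funext => w; rewrite /twist convDE sgnD. Qed.
Lemma twist_sgn b c F : (twist b (sgn c F : C) : C) = sgn c (twist b F : C).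
Proof. by apply/funext => w; rewrite /twist !conv_sgnE !sgn_sgn addbC. Qed.
Lemma cutp_mulr n (f : seq T -> seq T -> R) c w :
  c * cutp n f w = cutp n (fun v t => c * f v t) w.
Proof. exact: (cutp_nat (c \*o idfun)). Qed.
Lemma ins_mulr n y F c w : c * ins n y F w = ins n y (fun u => c * F u) w.
Proof. exact: (ins_nat (c \*o idfun)). Qed.

Lemma cutp_mul n (f : seq T -> C) G w :
  ((cutp n f : C) * G) w = cutp n (fun v t => (f v * G) t) w.
Proof.
elim: n f w => [|n IH] f w.
  by rewrite cutp0; congr (((_ : C) * _) w); apply/funext => u; rewrite cutp0.
case: w => [|a w]; first by rewrite conv_nil cutpS_nil mul0r.
by rewrite conv_cons cutpS_nil mul0r add0r cutpS_cons -IH.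
Qed.

Lemma ins_sgn (V : zmodType) n (y : seq T -> T) c (F : seq T -> V) :
  ins n y (fun u => sgn c (F u)) = fun u => sgn c (ins n y F u).
Proof.
case: c => //; apply/funext => w /=.
exact/esym/(ins_nat -%R).
Qed.
Lemma ins_nil n y F :
  ins n y F [::] = if n is 0 then F [:: y [::]] else 0.
Proof. by case: n => [|n] /=; rewrite /cutp ?addr0. Qed.

(** The new first letter [y v] falls to [G] when the left part of the cut is empty and to [F]
    otherwise. *)
Lemma cutp_ins_mul n y F G :
  cutp n (fun v t => (F * G) (y v :: t)) =
  (fun w => F [::] * cutp n (fun v t => G (y v :: t)) w
            + ((cutp n (fun v t => F (y v :: t)) : C) * G) w).
Proof.
apply/funext => w; rewrite (cutp_mul n (fun v t => F (y v :: t))).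
by rewrite cutp_mulr -cutp_add; apply: eq_cutp => v t _ _; rewrite conv_cons.
Qed.

Lemma ins_split n y (F : C) : (ins n y F : C) =
  (cutp n (fun v t => F (y v :: t)) : C) +
  ((fun w => if w is a :: w' then sgn (~~ odd n) (ins n y (fun u => F (a :: u)) w')
             else 0) : C).
Proof. by apply/funext => -[|a w]. Qed.

(** A cut of u y(v) t has the letter y(v) in its left or in its right part. In the second case u
    consists of the left part and of the letters in front of y(v) in the right part, and the sign
    (-1)^((n-1)|u|) factors accordingly; the first factor is the [twist]. *)
Lemma ins_mul n y F G : (ins n y (F * G : C) : C) =
  (ins n y F : C) * G + (twist (~~ odd n) F : C) * (ins n y G : C).
Proof.
apply/funext => w; rewrite convDE; elim: w F => [|a w IH] F.
  rewrite !conv_nil !ins_nil; case: (n) => [|k]; last by rewrite mul0r mulr0 addr0.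
  by rewrite conv_cons conv_nil addrC /twist andbF.
rewrite -[LHS]/(cutp n (fun v t => (F * G) (y v :: t)) (a :: w) +
  sgn (~~ odd n) (ins n y (fun u => (F * G) (a :: u)) w)).
(* The terms with [y] applied to a prefix are separated from those that keep the letter [a], to
   which the induction hypothesis applies. *)
rewrite (cutp_ins_mul n y F G) (ins_split n y F) mulrDl convDE.
set S : C := (fun w0 => if w0 is a :: w' then _ else 0).
set c := ~~ odd n.
rewrite (conv_cons S) (conv_cons (twist c F)) mul0r add0r.
have -> : ins n y (fun u => (F * G) (a :: u)) w =
    F [::] * ins n y (fun u => G (a :: u)) w +
    ins n y (((fun u => F (a :: u)) : C) * G : C) w.
  rewrite ins_mulr -[RHS](congr1 (fun H => H w) (insD n y _ _)).
  by congr (ins n y _ w); apply/funext => u; rewrite conv_cons.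
have -> : (((fun u => S (a :: u)) : C) * G) w =
    sgn c ((((ins n y (fun u => F (a :: u))) : C) * G) w).
  rewrite -conv_sgnE -sgnMl; congr (((_ : C) * _) w).
  by apply/funext => u; rewrite conv_sgnE.
have -> : (((fun u => twist c F (a :: u)) : C) * (ins n y G : C)) w =
    sgn c (((twist c (fun u => F (a :: u)) : C) * (ins n y G : C)) w).
  rewrite -conv_sgnE -sgnMl; congr (((_ : C) * _) w).
  apply/funext => u; rewrite conv_sgnE /twist sgn_sgn; congr sgn.
  by clear; case: c; rewrite //= addTb.
have -> : ins n y G (a :: w) = cutp n (fun v t => G (y v :: t)) (a :: w) +
    sgn c (ins n y (fun u => G (a :: u)) w) by [].
have -> : (twist c F : C) [::] = F [::] by rewrite /twist andbF.
rewrite IH !sgnD mulrDr sgnMr !addrA.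
have shuffle (p q r s t : R) : p + q + r + s + t = q + s + p + r + t.
  by rewrite [LHS](ACl (2*4*1*3*5)).
exact: shuffle.
Qed.

Lemma twist_cutp b n (f : seq T -> seq T -> R) :
  twist b (cutp n (fun v t => f v t)) =
  cutp n (fun v t => sgn (b && odd n) (twist b (f v) t)).
Proof.
apply/funext => w; rewrite /twist /cutp; case: leqP => nw; last by rewrite sgn0.
rewrite sgn_sgn size_drop oddB //; congr sgn.
by clear; case: b; case: (odd n); case: (odd _).
Qed.

(** [F] is evaluated on words whose length differs from that of the argument by n - 1, and the two
    twists differ by this parity. *)
Lemma ins_twist n y b (F : C) : (ins n y (twist b F) : C) =
  sgn (b && ~~ odd n) (twist b (ins n y F) : C).
Proof.
apply/funext => w; rewrite conv_sgnE /twist sgn_sgn; elim: w F => [|a w IH] F.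
  rewrite !ins_nil /= andbF addbF; case: n => [|n]; last by rewrite sgn0.
  by rewrite /= andbT.
have E : ins n y (fun u => twist b F (a :: u)) w =
    sgn b (ins n y (twist b (fun u => F (a :: u))) w).
  rewrite -(congr1 (fun H => H w) (ins_sgn n y b _)); congr (ins n y _ w).
  by apply/funext => u; rewrite /twist sgn_sgn /=; clear; case: b; case: (odd _).
rewrite -[LHS]/(cutp n (fun v t => twist b F (y v :: t)) (a :: w) +
  sgn (~~ odd n) (ins n y (fun u => twist b F (a :: u)) w)) E IH.
rewrite -[ins n y F (a :: w)]/(cutp n (fun v t => F (y v :: t)) (a :: w) +
  sgn (~~ odd n) (ins n y (fun u => F (a :: u)) w)) sgnD !sgn_sgn.
congr (_ + sgn _ _); last by clear; rewrite /=; case: b; case: (odd n); case: (odd _).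
rewrite /cutp; case: leqP => nw; last by rewrite sgn0.
rewrite /twist; congr sgn; rewrite /= size_drop oddB //=.
by clear; case: b; case: (odd n); case: (odd _).
Qed.
End Leibniz.

Section Leibniz2.
Variables (T : Type) (R : pzRingType).
Local Notation C := (conv T R).
Implicit Types (F G : C) (b : bool).

Lemma ins2_mulr n y p z F c w : c * ins2 n y p z F w = ins2 n y p z (fun u => c * F u) w.
Proof. exact: (ins2_nat (c \*o idfun)). Qed.
Lemma ins2_sgn (V : zmodType) n (y : seq T -> T) p z c (F : seq T -> V) :
  ins2 n y p z (fun u => sgn c (F u)) = fun u => sgn c (ins2 n y p z F u).
Proof.
case: c => //; apply/funext => w /=.
exact/esym/(ins2_nat -%R).
Qed.

(** The part of F{y, z} in which [y] is applied to a prefix; its [n] inputs stand in front of [z],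
    hence the sign (-1)^((p-1)n). *)
Let pre n (y : seq T -> T) p (z : seq T -> T) F : C :=
  cutp n (fun v t => sgn (~~ odd p && odd n) (ins p z (fun u => F (y v :: u)) t)).

Fact cutp_ins2_mul n y p z F G w :
  pre n y p z (F * G) w =
  F [::] * pre n y p z G w + (pre n y p z F * G) w +
  ((twist (~~ odd p) (cutp n (fun v t => F (y v :: t))) : C) * (ins p z G : C)) w.
Proof.
rewrite twist_cutp cutp_mulr !cutp_mul -!cutp_add.
apply: eq_cutp => v t _ _; set c := _ && _.
have -> : (fun u => (F * G) (y v :: u)) =
    (fun u => F [::] * G (y v :: u)) + (((fun u => F (y v :: u)) : C) * G : C).
  by apply/funext => u; rewrite conv_cons.
rewrite insD ins_mul; rewrite /= !addrfctE sgnD.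
have sgn_conv (F' G' : C) : (((fun u => sgn c (F' u)) : C) * G') t = sgn c ((F' * G') t).
  by rewrite -conv_sgnE -sgnMl; congr (((_ : C) * _) t); apply/funext => u; rewrite conv_sgnE.
by rewrite !sgn_conv sgnD addrA sgnMr ins_mulr.
Qed.

Lemma ins2_split n y p z F : (ins2 n y p z F : C) = (pre n y p z F : C) +
  ((fun w => if w is a :: w' then
     sgn (~~ odd n (+) ~~ odd p) (ins2 n y p z (fun u => F (a :: u)) w') else 0) : C).
Proof. by apply/funext => -[|a w]. Qed.

(** As [y] precedes [z], a cut has both in the left part, both in the right part, or it separates
    them. In the middle term the twist is taken after inserting [y]: the sign of [z] counts the
    inputs of [y], not the single letter that replaces them. *)
Lemma ins2_mul n y p z F G : (ins2 n y p z (F * G : C) : C) =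
  (ins2 n y p z F : C) * G +
  (twist (~~ odd p) (ins n y F) : C) * (ins p z G : C) +
  (twist (~~ odd n (+) ~~ odd p) F : C) * (ins2 n y p z G : C).
Proof.
apply/funext => w; rewrite !convDE; elim: w F => [|a w IH] F.
  rewrite -[LHS]/(pre n y p z (F * G) [::] + 0) addr0 cutp_ins2_mul.
  rewrite (ins2_split n y p z F) mulrDl convDE.
  rewrite (ins_split n y F) twistD (mulrDl (twist _ _ : C)) convDE.
  rewrite !conv_nil /twist !andbF /= !mul0r !addr0.
  by rewrite -/(pre n y p z G) [RHS](ACl (3*1*2)).
rewrite -[LHS]/(pre n y p z (F * G) (a :: w) +
  sgn (~~ odd n (+) ~~ odd p) (ins2 n y p z (fun u => (F * G) (a :: u)) w)).
rewrite cutp_ins2_mul (ins2_split n y p z F) mulrDl convDE.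
rewrite (ins_split n y F) twistD (mulrDl (twist _ _ : C)) convDE.
set S2 : C := (fun w0 => if w0 is a :: w' then sgn _ (ins2 _ _ _ _ _ _) else 0).
set S : C := (fun w0 => if w0 is a :: w' then sgn (~~ odd n) _ else 0).
set s := ~~ odd n; set t := ~~ odd p.
rewrite (conv_cons S2) (conv_cons (twist (s (+) t) F)) (conv_cons (twist t S)).
have sgn_conv c (F' G' F'' : C) : (forall u, F' u = sgn c (F'' u)) ->
    (F' * G') w = sgn c ((F'' * G') w).
  move=> FE; rewrite -conv_sgnE -sgnMl; congr (((_ : C) * _) w).
  by apply/funext => u; rewrite conv_sgnE.
rewrite (sgn_conv (s (+) t) (fun u => S2 (a :: u)) G (ins2 n y p z (fun u => F (a :: u)))) //.
rewrite (sgn_conv (s (+) t) (fun u => twist t S (a :: u)) _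
  (twist t (ins n y (fun u => F (a :: u))))); last first.
  by move=> u; rewrite /twist /S /= -/s !sgn_sgn; congr sgn; clear; case: s; case: t; case: (odd _).
rewrite (sgn_conv (s (+) t) (fun u => twist (s (+) t) F (a :: u)) _
  (twist (s (+) t) (fun u => F (a :: u)))); last first.
  by move=> u; rewrite /twist !sgn_sgn /=; congr sgn; clear; case: s; case: t; case: (odd _).
have -> : ins2 n y p z (fun u => (F * G) (a :: u)) w =
    F [::] * ins2 n y p z (fun u => G (a :: u)) w +
    ins2 n y p z (((fun u => F (a :: u)) : C) * G : C) w.
  rewrite ins2_mulr -[RHS](congr1 (fun H => H w) (ins2D n y p z _ _)).
  by congr (ins2 n y p z _ w); apply/funext => u; rewrite conv_cons.
have -> : (ins2 n y p z G : C) (a :: w) = pre n y p z G (a :: w) +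
    sgn (s (+) t) (ins2 n y p z (fun u => G (a :: u)) w) by [].
have -> : (twist (s (+) t) F : C) [::] = F [::] by rewrite /twist andbF.
have -> : (twist t S : C) [::] = 0 by rewrite /twist sgn0.
rewrite IH !sgnD !mulrDr !sgnMr !mul0r ?sgn0 ?add0r ?addr0 !addrA.
by rewrite [LHS](ACl (2*5*3*6*1*4*7)).
Qed.

Lemma ins2_twist n y p z b (F : C) : (ins2 n y p z (twist b F) : C) =
  sgn (b && (odd n (+) odd p)) (twist b (ins2 n y p z F) : C).
Proof.
have twist_cons (F' : C) a : (fun u => twist b F' (a :: u)) =
    fun u => sgn b (twist b (fun u => F' (a :: u)) u).
  by apply/funext => u; rewrite /twist sgn_sgn /=; clear; case: b; case: (odd _).
have preE F' w : pre n y p z (twist b F') w =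
    sgn (b && (odd n (+) odd p)) (twist b (pre n y p z F') w).
  rewrite /pre (twist_cutp b n (fun v => _ : C)).
  rewrite /cutp; case: leqP => nw; last by rewrite sgn0.
  rewrite twist_cons ins_sgn -/(ins p z (twist b _)) ins_twist conv_sgnE /twist.
  rewrite !sgn_sgn; congr sgn.
  by clear; case: b; case: (odd n); case: (odd p); case: (odd _).
apply/funext => w; elim: w F => [|a w IH] F.
  rewrite -[LHS]/(pre n y p z (twist b F) [::] + 0) addr0 preE conv_sgnE /twist.
  by rewrite -[ins2 n y p z F [::]]/(pre n y p z F [::] + 0) addr0.
rewrite -[LHS]/(pre n y p z (twist b F) (a :: w) +
  sgn (~~ odd n (+) ~~ odd p) (ins2 n y p z (fun u => twist b F (a :: u)) w)).
rewrite preE twist_cons ins2_sgn IH !conv_sgnE /twist.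
rewrite -[ins2 n y p z F (a :: w)]/(pre n y p z F (a :: w) +
  sgn (~~ odd n (+) ~~ odd p) (ins2 n y p z (fun u => F (a :: u)) w)).
rewrite !sgnD !sgn_sgn; congr (_ + sgn _ _).
by clear; rewrite /=; case: b; case: (odd n); case: (odd p); case: (odd _).
Qed.
End Leibniz2.

(** * Operator identities on words *)

Definition supported (T : Type) (V : zmodType) n (F : seq T -> V) :=
  forall w, size w != n -> F w = 0.

Section Supported.
Variables (T : Type) (R : pzRingType).
Local Notation C := (conv T R).

Lemma supp_mul n (f F : C) w : supported n f ->
  (f * F) w = cutp n (fun v t => f v * F t) w.
Proof.
elim: n f w => [|n IH] f w fn.
  rewrite cutp0; case: w => [|a w]; first by rewrite conv_nil.
  rewrite conv_cons (_ : (fun u => f (a :: u)) = 0) ?mul0r ?addr0 //.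
  by apply/funext => u; rewrite fn.
case: w => [|a w]; first by rewrite conv_nil cutpS_nil fn ?mul0r.
by rewrite conv_cons fn // mul0r add0r cutpS_cons IH // => v nv; rewrite fn.
Qed.

Lemma twist_supp n b F : supported n F -> (twist b F : C) = sgn (b && odd n) F.
Proof.
move=> Fn; apply/funext => w; rewrite /twist conv_sgnE.
by have [->//|/Fn ->] := eqVneq (size w) n; rewrite !sgn0.
Qed.

End Supported.

Section Universal.
Variables (V : zmodType) (R : pzRingType) (L : {additive V -> R}).
Local Notation C := (conv V R).
Implicit Types (y z : seq V -> V) (F G X : C).

Fixpoint word (w : seq V) : R := if w is a :: w' then L a * word w' else 1.
Definition hat (y : seq V -> V) : C := fun w => L (y w).

Local Notation I := (word : C).

Lemma supp_hat n y : supported n y -> supported n (hat y).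
Proof. by move=> yn w wn; rewrite /hat yn ?raddf0. Qed.

(** Unfolding the recursion gives X(w) as the sum over w = u v of (-1)^(b|u|) L_u G(v), which is a
    convolution product. With [G] collecting the terms that start at the front of the word, this
    yields closed formulas for insertions into [word]. *)
Lemma word_rec b G X : X [::] = G [::] ->
  (forall a w, X (a :: w) = G (a :: w) + sgn b (L a * X w)) ->
  X = (twist b I : C) * G.
Proof.
move=> X0 XS; have tw0 : (twist b I : C) [::] = 1 by rewrite /twist andbF.
have mulL a (H : C) : ((fun u => L a * H u : R) : C) * G = (fun u => L a * (H * G) u) :> C.
  apply/funext => u; elim: u H => [|c u IH] H; first by rewrite !conv_nil mulrA.
  rewrite conv_cons [in RHS]conv_cons mulrDr mulrA; congr (_ + _).
  exact: (IH (fun v => H (c :: v))).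
apply/funext => w; elim: w => [|a w IH]; first by rewrite X0 conv_nil tw0 mul1r.
rewrite XS conv_cons IH tw0 mul1r; congr (_ + _).
transitivity ((sgn b ((fun u => L a * (twist b I) u) : C) * G) w).
  by rewrite sgnMl conv_sgnE (mulL a (twist b I)).
congr (((_ : C) * G) w); apply/funext => u; rewrite conv_sgnE /twist sgnMr sgn_sgn /=.
by congr sgn; clear; case: b; case: (odd _).
Qed.

Lemma ins_word n y : supported n y ->
  (ins n y I : C) = (twist (~~ odd n) I : C) * (hat y * I).
Proof.
move=> yn; apply: word_rec => [|a w].
  by rewrite -[LHS]/(_ + 0) addr0 (supp_mul _ _ (supp_hat yn)).
by rewrite (supp_mul _ _ (supp_hat yn)) ins_mulr.
Qed.

(** The letters in front of [y] carry the signs of both insertions; then comes [y] with the sign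
    (-1)^((p-1)n), and [z] is inserted into the rest. *)
Lemma ins2_word n y p z : supported n y -> supported p z ->
  (ins2 n y p z I : C) = (twist (~~ odd n (+) ~~ odd p) I : C) *
    ((twist (~~ odd p) (hat y) : C) * (ins p z I : C)).
Proof.
move=> yn zp.
have preE w : cutp n (fun v t => sgn (~~ odd p && odd n) (ins p z (fun u => word (y v :: u)) t)) w
    = ((twist (~~ odd p) (hat y) : C) * (ins p z I : C)) w.
  rewrite (twist_supp _ (supp_hat yn)) sgnMl conv_sgnE (supp_mul _ _ (supp_hat yn)).
  rewrite /cutp; case: leqP => nw; last by rewrite sgn0.
  by rewrite -ins_mulr.
apply: word_rec => [|a w]; first by rewrite -preE -[LHS]/(_ + 0) addr0.
by rewrite -preE ins2_mulr.
Qed.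

Lemma ins_hat n y z : (ins n y (hat z) : C) = hat (ins n y z).
Proof. by apply/funext => w; rewrite /hat ins_nat. Qed.
Lemma ins2_hat n y p z y' : (ins2 n y p z (hat y') : C) = hat (ins2 n y p z y').
Proof. by apply/funext => w; rewrite /hat ins2_nat. Qed.

Lemma hatD y z : hat (y + z) = hat y + hat z.
Proof. by apply/funext => w; rewrite /hat raddfD. Qed.
Lemma hat_sgn b y : hat (sgn b y) = sgn b (hat y).
Proof. by apply/funext => w; rewrite /hat conv_sgnE sgn_fun raddf_sgn. Qed.
Lemma hatN y : hat (- y) = - hat y.
Proof. exact: (hat_sgn true). Qed.

(** The terms with [y] and [z] side by side occur in both composites and cancel by the Koszul sign;
    what remains is [z] inserted into [y] and [y] inserted into [z]. *)
Lemma ins_word_comm n y p z (s := ~~ odd n) (t := ~~ odd p) :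
  supported n y -> supported p z ->
  (ins p z (ins n y I) : C) - sgn (s && t) (ins n y (ins p z I) : C) =
  (twist (s (+) t) I : C) *
    (hat (ins p z y - sgn (s && t) (ins n y z)) * I).
Proof.
move=> yn zp.
have on : odd n = ~~ s by rewrite negbK.
have op : odd p = ~~ t by rewrite negbK.
rewrite (ins_word yn) (ins_word zp) !ins_mul !ins_twist !ins_hat.
rewrite (ins_word yn) (ins_word zp) -/s -/t !twistM !twist_twist.
rewrite !(twist_supp _ (supp_hat yn)) !(twist_supp _ (supp_hat zp)).
rewrite !hatD hatN hat_sgn on op !negbK ![t (+) s]addbC.
rewrite !(sgnMl, sgnMr, mulrDl, mulrDr, mulrA, mulNr, mulrN, sgnD, sgn_sgn).
rewrite on op; move: (s) (t) => b c.
by case: b; case: c; rewrite /sgn /=; zmod.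
Qed.

(** Only the parity of [m] enters the signs. It is a hypothesis because [(n + p).-1] has the
    required parity except for n = p = 0. *)
Lemma ins_word_bracket n y p z m (s := ~~ odd n) (t := ~~ odd p)
    (br := ins p z y - sgn (s && t) (ins n y z)) :
  supported n y -> supported p z -> supported m br -> ~~ odd m = s (+) t ->
  (ins p z (ins n y I) : C) - sgn (s && t) (ins n y (ins p z I) : C) = ins m br I.
Proof. by move=> yn zp mb e; rewrite ins_word_comm // ins_word // e. Qed.

(** With [pi'] the product, the two equations say that [y] and [z] are cocycles. They cancel the
    terms in which the product meets [y] alone or [z] alone; the terms in which it meets neither
    cancel by their signs, and pi'{y, z} is left. *)
Lemma ins_word_ins2 n y p z pi' (s := ~~ odd n) (t := ~~ odd p) :
  supported n y -> supported p z -> supported 2%N pi' ->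
  ins 2%N pi' y = sgn s (ins n y pi') -> ins 2%N pi' z = sgn t (ins p z pi') ->
  supported (n + p)%N (ins2 n y p z pi') ->
  (ins 2%N pi' (ins2 n y p z I) : C) - sgn (s (+) t) (ins2 n y p z (ins 2%N pi' I) : C) =
  - sgn (s (+) t) (ins (n + p)%N (ins2 n y p z pi') I : C).
Proof.
move=> yn zp pn yd zd bn.
have on : odd n = ~~ s by rewrite negbK.
have op : odd p = ~~ t by rewrite negbK.
rewrite (ins2_word yn zp) (ins_word pn) !ins2_mul !ins_mul !ins_twist !ins_hat !ins2_twist.
rewrite !ins2_hat !(ins2_word yn zp) !(ins_word yn) (ins_word bn) !(ins_word zp).
rewrite !ins_mul !ins_twist !ins_hat yd zd !(ins_word pn) !hat_sgn.
rewrite -/s -/t oddD on op !(twistM, twist_sgn, twist_twist).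
rewrite !(twist_supp _ (supp_hat yn)) !(twist_supp _ (supp_hat zp)) !(twist_supp _ (supp_hat pn)).
rewrite !(sgnMl, sgnMr, mulrDl, mulrDr, mulrA, mulNr, mulrN, sgnD, sgn_sgn) on op.
move: (s) (t) => b c.
by case: b; case: c; rewrite /sgn /=; zmod.
Qed.

End Universal.

(** * Functionals as values of operators *)

Section Endomorphisms.
Variable M : zmodType.

Definition endo_pred : {pred M -> M} := [pred f | `[< zmod_morphism f >]].
Fact endo_zmod_closed : zmod_closed endo_pred.
Proof.
split=> [|f g /asboolP fa /asboolP ga]; apply/asboolP => x y.
  by rewrite [RHS]subr0.
by rewrite !addrfctE !opprfctE fa ga opprD addrACA -opprD.
Qed.
HB.instance Definition _ := GRing.isZmodClosed.Build (M -> M) endo_pred endo_zmod_closed.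

Record endo := Endo { endo_fun : M -> M; _ : endo_fun \in endo_pred }.
HB.instance Definition _ := [isSub for endo_fun].
HB.instance Definition _ := [Choice of endo by <:].
HB.instance Definition _ := [SubChoice_isSubZmodule of endo by <:].

Lemma endoB (f : endo) : zmod_morphism (endo_fun f).
Proof. by case: f => f /= /asboolP. Qed.
HB.instance Definition _ f := GRing.isZmodMorphism.Build M M (endo_fun f) (endoB f).

Lemma endoP (f g : endo) : endo_fun f =1 endo_fun g -> f = g.
Proof. by move=> fg; apply/val_inj/funext. Qed.

(* The opposite product, so that words act on functionals letter by letter. *)
Fact endo_one_subproof : idfun \in endo_pred.
Proof. exact/asboolP. Qed.
Fact endo_mul_subproof (f g : endo) : endo_fun g \o endo_fun f \in endo_pred.
Proof. by apply/asboolP => x y /=; rewrite !raddfB. Qed.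
Definition endo_one := Endo endo_one_subproof.
Definition endo_mul f g := Endo (endo_mul_subproof f g).

Fact endo_mulA : associative endo_mul. Proof. by move=> f g h; apply: endoP. Qed.
Fact endo_mul1l : left_id endo_one endo_mul. Proof. by move=> f; apply: endoP. Qed.
Fact endo_mul1r : right_id endo_one endo_mul. Proof. by move=> f; apply: endoP. Qed.
Fact endo_mulDl : left_distributive endo_mul +%R.
Proof. by move=> f g h; apply: endoP => x /=; rewrite raddfD. Qed.
Fact endo_mulDr : right_distributive endo_mul +%R.
Proof. by move=> f g h; apply: endoP. Qed.
HB.instance Definition _ := GRing.Zmodule_isPzRing.Build endo
  endo_mulA endo_mul1l endo_mul1r endo_mulDl endo_mulDr.
End Endomorphisms.

Section Functionals.
Variables V U : zmodType.

Definition multiadditive (F : seq V -> U) :=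
  forall u t a b, F (u ++ (a + b) :: t) = F (u ++ a :: t) + F (u ++ b :: t).

Definition mfun_pred : {pred seq V -> U} := [pred F | `[< multiadditive F >]].
Fact mfun_zmod_closed : zmod_closed mfun_pred.
Proof.
split=> [|f g /asboolP fa /asboolP ga]; apply/asboolP => u t a b.
  by rewrite [RHS]addr0.
by rewrite !addrfctE !opprfctE fa ga opprD addrACA.
Qed.
HB.instance Definition _ :=
  GRing.isZmodClosed.Build (seq V -> U) mfun_pred mfun_zmod_closed.

Record mfun := MFun { mfun_fun : seq V -> U; _ : mfun_fun \in mfun_pred }.
HB.instance Definition _ := [isSub for mfun_fun].
HB.instance Definition _ := [Choice of mfun by <:].
HB.instance Definition _ := [SubChoice_isSubZmodule of mfun by <:].

Fact mfunP (F : mfun) : multiadditive (mfun_fun F).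
Proof. by case: F => F /= /asboolP. Qed.
Fact mfun_shift_subproof a (F : mfun) : (fun u => mfun_fun F (a :: u)) \in mfun_pred.
Proof. by apply/asboolP => u t b c; apply: (mfunP F (a :: u)). Qed.
Definition mfun_shift a F := MFun (mfun_shift_subproof a F).
Fact letter_subproof a : mfun_shift a \in @endo_pred mfun.
Proof. by apply/asboolP => F G; apply/val_inj. Qed.
Definition letter a : endo mfun := Endo (letter_subproof a).
(** This is where multiadditivity is used: it makes [letter] additive, as the calculus with [word]
    and [hat] requires. *)
Fact letter_zmod : zmod_morphism letter.
Proof.
move=> a b; apply: endoP => F; apply/val_inj/funext => u.
have /= E := mfunP F [::] u (a - b) b.
by apply/eqP; rewrite eq_sym subr_eq -E subrK.
Qed.
HB.instance Definition _ := GRing.isZmodMorphism.Build V (endo mfun) letter letter_zmod.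

Definition meval (F : mfun) (f : endo mfun) : U := mfun_fun (endo_fun f F) [::].
Fact meval_zmod F : zmod_morphism (meval F). Proof. by []. Qed.
HB.instance Definition _ F :=
  GRing.isZmodMorphism.Build (endo mfun) U (meval F) (meval_zmod F).

(** Every functional is the image of [word letter] under an additive map, so that [ins_nat] and
    [ins2_nat] reduce identities for functionals to identities for [word]. *)
Lemma meval_word F w : meval F (word letter w) = mfun_fun F w.
Proof. by elim: w F => [//|a w IH] F; rewrite -[RHS](IH (mfun_shift a F)). Qed.
End Functionals.

Section OperatorIdentities.
Variables V U : zmodType.
Implicit Types (y z : seq V -> V) (x : seq V -> U).

Let I : conv V (endo (mfun V U)) := word (@letter V U).

Lemma ins_bracket n y p z m x (s := ~~ odd n) (t := ~~ odd p)
    (br := ins p z y - sgn (s && t) (ins n y z)) :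
  supported n y -> supported p z -> supported m br -> ~~ odd m = s (+) t ->
  multiadditive x ->
  ins p z (ins n y x) - sgn (s && t) (ins n y (ins p z x)) = ins m br x.
Proof.
move=> yn zp mb e /asboolP xm; pose F : mfun V U := MFun xm.
have xE : x = (fun w => meval F (I w)) by apply/funext => w; rewrite meval_word.
have := ins_word_bracket (@letter V U) yn zp mb e.
move=> /(congr1 (fun H : conv V _ => fun w => meval F (H w))) /= E.
apply/funext => w; have := congr1 (@^~ w) E => /=.
rewrite convDE convNE conv_sgnE raddfB /= (raddf_sgn (meval F)) /= !ins_nat -/I -xE => <-.
rewrite -[LHS]/(ins p z (ins n y x) w - (sgn (s && t) (ins n y (ins p z x))) w).
rewrite sgn_fun; congr (ins p z _ w - sgn _ (ins n y _ w)).
  by apply/funext => u; rewrite ins_nat xE.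
by apply/funext => u; rewrite ins_nat xE.
Qed.

Lemma ins_ins2 n y p z pi' x (s := ~~ odd n) (t := ~~ odd p) :
  supported n y -> supported p z -> supported 2%N pi' ->
  ins 2%N pi' y = sgn s (ins n y pi') -> ins 2%N pi' z = sgn t (ins p z pi') ->
  supported (n + p)%N (ins2 n y p z pi') -> multiadditive x ->
  ins 2%N pi' (ins2 n y p z x) - sgn (s (+) t) (ins2 n y p z (ins 2%N pi' x)) =
  - sgn (s (+) t) (ins (n + p)%N (ins2 n y p z pi') x).
Proof.
move=> yn zp pn yd zd bn /asboolP xm; pose F : mfun V U := MFun xm.
have xE : x = (fun w => meval F (I w)) by apply/funext => w; rewrite meval_word.
have := ins_word_ins2 (@letter V U) yn zp pn yd zd bn.
move=> /(congr1 (fun H : conv V _ => fun w => meval F (H w))) /= E.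
apply/funext => w; have := congr1 (@^~ w) E => /=.
rewrite !convDE !convNE !conv_sgnE raddfB raddfN /= !(raddf_sgn (meval F)) /=.
rewrite ins_nat ins2_nat ins_nat -/I -xE => E1.
rewrite -[RHS]/(- (sgn (s (+) t) (ins (n + p)%N (ins2 n y p z pi') x)) w).
rewrite sgn_fun -E1.
rewrite -[LHS]/(ins 2%N pi' (ins2 n y p z x) w -
  (sgn (s (+) t) (ins2 n y p z (ins 2%N pi' x))) w) sgn_fun.
congr (ins 2%N pi' _ w - sgn _ (ins2 n y p z _ w)).
  by apply/funext => u; rewrite ins2_nat xE.
by apply/funext => u; rewrite ins_nat xE.
Qed.
End OperatorIdentities.

(** * The Hochschild complex *)

(** An alias of [A] that carries the structure of a possibly zero ring, so that convolution applies
    to functions with values in [A]. *)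
Definition aring (K : fieldType) (A : assocAlgType K) : Type := A.

Section AlgebraRing.
Variables (K : fieldType) (A : assocAlgType K).
HB.instance Definition _ := GRing.Lmodule.on (aring A).

Fact amulDl : left_distributive (@amul K A : aring A -> aring A -> aring A) +%R.
Proof. by move=> a b c; have := amul_linearl c 1 a b; rewrite !scale1r. Qed.
Fact amulDr : right_distributive (@amul K A : aring A -> aring A -> aring A) +%R.
Proof. by move=> a b c; have := amul_linearr a 1 b c; rewrite !scale1r. Qed.
HB.instance Definition _ := GRing.Zmodule_isPzRing.Build (aring A)
  (@amulA K A) (@amul1l K A) (@amul1r K A) amulDl amulDr.

Lemma aringME (a b : A) : (a : aring A) * (b : aring A) = a ∗ b.
Proof. by []. Qed.
End AlgebraRing.

Section Supports.
Variables (T : Type) (V : zmodType).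
Implicit Types F : seq T -> V.

Lemma ins_supp0 n y F : supported 0 F -> ins n y F = 0.
Proof.
move=> F0; apply/funext => w.
have E G v : (forall a u, G (a :: u) = 0) -> ins n y G v = 0.
  elim: v G => [|a v IH] G G0 /=.
    by rewrite addr0 /cutp; case: leqP => // _; rewrite G0.
  rewrite IH ?sgn0 ?addr0; first by rewrite /cutp; case: leqP => // _; rewrite G0.
  by move=> b u; rewrite G0.
by apply: E => a u; rewrite F0.
Qed.

Lemma ins_size n y F m w :
  supported m F -> (size w).+1 != (m + n)%N -> ins n y F w = 0.
Proof.
elim: w F m => [|a w IH] F m Fm wm /=.
  rewrite addr0 /cutp; case: leqP => //= n0; rewrite Fm //=.
  by move: n0 wm; rewrite leqn0 => /eqP->; rewrite addn0.
rewrite [X in _ + X](_ : _ = 0) ?addr0.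
  rewrite /cutp; case: leqP => //= nw; rewrite Fm //= size_drop /=.
  by apply: contra wm => /eqP <-; rewrite addSn subnK.
case: m Fm wm => [|m] Fm wm.
  by rewrite (ins_supp0 n y) ?sgn0 // => u _; rewrite Fm.
by rewrite (IH _ m) ?sgn0 // => u um; rewrite Fm.
Qed.

(** For m = 0 there is no slot and the insertion is zero, so the claim holds even where the
    predecessor is truncated. *)
Lemma supp_ins n y F m : supported m F -> supported (m + n).-1 (ins n y F).
Proof.
case: m => [|m] Fm w wm; first by rewrite (ins_supp0 _ _ Fm).
by apply: (ins_size _ Fm); apply: contra wm => /eqP [->].
Qed.

Lemma ins2_supp01 n y p z F m : (m < 2)%N -> supported m F -> ins2 n y p z F = 0.
Proof.
move=> m2 Fm; apply/funext => w; elim: w F m m2 Fm => [|a w IH] F m m2 Fm /=.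
  rewrite addr0 /cutp; case: leqP => // _; rewrite (ins_supp0 p z) ?sgn0 // => u u0.
  by rewrite Fm //=; case: m m2 {Fm} => [|[|m]].
rewrite (IH _ 0%N) // ?sgn0 ?addr0.
  rewrite /cutp; case: leqP => // _; rewrite (ins_supp0 p z) ?sgn0 // => u u0.
  by rewrite Fm //=; case: m m2 {Fm} => [|[|m]].
by move=> u u0; rewrite Fm //= eq_sym ltn_eqF // (leq_trans m2) // ltnS lt0n.
Qed.

Lemma ins2_size n y p z F m w :
  supported m F -> (size w).+2 != (m + n + p)%N -> ins2 n y p z F w = 0.
Proof.
elim: w F m => [|a w IH] F m Fm wm /=.
  rewrite addr0 /cutp; case: leqP => // n0.
  case: m Fm wm => [|m] Fm wm.
    by rewrite (ins_supp0 p z) ?sgn0 // => u _; rewrite Fm.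
  rewrite (@ins_size _ _ _ m) ?sgn0 //; first by move=> u um; rewrite Fm.
  by move: n0 wm; rewrite leqn0 => /eqP ->; rewrite addn0 addSn eqSS.
rewrite [X in _ + X](_ : _ = 0) ?addr0.
  rewrite /cutp; case: leqP => // nw.
  case: m Fm wm => [|m] Fm wm.
    by rewrite (ins_supp0 p z) ?sgn0 // => u _; rewrite Fm.
  rewrite (@ins_size _ _ _ m) ?sgn0 //; first by move=> u um; rewrite Fm.
  by move: nw wm; rewrite size_drop /=; lia.
case: m Fm wm => [|m] Fm wm.
  by rewrite (@ins2_supp01 _ _ _ _ _ 0%N) ?sgn0 // => u _; rewrite Fm.
by rewrite (IH _ m) ?sgn0 // => u um; rewrite Fm.
Qed.

Lemma supp_ins2 n y p z F m :
  supported m F -> supported (m + n + p).-2 (ins2 n y p z F).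
Proof.
move=> Fm w wm; have [m2|m2] := ltnP m 2; first by rewrite (ins2_supp01 _ _ _ _ m2 Fm).
by apply: (@ins2_size _ _ _ _ _ m) => //; move: m2 wm; clear; lia.
Qed.

Lemma supp_cutp_nil n y : supported n (y : seq T -> V) -> forall w, y w = cutp n (fun v t => if t is [::] then y v else 0) w.
Proof.
move=> yn w; rewrite /cutp; have [nw|nw] := leqP n (size w); last first.
  by rewrite yn // ltn_eqF.
have [e|ne] := eqVneq (size w) n; first by rewrite drop_oversize ?take_oversize ?e.
by rewrite yn //; case: (drop n w) (size_drop n w) => //=; move: nw ne; clear; lia.
Qed.
End Supports.

Lemma supp_conv (T : Type) (R : pzRingType) (F G : conv T R) m p :
  supported m F -> supported p G -> supported (m + p)%N (F * G).
Proof.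
move=> Fm Gp w wmp; rewrite (supp_mul _ _ Fm) /cutp; case: leqP => // mw.
rewrite Gp ?mulr0 // size_drop; apply: contra wmp => /eqP <-.
by rewrite subnKC.
Qed.

Section HochschildComplex.
Variables (K : fieldType) (A : assocAlgType K).
Local Notation C := (conv A (aring A)).
Implicit Types x y z : C.

Definition idc : C := fun w => if w is [:: a] then a else 0.
Definition prodc : C := idc * idc.
(** As [twist true] is (-1)^n in degree n, this is the classical Hochschild coboundary with its
    usual signs; the first and the last term are the outer faces. *)
Definition cdiff x : C := idc * x - ins 2%N prodc x - (twist true x : C) * idc.

Lemma supp_idc : supported 1 idc. Proof. by case=> [|a [|b w]]. Qed.
Lemma supp_prodc : supported 2 prodc.
Proof. exact: supp_conv supp_idc supp_idc. Qed.

Lemma ins_idc n y : supported n y -> ins n y idc = y.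
Proof.
move=> yn; apply/funext => w; rewrite [RHS](supp_cutp_nil yn).
case: w => [|a w] /=; first by rewrite addr0; apply: eq_cutp => v [].
rewrite (ins_supp0 n y) ?sgn0 ?addr0; last by case.
by apply: eq_cutp => v [].
Qed.

Lemma ins_prodc n y : supported n y ->
  ins n y prodc = y * idc + sgn (~~ odd n) (idc * y) :> C.
Proof.
move=> yn; rewrite /prodc ins_mul (ins_idc yn) (twist_supp _ supp_idc) andbT.
by rewrite sgnMl.
Qed.

Lemma ins2_prodc n y p z : supported n y -> supported p z ->
  ins2 n y p z prodc = sgn (~~ odd p && odd n) (y * z) :> C.
Proof.
move=> yn zp; rewrite /prodc ins2_mul (@ins2_supp01 _ _ _ _ _ _ _ 1%N) //; last exact: supp_idc.
by rewrite mul0r mulr0 addr0 add0r (ins_idc yn) (ins_idc zp) (twist_supp _ yn) sgnMl.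
Qed.

Lemma cdiffD x y : cdiff (x + y) = cdiff x + cdiff y.
Proof.
rewrite /cdiff mulrDr insD twistD mulrDl.
by rewrite -[in LHS]/((ins _ _ x : C) + (ins _ _ y : C)); zmod.
Qed.

(** Insertion of [prodc] is a twisted derivation, and the terms [twist true x * idc * y] that come
    from the two summands cancel. *)
Lemma cdiffM x y : cdiff (x * y) = cdiff x * y + (twist true x : C) * cdiff y.
Proof.
rewrite /cdiff ins_mul !twistM !(mulrBl, mulrBr) !mulrA.
zmod.
Qed.

(** A cocycle has zero bracket with the product; this is the form of the condition that [ins_ins2]
    takes. *)
Lemma ins_cocycle n y : supported n y -> cdiff y = 0 ->
  ins 2%N prodc y = sgn (~~ odd n) (ins n y prodc) :> C.
Proof.
move=> yn; rewrite (ins_prodc yn) /cdiff (twist_supp _ yn) sgnMl => /eqP.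
rewrite subr_eq0 subr_eq => /eqP E.
rewrite sgnD sgn_sgn addbb (_ : sgn false _ = idc * y) // E.
by case: (odd n); rewrite /sgn /=; zmod.
Qed.

(** In the inserted cochain additivity is not formal: its values become letters of [x], which has to
    be multiadditive. *)
Lemma ins_letters n y z (x : C) : multiadditive x ->
  ins n (y - z) x = ins n y x - ins n z x :> C.
Proof.
move=> xm; apply/funext => w; rewrite convDE convNE.
have xB u a b t : x (u ++ (a - b) :: t) = x (u ++ a :: t) - x (u ++ b :: t).
  by apply/eqP; rewrite eq_sym subr_eq -xm subrK.
elim: w x {xm} xB => [|a w IH] x xB /=.
  rewrite !addr0 /cutp; case: leqP => // _; last by rewrite subr0.
  by rewrite -[RHS](xB [::]).
rewrite (IH (fun u => x (a :: u))); last by move=> u; apply: (xB (a :: u)).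
have -> : cutp n (fun v t => x ((y - z) v :: t)) (a :: w) =
  cutp n (fun v t => x (y v :: t)) (a :: w) - cutp n (fun v t => x (z v :: t)) (a :: w).
  rewrite /cutp; case: leqP => // _; last by rewrite subr0.
  by rewrite -(xB [::]).
by rewrite sgnD sgnN; zmod.
Qed.

End HochschildComplex.
Arguments idc {K} A _.
Arguments prodc {K} A _.

(** * The bracket, the differential and the homotopies on words *)

Section HochschildIdentities.
Variables (K : fieldType) (A : assocAlgType K).
Local Notation C := (conv A (aring A)).
Implicit Types x y z : C.

Lemma insB n (y : seq A -> A) F G : ins n y (F - G : C) = (ins n y F : C) - (ins n y G : C) :> C.
Proof. by rewrite -[in RHS](subrK G F) [in RHS](insD n y (F - G)) addrK. Qed.
Lemma ins2B n (y : seq A -> A) p z F G :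
  ins2 n y p z (F - G : C) = (ins2 n y p z F : C) - (ins2 n y p z G : C) :> C.
Proof. by rewrite -[in RHS](subrK G F) [in RHS](ins2D n y p z (F - G)) addrK. Qed.

Lemma ins_zero n (y : seq A -> A) : ins n y (0 : C) = 0 :> C.
Proof. by have := insB n y 0 0; rewrite subrr => ->; rewrite subrr. Qed.
Lemma ins_0 n x : multiadditive x -> ins n (0 : C) x = 0 :> C.
Proof. by move=> xm; rewrite -[0 in LHS](subrr (0 : C)) (ins_letters n 0 0 xm) subrr. Qed.

Lemma ins_letters_sgn b n y x : multiadditive x -> ins n (sgn b y) x = sgn b (ins n y x) :> C.
Proof.
case: b => //= xm; have := ins_letters n 0 y xm.
by rewrite sub0r (ins_0 n xm) sub0r.
Qed.

(** The degrees are arguments because a function on words does not determine them: 0 is supported in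
    every degree. *)
Definition lie m n x y : C := ins n y x - sgn (~~ odd m && ~~ odd n) (ins m x y : C).

Lemma supp_lie m n x y : supported m x -> supported n y -> supported (m + n).-1 (lie m n x y).
Proof.
move=> xm yn w wmn; rewrite /lie convDE convNE conv_sgnE (supp_ins y xm) //.
by rewrite (supp_ins x yn) 1?addnC // sgn0 subr0.
Qed.

Lemma lie_supp0 x y : supported 0 x -> supported 0 y -> lie 0 0 x y = 0.
Proof. by move=> x0 y0; rewrite /lie !ins_supp0 // sgn0 subr0. Qed.

Lemma ins_lie n y p z x : supported n y -> supported p z -> multiadditive x ->
  ins p z (ins n y x) - sgn (~~ odd n && ~~ odd p) (ins n y (ins p z x) : C) =
  ins (n + p).-1 (lie n p y z) x.
Proof.
move=> yn zp xm.
have E m : supported m (lie n p y z) -> ~~ odd m = ~~ odd n (+) ~~ odd p ->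
    ins p z (ins n y x) - sgn (~~ odd n && ~~ odd p) (ins n y (ins p z x) : C) =
    ins m (lie n p y z) x.
  by move=> mb e; exact: (ins_bracket yn zp mb e xm).
have [np|np] := posnP (n + p)%N; last first.
  apply: E; first exact: supp_lie.
  by move: np; clear; case: n p => [|n] [|p] //=; rewrite ?addn0 ?oddD /=; do 2?case: odd.
move/eqP: np; rewrite addn_eq0 => /andP[/eqP n0 /eqP p0]; subst n p.
(* For n = p = 0 the bracket vanishes, so it may be regarded as supported in degree 1, which has the
   parity that the sign rule demands. *)
have l0 := lie_supp0 yn zp; rewrite (E 1%N) // l0 ?ins_0 //.
Qed.

(** The commutation rule for [y] and [prodc], whose bracket is [- cdiff y], moves [y] past the inner
    faces. In the outer faces [y] can also be inserted into [idc], and this leaves the two products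
    of [x] and [y]: for cocycles, x{y} is a homotopy between them. *)
Lemma cdiff_ins m n x y (s := ~~ odd n) : supported m x -> supported n y -> multiadditive x ->
  cdiff (ins n y x) = sgn s (ins n y (cdiff x) : C) + (ins n.+1 (cdiff y) x : C)
    - sgn s (y * x - (twist (odd n) x : C) * y).
Proof.
move=> xm yn xa.
have bE : lie n 2%N y (prodc A) = - cdiff y.
  rewrite /lie andbT (ins_prodc yn) /cdiff sgnD sgn_sgn addbb (twist_supp _ yn) sgnMl.
  by case: (odd n); rewrite /sgn /=; zmod.
have := ins_lie yn (@supp_prodc K A) xa.
rewrite bE addn2 -[- cdiff y]/(sgn true (cdiff y)) ins_letters_sgn // andbT /= => E.
rewrite /cdiff -/(cdiff y); rewrite [twist true (ins _ _ _)]/=.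
have -> : ins 2%N (prodc A) (ins n y x) =
    sgn s (ins n y (ins 2%N (prodc A) x) : C) - ins n.+1 (cdiff y) x :> C.
  by rewrite /s -E; zmod.
have -> : ins n y ((idc A) * x - ins 2%N (prodc A) x - (twist true x : C) * (idc A)) =
   (y * x + sgn s (idc A) * (ins n y x : C)) - (ins n y (ins 2%N (prodc A) x) : C)
   - (sgn s (twist true (ins n y x) : C) * (idc A) + (twist (~~ s) x : C) * y) :> C.
  rewrite !insB !ins_mul !ins_twist (ins_idc yn) (twist_supp _ (@supp_idc K A)).
  by rewrite twist_twist andbT addbT.
have -> : odd n = ~~ s by rewrite negbK.
by case: (s); rewrite /sgn /= ?mulNr; zmod.
Qed.

(** Antisymmetrizing [cdiff_ins] cancels the products of [x] and [y]. *)
Lemma cdiff_lie m n x y : supported m x -> supported n y ->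
  multiadditive x -> multiadditive y ->
  cdiff (lie m n x y) =
  sgn (~~ odd n) (lie m.+1 n (cdiff x) y) + lie m n.+1 x (cdiff y).
Proof.
move=> xm yn xa ya; rewrite /lie.
have cdiffB F G : cdiff (F - G : C) = cdiff F - cdiff G.
  by rewrite -[in RHS](subrK G F) [in RHS]cdiffD addrK.
have cdiff_sgn b F : cdiff (sgn b F : C) = sgn b (cdiff F).
  case: b => //=; have := cdiffB 0 F; have := cdiffB 0 0.
  by rewrite !subrr !sub0r => ->; rewrite sub0r.
rewrite cdiffB cdiff_sgn (cdiff_ins xm yn xa) (cdiff_ins yn xm ya).
rewrite (twist_supp _ xm) (twist_supp _ yn) !sgnMl /=.
case: (odd m); case: (odd n); rewrite /sgn /=; zmod.
Qed.

Lemma lie_antisym m n x y :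
  lie m n x y = - sgn (~~ odd m && ~~ odd n) (lie n m y x).
Proof.
rewrite /lie sgnD sgnN sgn_sgn andbC addbb; zmod.
Qed.

(** Insertions of a bracket become differences of twofold insertions by [ins_lie]; all terms then
    have this form and cancel in pairs. *)
Lemma lie_jacobi m n p x y z : supported m x -> supported n y -> supported p z ->
  multiadditive x -> multiadditive y -> multiadditive z ->
  lie m (n + p).-1 x (lie n p y z) =
  lie (m + n).-1 p (lie m n x y) z
  + sgn (~~ odd m && ~~ odd n) (lie n (m + p).-1 y (lie m p x z)).
Proof.
move=> xm yn zp xa ya za.
(* The predecessor of k + l has the parity of the sum of the shifted degrees except for k = l = 0,
   where the bracket is zero and takes any sign. *)
have par k l u v : supported k u -> supported l v ->
    lie k l u v = 0 \/ ~~ odd (k + l).-1 = ~~ odd k (+) ~~ odd l.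
  move=> uk vl; have [kl|kl] := posnP (k + l)%N; last first.
    by right; move: kl; clear; case: k l => [|k] [|l] //=; rewrite ?addn0 ?oddD /=; do 2?case: odd.
  by left; move/eqP: kl uk vl; rewrite addn_eq0 => /andP[/eqP-> /eqP->]; apply: lie_supp0.
have sgn_fun_lie b k l u v j F : supported k u -> supported l v ->
    sgn (b && ~~ odd (k + l).-1) (ins j F (lie k l u v) : C) =
    sgn (b && (~~ odd k (+) ~~ odd l)) (ins j F (lie k l u v) : C).
  by move=> uk vl; case: (par k l u v uk vl) => ->; rewrite ?ins_zero ?sgn0.
have sgn_lie_fun b k l u v j F : supported k u -> supported l v -> multiadditive F ->
    sgn (~~ odd (k + l).-1 && b) (ins j (lie k l u v) F : C) =
    sgn ((~~ odd k (+) ~~ odd l) && b) (ins j (lie k l u v) F : C).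
  by move=> uk vl Fa; case: (par k l u v uk vl) => ->; rewrite ?ins_0 ?sgn0.
have ins_sgnC k b (u : seq A -> A) (F : C) : ins k u (sgn b F) = sgn b (ins k u F : C) :> C.
  by case: b => //=; have := insB k u 0 F; rewrite ins_zero !sub0r.
rewrite {1}[in LHS]/lie {1}[in X in _ = X + _]/lie {1}[in X in _ = _ + sgn _ X]/lie.
rewrite sgn_fun_lie // sgn_fun_lie // sgn_lie_fun //.
rewrite -!ins_lie // /lie !insB !ins_sgnC.
case: (odd m); case: (odd n); case: (odd p); rewrite /sgn /=; zmod.
Qed.

Lemma cocycle_commut m n x y : supported m x -> supported n y -> multiadditive x ->
  cdiff x = 0 -> cdiff y = 0 ->
  x * y = sgn (odd m && odd n) (y * x) + sgn (odd m && odd n) (sgn (~~ odd n) (cdiff (ins n y x))).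
Proof.
move=> xm yn xa dx dy; rewrite (cdiff_ins xm yn xa) dx dy (twist_supp _ xm) sgnMl.
rewrite ins_zero ins_0 //; case: (odd m); case: (odd n); rewrite /sgn /=; zmod.
Qed.

(** Write π for [prodc]. Inserting [y] and [z] into the equation [cdiff x = 0] expresses x{π}{y, z}
    by products, the contributions of the outer faces. By [ins_ins2] it is also a combination of
    x{y, z}{π}, the inner faces of the homotopy, and x{π{y, z}}, where π{y, z} is [y * z] up to
    sign. *)
Lemma ins_cocycle_mul m n p x y z :
  supported m x -> supported n y -> supported p z -> multiadditive x ->
  cdiff x = 0 -> cdiff y = 0 -> cdiff z = 0 ->
  ins (n + p)%N (y * z) x =
  y * (ins p z x : C) + sgn (~~ odd m && odd p) ((ins n y x : C) * z)
  + sgn (~~ odd n (+) ~~ odd p (+) (~~ odd p && odd n)) (cdiff (ins2 n y p z x)).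
Proof.
move=> xm yn zp xa dx dy dz.
set s := ~~ odd n; set t := ~~ odd p.
have on : odd n = ~~ s by rewrite negbK.
have op : odd p = ~~ t by rewrite negbK.
have yzn : supported (n + p)%N (sgn (t && odd n) (y * z)).
  by move=> w wn; rewrite conv_sgnE (supp_conv yn zp) ?sgn0.
have := ins_ins2 yn zp (@supp_prodc K A) (ins_cocycle yn dy) (ins_cocycle zp dz).
rewrite (ins2_prodc yn zp) => /(_ _ _ yzn xa).
rewrite ins_letters_sgn // -/s -/t => E.
(* The case m = 0, in which the predecessor may be truncated, is separate: there x{y} is zero. *)
have tw : (twist (t (+) true) (ins n y x) : C) = sgn (~~ t && (odd m (+) s)) (ins n y x : C).
  case: m xm => [|m] xm.
    by rewrite (ins_supp0 _ _ xm); apply/funext => w; rewrite /twist conv_sgnE !sgn0.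
  rewrite (twist_supp _ (supp_ins y xm)) addbT; congr (sgn (_ && _) _).
  by rewrite addSn /= oddD on; case: (odd m); case: (s).
have d2 : ins2 n y p z (cdiff x) = 0 :> C.
  by rewrite dx; have := ins2B n y p z 0 0; rewrite !subrr.
have i2 : ins2 n y p z (idc A) = 0 :> C by rewrite (@ins2_supp01 _ _ _ _ _ _ _ 1%N) //; exact: supp_idc.
move: d2; rewrite /cdiff !ins2B !ins2_mul i2 mulr0 mul0r ins2_twist ins_twist (ins_idc yn) (ins_idc zp).
rewrite (twist_supp _ yn) (twist_supp _ (@supp_idc K A)) !twist_sgn twist_twist tw.
move: E; rewrite -/s -/t on op !(sgnMl, sgnMr, sgn_sgn).
(* Once [E] has eliminated x{y, z}{π}, the difference of the two sides is the vanishing left side of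
   [H] up to the sign [~~ (t && ~~ s)]. *)
move=> E H; apply/eqP; rewrite -subr_eq0 -(sgn0 _ (~~ (t && ~~ s))) -H.
rewrite -(subrK (sgn (s (+) t) (ins2 n y p z (ins 2%N (prodc A) x) : C))
  (ins 2%N (prodc A) (ins2 n y p z x))) E.
apply/eqP; clear; case: (s); case: (t); case: (odd m); rewrite /sgn /=; zmod.
Qed.
End HochschildIdentities.

(** * Sweedler sums *)

Section LinearProp.
Variables (K : fieldType) (U W : lmodType K) (f : U -> W).
Hypothesis fl : linear f.
Lemma lin0 : f 0 = 0.
Proof. by have := fl (-1) 0 0; rewrite scaler0 addr0 scaleN1r addNr. Qed.
Lemma linD u v : f (u + v) = f u + f v.
Proof. by have := fl 1 u v; rewrite !scale1r. Qed.
Lemma linZ k u : f (k *: u) = k *: f u.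
Proof. by have := fl k u 0; rewrite lin0 !addr0. Qed.
Lemma lin_sum (I : Type) (r : seq I) (F : I -> U) :
  f (\sum_(i <- r) F i) = \sum_(i <- r) f (F i).
Proof. exact: (big_morph f linD lin0). Qed.
Lemma lin_sgn b u : f (sgn b u) = sgn b (f u).
Proof. by case: b => //=; rewrite /sgn -scaleN1r linZ scaleN1r. Qed.
End LinearProp.

Section TensorFacts.
Variable K : fieldType.

Lemma tensor_sum (I : eqType) (V : I -> lmodType K) (t : tensor V) :
  exists s : seq (K * (forall i, V i)), t = \sum_(p <- s) p.1 *: pure p.2.
Proof.
have [u ->] := pi_surj (t : qspace _).
elim/freemod_ind: u => [|k x u [s ih]].
  by exists [::]; rewrite big_nil; exact: (lin0 (@pi_linear _ _ _ _)).
exists ((k, (x : forall i, V i)) :: s); rewrite big_cons -ih /=.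
by rewrite pi_linear.
Qed.

Lemma tensor_lin_ext (I : eqType) (V : I -> lmodType K) (W : lmodType K)
    (f g : tensor V -> W) :
  linear f -> linear g -> (forall v, f (pure v) = g (pure v)) -> f =1 g.
Proof.
move=> fl gl fg t; have [s ->] := tensor_sum t.
rewrite (lin_sum fl) (lin_sum gl); apply: eq_bigr => p _.
by rewrite (linZ fl) (linZ gl) fg.
Qed.

Variables U V W : lmodType K.

Definition bilin (f : U -> V -> W) :=
  (forall v, linear (f^~ v)) /\ (forall u, linear (f u)).

Lemma bilin_multilinear f : bilin f ->
  @multilinear K _ (fun i : bool => if i then V else U) W
    (fun w => f (w false) (w true)).
Proof.
by move=> [fl fr] v [] a x y; rewrite !dfwith_in !dfwith_out //; [apply: fr | apply: fl].
Qed.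
Lemma blift_linear f : bilin f -> linear (blift f).
Proof. by move=> fb; apply: tlift_linear; apply: bilin_multilinear. Qed.
Lemma blift_pure f u v : bilin f -> blift f (u ⊗ v) = f u v.
Proof. by move=> fb; rewrite /blift tlift_pure //; apply: bilin_multilinear. Qed.
End TensorFacts.

Section Bpure.
Variables (K : fieldType) (U V : lmodType K).

Lemma bpure_bilin : bilin (@bpure K U V).
Proof.
have E (w : forall i : bool, if i then V else U : lmodType K) i (x : if i then V else U) :
    pure (dfwith w x) = (dfwith w x false : U) ⊗ (dfwith w x true : V).
  congr (pure _); apply: functional_extensionality_dep => -[] //.
split=> [v|u] a x y.
  have := @pure_multilinear K bool (fun i => if i then V else U)
    (fun i => if i return (if i then V else U : lmodType K) then v else 0) false a x y.
  by rewrite !E !dfwith_in !dfwith_out.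
have := @pure_multilinear K bool (fun i => if i then V else U)
  (fun i => if i return (if i then V else U : lmodType K) then 0 else u) true a x y.
by rewrite !E !dfwith_in !dfwith_out.
Qed.

Lemma btensor_sum (t : btensor U V) :
  exists s : seq (U * V), t = \sum_(p <- s) p.1 ⊗ p.2.
Proof.
have [s ->] := tensor_sum t.
pose F (p : K * (forall i : bool, if i then V else U : lmodType K)) : U * V :=
  (p.1 *: (p.2 false : U), p.2 true : V).
exists [seq F p | p <- s].
rewrite big_map; apply: eq_bigr => -[k v] _ /=.
rewrite (linZ (bpure_bilin.1 _)); congr (_ *: pure _).
by apply: functional_extensionality_dep => -[].
Qed.
End Bpure.

Section Sweedler.
Variables (K : fieldType) (H : algType K).
Variables (comul : {linear H -> btensor H H}) (counit : {linear H -> K^o}).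
Hypothesis bialgH : is_bialgebra comul counit.

(** A chosen decomposition of the coproduct. Sums over it are finite sums, which commute with linear
    maps for arbitrary summands; bilinear summands make them agree with [blift], hence independent
    of the choice and linear in [b]. *)
Definition cop b : seq (H * H) := sval (cid (btensor_sum (comul b))).
Lemma copE b : comul b = \sum_(p <- cop b) p.1 ⊗ p.2.
Proof. exact: (svalP (cid (btensor_sum (comul b)))). Qed.

Definition sw (W : zmodType) b (f : H -> H -> W) : W := \sum_(p <- cop b) f p.1 p.2.

Lemma eq_sw (W : zmodType) b (f g : H -> H -> W) :
  (forall b1 b2, f b1 b2 = g b1 b2) -> sw b f = sw b g.
Proof. by move=> fg; apply: eq_bigr => p _; apply: fg. Qed.

Section Target.
Variable W : lmodType K.
Implicit Types (f g : H -> H -> W).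

Lemma blift_sw f b : bilin f -> blift f (comul b) = sw b f.
Proof.
move=> fb; rewrite copE (lin_sum (blift_linear fb)).
by apply: eq_bigr => p _; rewrite blift_pure.
Qed.

Lemma sw_linear f : bilin f -> linear (fun b => sw b f).
Proof.
move=> fb k b c; rewrite -!blift_sw // linearP.
exact: blift_linear.
Qed.

Lemma swP k f g b : sw b (fun b1 b2 => k *: f b1 b2 + g b1 b2) = k *: sw b f + sw b g.
Proof. by rewrite /sw big_split scaler_sumr. Qed.

Definition trilin (f : H -> H -> H -> W) :=
  [/\ forall b c, linear (fun a => f a b c), forall a c, linear (fun b => f a b c)
    & forall a b, linear (fun c => f a b c)].
End Target.

Lemma sw_counitl (W : lmodType K) (g : H -> W) b : linear g -> sw b (fun b1 b2 => (counit b1 : K) *: g b2) = g b.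
Proof.
move=> gl; rewrite -[in RHS](counitl bialgH b) blift_sw; last first.
  split=> [b2|b1] k c d; first by rewrite linearP scalerDl scalerA.
  by rewrite scalerDr !scalerA mulrC.
rewrite (lin_sum gl); apply: eq_bigr => p _.
by rewrite (linZ gl).
Qed.

Lemma sw_counitr (W : lmodType K) (g : H -> W) b : linear g -> sw b (fun b1 b2 => (counit b2 : K) *: g b1) = g b.
Proof.
move=> gl; rewrite -[in RHS](counitr bialgH b) blift_sw; last first.
  split=> [b2|b1] k c d; last by rewrite linearP scalerDl scalerA.
  by rewrite scalerDr !scalerA mulrC.
rewrite (lin_sum gl); apply: eq_bigr => p _.
by rewrite (linZ gl).
Qed.


(** A trilinear [f] factors through a ⊗ (b ⊗ c), and the induced linear map is applied to the
    coassociativity of [comul]. *)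
Lemma sw_coassoc (W : lmodType K) (f : H -> H -> H -> W) b : trilin f ->
  sw b (fun b1 b2 => sw b1 (fun b11 b12 => f b11 b12 b2)) =
  sw b (fun b1 b2 => sw b2 (fun b21 b22 => f b1 b21 b22)).
Proof.
move=> [f1 f2 f3].
have fb a : bilin (f a) by split=> *; [apply: f2 | apply: f3].
have Fb : bilin (fun a t => blift (f a) t).
  split=> [t|a]; last exact: blift_linear.
  by move=> k a a'; apply: tlift_fun_linear => v; apply: f1.
have FE a b' c : blift (fun a t => blift (f a) t) (a ⊗ (b' ⊗ c)) = f a b' c.
  by rewrite blift_pure // blift_pure.
have Fl := blift_linear Fb.
have [P1 P2 P3] : trilin (fun a b' c : H => a ⊗ (b' ⊗ c)).
  split=> a c k x y; first exact: (bpure_bilin _ _).1.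
    by rewrite (bpure_bilin _ _).1; apply: (bpure_bilin _ _).2.
  by rewrite (bpure_bilin _ _).2; apply: (bpure_bilin _ _).2.
have FsumE g c : bilin g -> blift (fun a t => blift (f a) t) (blift g (comul c)) =
    sw c (fun c1 c2 => blift (fun a t => blift (f a) t) (g c1 c2)).
  by move=> gb; rewrite blift_sw // (lin_sum Fl).
have B1 (c : H) : bilin (fun b11 b12 : H => b11 ⊗ (b12 ⊗ c)).
  by split=> d; [exact: (P1 d c) | exact: (P2 d c)].
have B2 (a : H) : bilin (fun b21 b22 : H => a ⊗ (b21 ⊗ b22)) by split=> d; [exact: (P2 a d) | exact: (P3 a d)].
have := congr1 (blift (fun a t => blift (f a) t)) (comulA bialgH b).
rewrite !FsumE; first last.
- split=> [c|a] k x y; first by rewrite linearP; exact: (blift_linear (B1 c)).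
  by apply: tlift_fun_linear => v; exact: P3.
- split=> [c|a] k x y; last by rewrite linearP; exact: (blift_linear (B2 a)).
  by apply: tlift_fun_linear => v; exact: P1.
rewrite /sw; under eq_bigr do rewrite FsumE //.
under [X in _ = X]eq_bigr do rewrite FsumE //.
move=> E; transitivity (sw b (fun b1 b2 => sw b1 (fun b11 b12 =>
    blift (fun a t => blift (f a) t) (b11 ⊗ (b12 ⊗ b2))))).
  by apply: eq_bigr => p _; apply: eq_bigr => q _; rewrite FE.
by rewrite {1}/sw E; apply: eq_bigr => p _; apply: eq_bigr => q _; rewrite FE.
Qed.
End Sweedler.

(** * Multilinear and equivariant cochains *)

Section Multilinear.
Variables (K : fieldType) (A : lmodType K).

Definition mlin (W : lmodType K) (F : seq A -> W) :=
  forall u t k a b, F (u ++ (k *: a + b) :: t) = k *: F (u ++ a :: t) + F (u ++ b :: t).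

Section Target.
Variable W : lmodType K.
Implicit Types F G : seq A -> W.

Lemma mlin_multiadditive F : mlin F -> multiadditive F.
Proof. by move=> Fm u t a b; have := Fm u t 1 a b; rewrite !scale1r. Qed.
Lemma mlin_cons F a : mlin F -> mlin (fun u => F (a :: u)).
Proof. by move=> Fm u; apply: (Fm (a :: u)). Qed.
Lemma mlin_head F t : mlin F -> linear (fun a => F (a :: t)).
Proof. by move=> Fm k a b; apply: (Fm [::]). Qed.
Lemma mlin_rec F :
  (forall t, linear (fun a => F (a :: t))) -> (forall a, mlin (fun u => F (a :: u))) -> mlin F.
Proof. by move=> F0 FS [|a u] t k b c; [apply: F0 | apply: FS]. Qed.

Lemma mlin_comp F (V : lmodType K) (h : W -> V) : linear h -> mlin F -> mlin (fun w => h (F w)).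
Proof. by move=> hl Fm u t k a b; rewrite Fm hl. Qed.
Lemma mlin_lin k F G : mlin F -> mlin G -> mlin (fun w => k *: F w + G w).
Proof.
move=> Fm Gm u t c a b; rewrite Fm Gm !scalerDr !scalerA [k * c]mulrC.
by rewrite addrACA.
Qed.
Lemma mlin0 : mlin (fun=> 0 : W).
Proof. by move=> u t k a b; rewrite scaler0 addr0. Qed.
Lemma linear_sgn b : linear (sgn b : W -> W).
Proof. by move=> k u v; rewrite sgnD sgnZ. Qed.
Lemma mlin_sgn b F : mlin F -> mlin (fun w => sgn b (F w)).
Proof. exact/mlin_comp/linear_sgn. Qed.

Lemma mlin_cutp n (f : seq A -> seq A -> W) :
  (forall t, mlin (f^~ t)) -> (forall v, mlin (f v)) -> mlin (cutp n f).
Proof.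
elim: n f => [|n IH] f fv ft.
  by move=> u t k a b; rewrite !cutp0; apply: ft.
apply: mlin_rec => [t k a b|a].
  rewrite !cutpS_cons /cutp; case: leqP => _; last by rewrite scaler0 addr0.
  exact: (fv _ [::]).
by apply: (IH (fun v => f (a :: v))) => [t|v]; [exact: (mlin_cons a (fv t)) | exact: ft].
Qed.

Lemma ins_lin n (y : seq A -> A) k F G w :
  ins n y (fun u => k *: F u + G u) w = k *: ins n y F w + ins n y G w.
Proof.
have := congr1 (@^~ w) (insD n y (fun u => k *: F u) G) => /= E.
rewrite [LHS]E; congr (_ + _).
by rewrite -(ins_nat (GRing.scale k)).
Qed.

Lemma mlin_ins n (y : seq A -> A) F : mlin y -> mlin F -> mlin (ins n y F).
Proof.
move=> ym Fm u; elim: u F Fm => [|c u IH] F Fm t k a b; last first.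
  rewrite !cat_cons.
  have C : mlin (cutp n (fun v t => F (y v :: t))).
    apply: mlin_cutp => [t' u' t'' k' a' b'|v]; first by rewrite ym (Fm [::]).
    exact: mlin_cons.
  have /= Ct := C (c :: u) t k a b.
  by rewrite /= Ct IH ?sgnD -?sgnZ; [rewrite scalerDr addrACA | apply: mlin_cons].
have C : mlin (cutp n (fun v t => F (y v :: t))).
  apply: mlin_cutp => [t' u' t'' k' a' b'|v]; first by rewrite ym (Fm [::]).
  exact: mlin_cons.
have /= Ct := C [::] t k a b; rewrite /= Ct.
have -> : (fun u => F ((k *: a + b) :: u)) = (fun u => k *: F (a :: u) + F (b :: u)).
  by apply/funext => u; apply: (Fm [::]).
by rewrite ins_lin sgnD -sgnZ scalerDr addrACA.
Qed.

Lemma ins2_lin n (y : seq A -> A) p z k F G w :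
  ins2 n y p z (fun u => k *: F u + G u) w = k *: ins2 n y p z F w + ins2 n y p z G w.
Proof.
have := congr1 (@^~ w) (ins2D n y p z (fun u => k *: F u) G) => /= E.
rewrite [LHS]E; congr (_ + _).
by rewrite -(ins2_nat (GRing.scale k)).
Qed.

Lemma mlin_ins2 n (y : seq A -> A) p (z : seq A -> A) F :
  mlin y -> mlin z -> mlin F -> mlin (ins2 n y p z F).
Proof.
move=> ym zm Fm.
have C G : mlin G -> mlin (cutp n (fun v t =>
    sgn (~~ odd p && odd n) (ins p z (fun u => G (y v :: u)) t))).
  move=> Gm; apply: mlin_cutp => [t' u' t'' k' a' b'|v]; last first.
    by apply/mlin_sgn/mlin_ins => //; apply: mlin_cons.
  rewrite -linear_sgn -ins_lin; congr (sgn _ (ins p z _ _)).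
  by apply/funext => w; rewrite ym (Gm [::]).
move=> u; elim: u F Fm => [|c u IH] F Fm t k a b; last first.
  have /= Ct := C _ Fm (c :: u) t k a b.
  by rewrite /= Ct IH ?sgnD -?sgnZ; [rewrite scalerDr addrACA | apply: mlin_cons].
have /= Ct := C _ Fm [::] t k a b; rewrite /= Ct.
have -> : (fun u => F ((k *: a + b) :: u)) = (fun u => k *: F (a :: u) + F (b :: u)).
  by apply/funext => u; apply: (Fm [::]).
by rewrite ins2_lin sgnD -sgnZ scalerDr addrACA.
Qed.
End Target.
End Multilinear.

Section AlgebraMultilinear.
Variables (K : fieldType) (A : assocAlgType K).
Local Notation C := (conv A (aring A)).
Implicit Types x y z : C.

Lemma conv_linl k x y z w :
  (((fun u => k *: x u + y u : aring A) : C) * z) w = k *: (x * z) w + (y * z) w.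
Proof.
elim: w x y => [|a w IH] x y.
  by rewrite !conv_nil; apply: amul_linearl.
by rewrite !conv_cons (IH (fun u => x (a :: u))) [_ * _](amul_linearl (z (a :: w))) scalerDr addrACA.
Qed.

Lemma conv_linr k x y z w :
  (z * ((fun u => k *: x u + y u : aring A) : C)) w = k *: (z * x) w + (z * y) w.
Proof.
elim: w z => [|a w IH] z.
  by rewrite !conv_nil; apply: amul_linearr.
by rewrite !conv_cons IH [_ * _](amul_linearr (z [::])) scalerDr addrACA.
Qed.

Lemma mlin_conv x y : mlin x -> mlin y -> mlin (x * y).
Proof.
move=> xm ym u; elim: u x xm => [|c u IH] x xm t k a b; last first.
  rewrite !cat_cons !conv_cons (ym (c :: u)) (IH (fun u => x (c :: u))); last exact: mlin_cons.
  by rewrite [_ * _]amul_linearr scalerDr addrACA.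
rewrite !cat0s !conv_cons (ym [::]) [_ * _]amul_linearr.
have -> : (fun u => x ((k *: a + b) :: u)) = (fun u => k *: x (a :: u) + x (b :: u)).
  by apply/funext => u; apply: (xm [::]).
by rewrite conv_linl scalerDr addrACA.
Qed.

Lemma mlin_idc : mlin (idc A).
Proof.
apply: mlin_rec => [[|c t] k a b|a] //=; first by rewrite scaler0 addr0.
by case=> [|c u] [|d t] k b e /=; rewrite scaler0 addr0.
Qed.
End AlgebraMultilinear.

(** * The diagonal action on words and equivariance *)

Section DiagonalAction.
Variables (K : fieldType) (H : algType K) (A : assocAlgType K).
Variables (comul : {linear H -> btensor H H}) (counit : {linear H -> K^o}).
Variable act : H -> {linear A -> A}.
Hypothesis bialgH : is_bialgebra comul counit.
Hypothesis modalgA : is_module_algebra comul counit act.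
Local Notation swc := (sw comul).

(* The sum of F (b_(1) a_1 ... b_(n) a_n) over the n-fold coproduct of b. *)
Fixpoint hact (W : lmodType K) (w : seq A) (b : H) (F : seq A -> W) : W :=
  if w is a :: w' then swc b (fun b1 b2 => hact w' b2 (fun u => F (act b1 a :: u)))
  else (counit b : K) *: F [::].

Lemma lin_sw (U V : lmodType K) (h : U -> V) b (f : H -> H -> U) :
  linear h -> h (swc b f) = swc b (fun b1 b2 => h (f b1 b2)).
Proof. by move=> hl; apply: (lin_sum hl). Qed.

Section Target.
Variable W : lmodType K.
Implicit Types F G : seq A -> W.

Lemma hact_lin_fun w b k F G :
  hact w b (fun u => k *: F u + G u) = k *: hact w b F + hact w b G.
Proof.
elim: w b F G => [|a w IH] b F G /=.
  by rewrite scalerDr !scalerA mulrC.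
rewrite -swP; apply: eq_sw => b1 b2; exact: IH.
Qed.

Lemma hact_comp (V : lmodType K) (h : W -> V) w b F : linear h ->
  hact w b (fun u => h (F u)) = h (hact w b F).
Proof.
move=> hl; elim: w b F => [|a w IH] b F /=; first by rewrite (linZ hl).
by rewrite (lin_sw _ _ hl); apply: eq_sw => b1 b2; apply: IH.
Qed.

Lemma hact_bilin w F a : mlin F -> (forall G, mlin G -> linear (fun b => hact w b G)) ->
  bilin (fun b1 b2 => hact w b2 (fun u => F (act b1 a :: u))).
Proof.
move=> Fm Gl; split=> [b2 k c d|b1]; last exact/Gl/mlin_cons.
rewrite -hact_lin_fun; congr hact; apply/funext => u.
by rewrite (act_linear modalgA) (Fm [::]).
Qed.

Lemma hact_linear w F : mlin F -> linear (fun b => hact w b F).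
Proof.
elim: w F => [|a w IH] F Fm.
  by move=> k b c; rewrite /= linearP scalerDl scalerA.
exact: (sw_linear comul (hact_bilin a Fm IH)).
Qed.

Lemma hact_size w b F n : size w = n -> (forall u, size u = n -> F u = 0) -> hact w b F = 0.
Proof.
elim: w n b F => [|a w IH] n b F <- F0 /=; first by rewrite F0 // scaler0.
by rewrite /swc big1 // => p _; apply: (IH (size w)) => // u uw; rewrite F0 //= uw.
Qed.

Lemma cutp_sw n b (f : H -> H -> seq A -> seq A -> W) w :
  swc b (fun b1 b2 => cutp n (f b1 b2) w) = cutp n (fun v t => swc b (fun b1 b2 => f b1 b2 v t)) w.
Proof. by rewrite /cutp; case: leqP => // _; rewrite /swc big1. Qed.

(** By coassociativity the iterated coproduct splits at a cut: one leg of a single coproduct acts on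
    the prefix, the other on the rest. The empty prefix is the counit law. *)
Lemma hact_cutp n (f : seq A -> seq A -> W) w b :
  (forall t, mlin (f^~ t)) -> (forall v, mlin (f v)) ->
  hact w b (cutp n f) =
  cutp n (fun v t => swc b (fun b1 b2 => hact v b1 (fun v' => hact t b2 (f v')))) w.
Proof.
elim: n f w b => [|n IH] f w b fv ft.
  rewrite cutp0 /= (sw_counitl bialgH _ (hact_linear w (ft [::]))).
  by congr hact; apply/funext => u; rewrite cutp0.
case: w => [|a w]; first by rewrite /= scaler0.
have fva c t : mlin (fun v => f (c :: v) t) by apply: (mlin_cons c (fv t)).
rewrite cutpS_cons /= -[LHS]/(swc b (fun b1 b2 => hact w b2 (cutp n (fun v => f (act b1 a :: v))))).
transitivity (swc b (fun b1 b2 => cutp n (fun v t => swc b2 (fun b21 b22 =>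
    hact v b21 (fun v' => hact t b22 (f (act b1 a :: v'))))) w)).
  by apply: eq_sw => b1 b2; apply: IH => [t|v]; [apply: fva | apply: ft].
rewrite cutp_sw; apply: eq_cutp => v t _ _.
pose g (p q r : H) := hact v q (fun v' => hact t r (f (act p a :: v'))).
have gm c r : mlin (fun v' => hact t r (f (c :: v'))).
  move=> u u' k d e; rewrite -hact_lin_fun; congr hact; apply/funext => u2.
  exact: fva.
rewrite -(sw_coassoc bialgH (f := g)).
  by apply: eq_sw => b1 b2.
split=> c d k x y; rewrite /g.
- rewrite -hact_lin_fun; congr hact; apply/funext => v'; rewrite -hact_lin_fun.
  by congr hact; apply/funext => u; rewrite (act_linear modalgA) (fv u [::]).
- exact: (hact_linear v (gm _ _)).
- rewrite -hact_lin_fun; congr hact; apply/funext => v'.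
  exact: (hact_linear t (ft _)).
Qed.

Lemma hactD w b F G : hact w b (fun u => F u + G u) = hact w b F + hact w b G.
Proof.
rewrite -[hact w b F]scale1r -hact_lin_fun; congr hact.
by apply/funext => u; rewrite scale1r.
Qed.
Lemma hact_sgn w b c F : hact w b (fun u => sgn c (F u)) = sgn c (hact w b F).
Proof. exact/hact_comp/linear_sgn. Qed.

Lemma ins_sw n (y : seq A -> A) b (f : H -> H -> seq A -> W) w :
  ins n y (fun u => swc b (fun b1 b2 => f b1 b2 u)) w = swc b (fun b1 b2 => ins n y (f b1 b2) w).
Proof.
rewrite /sw; elim: (cop comul b) => [|p s IH].
  rewrite big_nil; have := ins_nat (GRing.scale (0 : K)) n y (0 : seq A -> W) w; rewrite /= scale0r => E; rewrite [RHS]E.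
  by congr (ins n y _ w); apply/funext => u; rewrite big_nil scaler0.
rewrite big_cons -IH -[RHS](congr1 (@^~ w) (insD n y _ _)).
by congr (ins n y _ w); apply/funext => u; rewrite big_cons.
Qed.
Lemma ins2_sw n (y : seq A -> A) p z b (f : H -> H -> seq A -> W) w :
  ins2 n y p z (fun u => swc b (fun b1 b2 => f b1 b2 u)) w =
  swc b (fun b1 b2 => ins2 n y p z (f b1 b2) w).
Proof.
rewrite /sw; elim: (cop comul b) => [|q s IH].
  rewrite big_nil; have := ins2_nat (GRing.scale (0 : K)) n y p z (0 : seq A -> W) w; rewrite /= scale0r => E; rewrite [RHS]E.
  by congr (ins2 n y p z _ w); apply/funext => u; rewrite big_nil scaler0.
rewrite big_cons -IH -[RHS](congr1 (@^~ w) (ins2D n y p z _ _)).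
by congr (ins2 n y p z _ w); apply/funext => u; rewrite big_cons.
Qed.
Lemma sw_sgn c b (f : H -> H -> W) : swc b (fun b1 b2 => sgn c (f b1 b2)) = sgn c (swc b f).
Proof. exact/esym/lin_sw/linear_sgn. Qed.
End Target.

(** H-linearity for the diagonal action, in all lengths at once; on the empty word it says that [y
    [::]] is invariant, since [hact] acts there by the counit. *)
Definition equivariant (y : seq A -> A) := forall b w, hact w b y = act b (y w).

Section Equivariance.
Variable W : lmodType K.
Implicit Type F : seq A -> W.

Lemma hact_cutp_letter n y (G : A -> seq A -> W) w b :
  mlin y -> equivariant y -> (forall t, linear (G^~ t)) -> (forall c, mlin (G c)) ->
  hact w b (cutp n (fun v => G (y v))) =
  cutp n (fun v t => swc b (fun b1 b2 => hact t b2 (G (act b1 (y v))))) w.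
Proof.
move=> ym ye Gl Gm; rewrite hact_cutp; first last.
- by move=> v; apply: Gm.
- by move=> t; apply: mlin_comp (Gl t) ym.
apply: eq_cutp => v t _ _; apply: eq_sw => b1 b2.
rewrite (@hact_comp _ _ (fun c => hact t b2 (G c))) ?ye //.
move=> k c d; rewrite -hact_lin_fun; congr hact; apply/funext => u; exact: Gl.
Qed.

(** Equivariance turns the action of one leg of the coproduct on the block consumed by [y] into its
    action on the single letter that [y] produces. *)
Lemma hact_ins n y F w b : mlin y -> equivariant y -> mlin F ->
  hact w b (ins n y F) = ins n y (fun u => hact u b F) w.
Proof.
move=> ym ye.
pose S G w := if w is a :: w' then sgn (~~ odd n) (ins n y (fun u => G (a :: u)) w') else 0 : W.
have insE G : ins n y G = (fun u => cutp n (fun v t => G (y v :: t)) u + S G u).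
  by apply/funext => -[].
move=> Fm; elim: w F b Fm => [|a w IH] F b Fm.
all: rewrite insE hactD (hact_cutp_letter _ _ _ ym ye (fun t => mlin_head t Fm) (fun c => mlin_cons c Fm)).
  by rewrite /= scaler0.
congr (_ + _); transitivity (swc b (fun b1 b2 =>
    sgn (~~ odd n) (hact w b2 (ins n y (fun u => F (act b1 a :: u)))))).
  by apply: eq_sw => b1 b2; rewrite -hact_sgn.
rewrite sw_sgn; congr sgn.
rewrite [RHS](ins_sw n y b (fun b1 b2 u => hact u b2 (fun u' => F (act b1 a :: u')))).
by apply: eq_sw => b1 b2; apply/IH/mlin_cons.
Qed.

Lemma hact_ins2 n y p z F w b :
  mlin y -> equivariant y -> mlin z -> equivariant z -> mlin F ->
  hact w b (ins2 n y p z F) = ins2 n y p z (fun u => hact u b F) w.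
Proof.
move=> ym ye zm ze.
pose S G w := if w is a :: w' then
  sgn (~~ odd n (+) ~~ odd p) (ins2 n y p z (fun u => G (a :: u)) w') else 0 : W.
pose P G c t := sgn (~~ odd p && odd n) (ins p z (fun u => G (c :: u)) t) : W.
have insE G : ins2 n y p z G = (fun u => cutp n (fun v => P G (y v)) u + S G u).
  by apply/funext => -[].
have PE G w' c : mlin G -> hact w' c (cutp n (fun v => P G (y v))) =
    cutp n (fun v t => P (fun u => hact u c G) (y v) t) w'.
  move=> Gm; rewrite hact_cutp_letter //; first last.
  - by move=> d; apply/mlin_sgn/mlin_ins => //; apply: mlin_cons.
  - move=> t k d e; rewrite /P -linear_sgn -ins_lin; congr (sgn _ (ins p z _ t)).
    by apply/funext => u; apply: (Gm [::]).
  apply: eq_cutp => v t _ _; rewrite /P.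
  rewrite [in RHS](ins_sw p z c (fun b1 b2 u => hact u b2 (fun u' => G (act b1 (y v) :: u')))).
  rewrite -sw_sgn; apply: eq_sw => b1 b2.
  by rewrite hact_sgn hact_ins //; apply: mlin_cons.
move=> Fm; elim: w F b Fm => [|a w IH] F b Fm; rewrite insE hactD PE //.
  by rewrite /= scaler0.
congr (_ + _); transitivity (swc b (fun b1 b2 =>
    sgn (~~ odd n (+) ~~ odd p) (hact w b2 (ins2 n y p z (fun u => F (act b1 a :: u)))))).
  by apply: eq_sw => b1 b2; rewrite -hact_sgn.
rewrite sw_sgn; congr sgn.
rewrite [RHS](ins2_sw n y p z b (fun b1 b2 u => hact u b2 (fun u' => F (act b1 a :: u')))).
by apply: eq_sw => b1 b2; apply/IH/mlin_cons.
Qed.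
End Equivariance.

Local Notation C := (conv A (aring A)).

Lemma conv_sw b (f : H -> H -> C) (z : C) w :
  (((fun u => swc b (fun b1 b2 => f b1 b2 u) : aring A) : C) * z) w =
  swc b (fun b1 b2 => (f b1 b2 * z) w).
Proof.
rewrite /sw; elim: (cop comul b) => [|q s IH].
  rewrite big_nil (_ : (fun u => _) = (0 : C)) ?mul0r //.
  by apply/funext => u; rewrite big_nil.
transitivity (((f q.1 q.2 + (fun u => \sum_(p <- s) f p.1 p.2 u) : C) * z) w).
  by congr (((_ : C) * _) w); apply/funext => u; rewrite big_cons.
by rewrite mulrDl convDE IH big_cons.
Qed.

(** The coproduct splits along every cut of the word: coassociativity gives the inductive step, the
    counit law the cut with empty left part. *)
Lemma hact_conv (x y : C) w b : mlin x -> mlin y ->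
  hact w b (x * y) =
  swc b (fun b1 b2 => (((fun u => hact u b1 x) : C) * ((fun u => hact u b2 y) : C)) w).
Proof.
move=> + ym; elim: w b x => [|a w IH] b x xm.
  transitivity ((x [::] : aring A) * hact [::] b y).
    by rewrite /= conv_nil -[LHS](linZ (amul_linearr _)).
  rewrite -(sw_counitl bialgH b (W := A) (g := fun b2 => (x [::] : aring A) * (hact [::] b2 y))).
    apply: eq_sw => b1 b2; rewrite conv_nil /=.
    exact/esym/(linZ (amul_linearl _)).
  by move=> k c d; rewrite (hact_linear [::] ym); apply: amul_linearr.
transitivity (swc b (fun b1 b2 => (x [::] : aring A) * hact w b2 (fun u => y (act b1 a :: u)))
  + swc b (fun b1 b2 => swc b2 (fun b21 b22 =>
    (((fun u => hact u b21 (fun u' => x (act b1 a :: u'))) : C) * (fun u => hact u b22 y)) w))).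
  rewrite -[RHS]big_split; apply: eq_bigr => p _ /=.
  rewrite -IH; last exact: mlin_cons.
  rewrite -[X in _ = X + _](hact_comp w p.2 (fun u => y (act p.1 a :: u)) (amul_linearr (x [::]))).
  rewrite -[RHS]hactD; congr hact.
  by apply/funext => u; rewrite conv_cons.
pose g (p q r : H) := (((fun u => hact u q (fun u' => x (act p a :: u'))) : C) * (fun u => hact u r y)) w.
have -> : swc b (fun b1 b2 => swc b2 (fun b21 b22 => g b1 b21 b22)) =
    swc b (fun b1 b2 => swc b1 (fun b11 b12 => g b11 b12 b2)).
  symmetry; apply: (sw_coassoc bialgH); split=> c d k e f; rewrite /g.
  - rewrite -conv_linl; congr (((_ : C) * _) w); apply/funext => u.
    rewrite -hact_lin_fun; congr hact; apply/funext => u'.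
    by rewrite (act_linear modalgA) (xm [::]).
  - rewrite -conv_linl; congr (((_ : C) * _) w); apply/funext => u.
    exact/hact_linear/mlin_cons.
  - rewrite -conv_linr; congr (((_ : C) * _) w); apply/funext => u.
    exact: hact_linear.
rewrite -[in LHS](lin_sw _ _ (amul_linearr (x [::]))).
rewrite -[swc b (fun b1 b2 => hact w b2 _)]/(hact (a :: w) b y).
rewrite -[X in X + _ = _](sw_counitl bialgH b (W := A) (g := fun b2 => (x [::] : aring A) * (hact (a :: w) b2 y))).
  rewrite -[LHS]big_split; apply: eq_bigr => p _ /=.
  rewrite conv_cons; congr (_ + _); last by rewrite -conv_sw.
  exact/esym/(linZ (amul_linearl _)).
by move=> k c d; rewrite (hact_linear (a :: w) ym); apply: amul_linearr.
Qed.

Lemma equivariant_conv (x y : C) : mlin x -> mlin y -> equivariant x -> equivariant y ->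
  equivariant (x * y).
Proof.
move=> xm ym xe ye b w; rewrite hact_conv //.
transitivity (swc b (fun b1 b2 =>
    (((fun u => act b1 (x u)) : C) * ((fun u => act b2 (y u)) : C)) w)).
  apply: eq_sw => b1 b2; congr (((_ : C) * (_ : C)) w); apply/funext => u; [exact: xe | exact: ye].
have actM (c d : A) : swc b (fun b1 b2 => (act b1 c : aring A) * act b2 d) = act b ((c : aring A) * d).
  rewrite aringME (act_prod modalgA) blift_sw //; split=> e k g h.
    by rewrite (act_linear modalgA); apply: amul_linearl.
  by rewrite (act_linear modalgA); apply: amul_linearr.
elim: w x {xm xe} => [|a w IH] x.
  by rewrite conv_nil -actM; apply: eq_sw => b1 b2; rewrite conv_nil.
rewrite conv_cons linearD /= -IH -actM -[RHS]big_split.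
by apply: eq_bigr => p _; rewrite conv_cons.
Qed.

Lemma equivariant_idc : equivariant (idc A).
Proof.
move=> b [|a [|c w]]; first by rewrite /= scaler0 linear0.
  rewrite /= (sw_counitr bialgH b (g := fun b1 => act b1 a)) //.
  exact: (act_linear modalgA).
by rewrite linear0 (@hact_size _ _ _ _ (size w).+2) // => -[|? []].
Qed.

Lemma equivariant_ins n (y x : C) : mlin y -> mlin x -> equivariant y -> equivariant x ->
  equivariant (ins n y x).
Proof.
move=> ym xm ye xe b w; rewrite hact_ins // ins_nat; congr (ins n y _ w).
by apply/funext => u; apply: xe.
Qed.
Lemma equivariant_ins2 n p (y z x : C) : mlin y -> mlin z -> mlin x ->
  equivariant y -> equivariant z -> equivariant x -> equivariant (ins2 n y p z x).
Proof.
move=> ym zm xm ye ze xe b w; rewrite hact_ins2 // ins2_nat; congr (ins2 n y p z _ w).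
by apply/funext => u; apply: xe.
Qed.

(** The model of Hom_X(CB_n, A) on words: by [hom_expc], [hom_good] and [expc_inj], [expc n] is a
    bijection from these functions onto the homomorphisms. *)
Definition good n (x : C) := [/\ mlin x, supported n x & equivariant x].

Lemma good_lin n k (x y : C) : good n x -> good n y -> good n (fun w => k *: (x w : A) + y w : A).
Proof.
move=> [xm xs xe] [ym ys ye]; split.
- exact: mlin_lin.
- by move=> w wn; rewrite xs // ys // scaler0 addr0.
- by move=> b w; rewrite hact_lin_fun xe ye linearP.
Qed.
Lemma good0 n : good n 0.
Proof.
split=> //; first exact: mlin0.
move=> b w; rewrite linear0; have := @hact_lin_fun A w b (-1) 0 0.
rewrite scaleN1r addNr => <-; congr hact; apply/funext => u.
by rewrite scaler0 addr0.
Qed.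
Lemma goodB n (x y : C) : good n x -> good n y -> good n (x - y).
Proof.
move=> xg yg; have := good_lin (-1) yg xg.
by congr good; apply/funext => w; rewrite scaleN1r addrC.
Qed.
Lemma good_sgn n b (x : C) : good n x -> good n (sgn b x).
Proof.
by case: b => // xg; have := goodB (good0 n) xg; rewrite sub0r.
Qed.
Lemma goodD n (x y : C) : good n x -> good n y -> good n (x + y).
Proof. by move=> xg yg; rewrite -[y]opprK; apply/goodB/(good_sgn true). Qed.

Lemma good_idc : good 1 (idc A).
Proof. by split; [apply: mlin_idc | apply: supp_idc | apply: equivariant_idc]. Qed.
Lemma good_conv m n (x y : C) : good m x -> good n y -> good (m + n)%N (x * y).
Proof.
move=> [xm xs xe] [ym ys ye]; split; first exact: mlin_conv.
  exact: supp_conv.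
exact: equivariant_conv.
Qed.
Lemma good_ins m n (x y : C) : good m x -> good n y -> good (m + n).-1 (ins n y x).
Proof.
move=> [xm xs xe] [ym ys ye]; split; first exact: mlin_ins.
  exact: supp_ins.
exact: equivariant_ins.
Qed.
Lemma good_ins2 m n p (x y z : C) : good m x -> good n y -> good p z ->
  good (m + n + p).-2 (ins2 n y p z x).
Proof.
move=> [xm xs xe] [ym ys ye] [zm zs ze]; split; first exact: mlin_ins2.
  exact: supp_ins2.
exact: equivariant_ins2.
Qed.
Lemma good_prodc : good 2 (prodc A).
Proof. exact: good_conv good_idc good_idc. Qed.
Lemma good_cdiff n (x : C) : good n x -> good n.+1 (cdiff x).
Proof.
move=> xg; have [_ xs _] := xg; rewrite /cdiff (twist_supp _ xs) sgnMl.
apply: goodB; first apply: goodB.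
- exact: good_conv good_idc xg.
- by have := good_ins xg good_prodc; rewrite addn2.
- by rewrite -addn1; apply/good_sgn/good_conv/good_idc.
Qed.
Lemma good_lie m n (x y : C) : good m x -> good n y -> good (m + n).-1 (lie m n x y).
Proof.
move=> xg yg; apply: goodB; first exact: good_ins.
by apply: good_sgn; rewrite addnC; apply: good_ins.
Qed.
End DiagonalAction.

(** * Cochains on tensor powers *)

Section TensorLift.
Variables (K : fieldType) (I : eqType) (V : I -> lmodType K).
Implicit Type W : lmodType K.

(** One decomposition of the chosen representative serves every [f], multilinear or not; hence
    [tlift] commutes with linear maps and with sums of functions unconditionally. *)
Lemma tlift_decomp (t : tensor V) :
  exists s : seq (K * (forall i, V i)), forall W (f : (forall i, V i) -> W),
    tlift f t = \sum_(p <- s) p.1 *: f p.2.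
Proof.
rewrite /tlift; elim/freemod_ind: (repr _) => [|k x u [s ih]].
  by exists [::] => W f; rewrite big_nil linear0.
exists ((k, (x : forall i, V i)) :: s) => W f.
by rewrite big_cons -ih linearP /= flift_gen.
Qed.

Lemma eq_tlift W (f g : (forall i, V i) -> W) t : (forall v, f v = g v) -> tlift f t = tlift g t.
Proof. by move=> fg; congr tlift; apply/funext. Qed.

Lemma tlift_comp W W' (h : W -> W') (f : (forall i, V i) -> W) t : linear h ->
  h (tlift f t) = tlift (fun v => h (f v)) t.
Proof.
move=> hl; have [s sE] := tlift_decomp t; rewrite !sE (lin_sum hl).
by apply: eq_bigr => p _; rewrite (linZ hl).
Qed.

Lemma tlift_sum W (J : Type) (r : seq J) (f : J -> (forall i, V i) -> W) t :
  tlift (fun v => \sum_(j <- r) f j v) t = \sum_(j <- r) tlift (f j) t.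
Proof.
have [s sE] := tlift_decomp t; rewrite sE.
under eq_bigr do rewrite scaler_sumr.
by rewrite exchange_big; apply: eq_bigr => j _; rewrite sE.
Qed.
Lemma tliftZ W k (f : (forall i, V i) -> W) t : tlift (fun v => k *: f v) t = k *: tlift f t.
Proof.
have [s sE] := tlift_decomp t; rewrite !sE scaler_sumr.
by apply: eq_bigr => p _; rewrite !scalerA mulrC.
Qed.
End TensorLift.

Section BinaryLift.
Variables (K : fieldType) (U V W : lmodType K).
Lemma eq_blift (f g : U -> V -> W) t : (forall u v, f u v = g u v) -> blift f t = blift g t.
Proof. by move=> fg; apply: eq_tlift => v; apply: fg. Qed.
Lemma blift_comp (W' : lmodType K) (h : W -> W') (f : U -> V -> W) t : linear h ->
  h (blift f t) = blift (fun u v => h (f u v)) t.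
Proof. exact: tlift_comp. Qed.
Lemma blift_fun_linear (f g h : U -> V -> W) a t :
  (forall u v, f u v = a *: g u v + h u v) -> blift f t = a *: blift g t + blift h t.
Proof. by move=> fE; apply: tlift_fun_linear => v; apply: fE. Qed.
End BinaryLift.

Section FiniteWords.
Variables (K : fieldType) (A : lmodType K).

Definition wl N (v : 'I_N -> A) : seq A := [seq v i | i <- enum 'I_N].
Definition fw N (w : seq A) : 'I_N -> A := fun i => w`_i.

Lemma size_wl N (v : 'I_N -> A) : size (wl v) = N.
Proof. by rewrite size_map size_enum_ord. Qed.
Lemma nth_wl N (v : 'I_N -> A) (i : 'I_N) : (wl v)`_i = v i.
Proof. by rewrite (nth_map i) ?size_enum_ord // nth_ord_enum. Qed.
Lemma wl_eq N (v : 'I_N -> A) w : size w = N -> (forall i : 'I_N, v i = w`_i) -> wl v = w.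
Proof.
move=> wN vw; apply: (@eq_from_nth _ 0); rewrite size_wl // => i iN.
by rewrite (nth_wl v (Ordinal iN)) vw.
Qed.
Lemma wl_fw N w : size w = N -> wl (@fw N w) = w.
Proof. by move=> wN; apply: wl_eq. Qed.
Lemma fw_wl N (v : 'I_N -> A) : @fw N (wl v) = v.
Proof. by apply/funext => i; rewrite /fw nth_wl. Qed.

Lemma wl_dfwith N (v : 'I_N -> A) (i : 'I_N) z :
  wl (@dfwith 'I_N (fun=> A) v i z) = take i (wl v) ++ z :: drop i.+1 (wl v).
Proof.
apply: wl_eq => [|j].
  by rewrite size_cat /= size_take size_drop size_wl ltn_ord; have := ltn_ord i; lia.
rewrite nth_cat size_take size_wl ltn_ord.
have [ji|] := ltnP j i.
  by rewrite nth_take // nth_wl dfwith_out // -val_eqE /= gtn_eqF.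
rewrite leq_eqVlt => /orP[/eqP/val_inj <-|ij]; first by rewrite subnn /= dfwith_in.
rewrite dfwith_out; last by rewrite -val_eqE /= ltn_eqF.
rewrite -(subnSK ij) /= nth_drop -[in LHS](fw_wl v) /fw; congr (_`_ _); lia.
Qed.

Lemma multilinear_wl (W : lmodType K) N (F : seq A -> W) : mlin F ->
  multilinear (fun v : 'I_N -> A => F (wl v)).
Proof. by move=> Fm v i a x y; rewrite !wl_dfwith; apply: Fm. Qed.

Lemma multilinear_wl_comp (W B : lmodType K) N (F : seq A -> W) (G : 'I_N -> B -> A) :
  mlin F -> (forall i, linear (G i)) ->
  multilinear (fun h : 'I_N -> B => F (wl (fun i => G i (h i)))).
Proof.
move=> Fm Gl h i a x y.
have E (z : B) : (fun j => G j (@dfwith 'I_N (fun=> B) h i z j)) =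
    @dfwith 'I_N (fun=> A) (fun j => G j (h j)) i (G i z).
  apply/funext => j; have [<-|ij] := eqVneq i j; first by rewrite !dfwith_in.
  by rewrite !dfwith_out.
by rewrite !E Gl; apply: (multilinear_wl Fm).
Qed.

Lemma wl_cons N (v : 'I_N.+1 -> A) : wl v = v ord0 :: wl (fun i => v (lift ord0 i)).
Proof.
apply: wl_eq => [|i]; first by rewrite /= size_wl.
case: (unliftP ord0 i) => [j ->|->] //=.
by rewrite nth_wl.
Qed.

Lemma wl_vcons N x (v : 'I_N -> A) : wl (vcons x v) = x :: wl v.
Proof.
rewrite wl_cons /vcons unlift_none /=; congr (_ :: wl _).
by apply/funext => i; rewrite liftK.
Qed.
Lemma wl_vrcons N (v : 'I_N -> A) x : wl (vrcons v x) = wl v ++ [:: x].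
Proof.
apply: wl_eq => [|i]; first by rewrite size_cat size_wl addn1.
rewrite /vrcons nth_cat size_wl; case: (unliftP ord_max i) => [j ->|->].
  by rewrite lift_max ltn_ord nth_wl.
by rewrite /= ltnn subnn.
Qed.
Lemma wl_vbar N a (v : 'I_N -> A) b : wl (vbar a v b) = a :: wl v ++ [:: b].
Proof. by rewrite wl_vcons wl_vrcons. Qed.

Lemma wl_ends N (v : 'I_N.+2 -> A) :
  wl v = v ord0 :: wl (fun i : 'I_N => v (inord i.+1)) ++ [:: v ord_max].
Proof.
apply: wl_eq => [|i]; first by rewrite /= size_cat size_wl addn1.
case: (unliftP ord0 i) => [j ->|->] //=; rewrite nth_cat size_wl.
have [jN|] := ltnP (lift ord0 j).-1 N.
  rewrite (nth_wl (fun i => v (inord i.+1)) (Ordinal jN)); congr v.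
  by apply/val_inj; rewrite /= inordK // ltnS ltnW.
rewrite /= => Nj; have jN : j = N :> nat by apply/eqP; rewrite eqn_leq Nj -ltnS ltn_ord.
by rewrite jN subnn; congr v; apply/val_inj; rewrite /= /bump leq0n jN.
Qed.

(** Extension by zero to the other lengths turns linear maps on a tensor power into multilinear
    functions on words. *)
Lemma mlin_pure N : mlin (fun w => if size w == N then pure (@fw N w) else 0 : tpow N A).
Proof.
move=> u t k a b; rewrite !size_cat /=; case: eqP => [E|_]; last by rewrite scaler0 addr0.
have uN : (size u < N)%N by rewrite -E addnS ltnS leq_addr.
have D c : @fw N (u ++ c :: t) = @dfwith 'I_N (fun=> A) (@fw N (u ++ 0 :: t)) (Ordinal uN) c.
  rewrite -[RHS]fw_wl wl_dfwith wl_fw ?size_cat //=.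
  by rewrite take_size_cat // drop_cat ltnNge leqnSn subSnn /= drop0.
rewrite (D (k *: a + b)) (D a) (D b); exact: pure_multilinear.
Qed.
End FiniteWords.

(** * Homomorphisms over the crossed product as functions on words *)

Section Ends.
Variables (K : fieldType) (A : assocAlgType K).

Fixpoint rmul_last (c : A) (w : seq A) : seq A :=
  if w is x :: w' then (if w' is [::] then [:: x ∗ c] else x :: rmul_last c w') else [::].
Definition mul_ends (a c : A) (w : seq A) : seq A :=
  if w is x :: w' then (a ∗ x) :: rmul_last c w' else [::].

Lemma rmul_last_cat c u x : rmul_last c (u ++ [:: x]) = u ++ [:: x ∗ c].
Proof. by elim: u => [|a u IH] //=; rewrite IH; case: u {IH}. Qed.
Lemma rmul_last_split c u t : exists u' t' (g : A -> A),
  linear g /\ forall x, rmul_last c (u ++ x :: t) = u' ++ g x :: t'.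
Proof.
elim: u => [|a u [u' [t' [g [gl gE]]]]].
  case: t => [|y t]; [exists [::], [::], (amul^~ c) | exists [::], (rmul_last c (y :: t)), id].
    by split=> //; apply: amul_linearl.
  by [].
exists (a :: u'), t', g; split=> // x; rewrite cat_cons /= gE.
by case: u {gE}.
Qed.

Lemma mlin_mul_ends (W : lmodType K) (F : seq A -> W) a c : mlin F -> mlin (fun w => F (mul_ends a c w)).
Proof.
move=> Fm [|x u] t k y z /=; first by rewrite amul_linearr (Fm [::]).
have [u' [t' [g [gl gE]]]] := rmul_last_split c u t.
by rewrite !gE gl (Fm (_ :: _)).
Qed.

Lemma mul_ends_linearl (W : lmodType K) (F : seq A -> W) c w : mlin F -> F [::] = 0 ->
  linear (fun a => F (mul_ends a c w)).
Proof.
move=> Fm F0; case: w => [|x w] k a b /=; first by rewrite F0 scaler0 addr0.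
by rewrite amul_linearl (Fm [::]).
Qed.
(** On words with fewer than two letters [mul_ends] does not depend on [c], and linearity there
    requires that [F] vanish. *)
Lemma mul_ends_linearr (W : lmodType K) (F : seq A -> W) a w : mlin F ->
  (forall u, (size u < 2)%N -> F u = 0) -> linear (fun c => F (mul_ends a c w)).
Proof.
move=> Fm F0; case: w => [|x w] k c d; first by rewrite F0 // scaler0 addr0.
have [->|[u [y ->]]] : w = [::] \/ exists u y, w = u ++ [:: y].
- by case/lastP: w => [|u y]; [left | right; exists u, y; rewrite cats1].
- by rewrite !F0 // scaler0 addr0.
- by rewrite /= !rmul_last_cat amul_linearr (Fm (_ :: _)).
Qed.
End Ends.

Section HomCrossed.
Variables (K : fieldType) (H : algType K) (A : assocAlgType K).
Variables (comul : {linear H -> btensor H H}) (counit : {linear H -> K^o}).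
Variable act : H -> {linear A -> A}.
Hypothesis bialgH : is_bialgebra comul counit.
Hypothesis modalgA : is_module_algebra comul counit act.
Local Notation C := (conv A (aring A)).
Local Notation hact := (hact comul counit act).

(** [itercomul] ends with one tensor factor and [hact] with none, so the base case is the counit
    law; otherwise the recursions agree. *)
Lemma itercomul_hact (W : lmodType K) (F : seq A -> W) m (v : 'I_m.+1 -> A) b : mlin F ->
  tlift (fun h : 'I_m.+1 -> H => F (wl (fun i => act (h i) (v i)))) (itercomul comul m b) =
  hact (wl v) b F.
Proof.
have Fh n (G : seq A -> W) (u : 'I_n -> A) : mlin G ->
    multilinear (fun h : 'I_n -> H => G (wl (fun i => act (h i) (u i)))).
  move=> Gm; apply: (multilinear_wl_comp (G := fun i c => act c (u i)) Gm) => i.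
  exact: (act_linear modalgA).
elim: m F v b => [|m IH] F v b Fm.
  rewrite /= tlift_pure; last exact: Fh.
  have wl1 (u : 'I_1 -> A) : wl u = [:: u ord0].
    by apply: wl_eq => // i; rewrite (ord1 i).
  rewrite !wl1 /= (sw_counitr bialgH b (g := fun b1 => F [:: act b1 (v ord0)])) //.
  by move=> k c d; rewrite (act_linear modalgA) (Fm [::]).
rewrite /= (blift_comp _ _ (tlift_linear (Fh _ _ v Fm))).
rewrite wl_cons /= -blift_sw; last first.
  by apply: (hact_bilin modalgA) => // G; apply: (hact_linear modalgA).
apply: eq_blift => b1 b2; rewrite (tlift_comp _ _ (tlift_linear (Fh _ _ v Fm))).
rewrite -IH; last exact: mlin_cons.
apply: eq_tlift => h; rewrite tlift_pure; last exact: Fh.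
rewrite wl_cons /vcons unlift_none /=; congr (F (_ :: wl _)).
by apply/funext => i; rewrite liftK.
Qed.

Lemma crossed_actCB_lift n (f : CB A n -> A) (F : seq A -> A) x t : linear f ->
  (forall v, f (pure v) = F (wl v)) ->
  f (crossed_actCB comul act x t) = blift (fun aa b => blift (fun a c =>
    tlift (fun h : 'I_n.+2 -> H => tlift (fun v : 'I_n.+2 -> A =>
      F (mul_ends a c (wl (fun i => act (h i) (v i))))) t) (itercomul comul n.+1 b)) aa) x.
Proof.
move=> fl fF; rewrite /crossed_actCB (blift_comp _ _ fl); apply: eq_blift => aa b.
rewrite (blift_comp _ _ fl); apply: eq_blift => a c.
rewrite (tlift_comp _ _ fl); apply: eq_tlift => h.
rewrite (tlift_comp _ _ fl); apply: eq_tlift => v.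
rewrite fF wl_vbar; congr F; rewrite wl_ends /=.
by rewrite rmul_last_cat.
Qed.

Lemma crossed_actCB_pure n (f : CB A n -> A) (F : seq A -> A) x (v : 'I_n.+2 -> A) : linear f ->
  (forall v, f (pure v) = F (wl v)) -> mlin F ->
  f (crossed_actCB comul act x (pure v)) = blift (fun aa b => blift (fun a c =>
    hact (wl v) b (fun w => F (mul_ends a c w))) aa) x.
Proof.
move=> fl fF Fm; rewrite (crossed_actCB_lift _ _ fl fF).
apply: eq_blift => aa b; apply: eq_blift => a c.
rewrite -itercomul_hact; last exact: mlin_mul_ends.
apply: eq_tlift => h; rewrite tlift_pure //.
apply: (multilinear_wl_comp (G := fun i c => act (h i) c) (mlin_mul_ends a c Fm)) => i.
exact: linearP.
Qed.

(* [idc * x * idc] maps a_0 a_1 ... a_(n+1) to a_0 x(a_1 ... a_n) a_(n+1). *)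
Definition expc n (x : C) : CB A n -> A :=
  tlift (fun v : 'I_n.+2 -> A => (idc A * x * idc A) (wl v)).
Arguments expc n x _ : clear implicits.

Lemma idc_mul (x : C) a w : (idc A * x) (a :: w) = a ∗ x w.
Proof.
rewrite conv_cons mul0r add0r; case: w => [|c w]; first by rewrite conv_nil.
rewrite conv_cons (_ : (fun u => _) = (0 : C)) ?mul0r ?addr0 //.
Qed.
Lemma mul_idc (x : C) w c : (x * idc A) (w ++ [:: c]) = x w ∗ c.
Proof.
elim: w x => [|a w IH] x.
  by rewrite conv_cons conv_nil mulr0 addr0.
by rewrite cat_cons conv_cons (IH (fun u => x (a :: u))); case: w {IH} => [|? [|? ?]] /=; rewrite mulr0 add0r.
Qed.
Lemma idc_mul_idc (x : C) a w c : (idc A * x * idc A) (a :: w ++ [:: c]) = a ∗ x w ∗ c.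
Proof. by rewrite -cat_cons mul_idc idc_mul. Qed.

Lemma idc_mul_idc_ends (x : C) a c w n : supported n x ->
  (idc A * x * idc A) (mul_ends a c w) = a ∗ (idc A * x * idc A) w ∗ c.
Proof.
move=> xn.
have [->|[y ->]|[y [u [z ->]]]] : [\/ w = [::], exists y, w = [:: y] | exists y u z, w = y :: u ++ [:: z]].
- case: w => [|y w]; first by constructor 1.
  case/lastP: w => [|u z]; first by constructor 2; exists y.
  by constructor 3; exists y, u, z; rewrite cats1.
- by rewrite /= !conv_nil mulr0 -[amul a 0]/((a : aring A) * 0) mulr0 -[amul 0 c]/((0 : aring A) * c) mul0r.
- have E z : (idc A * x * idc A) [:: z] = 0.
    by rewrite -mulrA idc_mul conv_nil mulr0 -[amul _ _]/((z : aring A) * 0) mulr0.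
  by rewrite /= !E -[amul a 0]/((a : aring A) * 0) mulr0 -[amul 0 c]/((0 : aring A) * c) mul0r.
by rewrite /= rmul_last_cat !idc_mul_idc !amulA.
Qed.

Section Expansion.
Variables (n : nat) (x : C).
Hypothesis xg : good comul counit act n x.

Lemma good_idc_mul_idc : good comul counit act n.+2 (idc A * x * idc A).
Proof.
have := good_conv bialgH modalgA (good_conv bialgH modalgA (good_idc bialgH modalgA) xg) (good_idc bialgH modalgA).
by rewrite addn1.
Qed.

Lemma expc_pure v : expc n x (pure v) = (idc A * x * idc A) (wl v).
Proof. by have [m _ _] := good_idc_mul_idc; rewrite /expc tlift_pure //; apply: multilinear_wl. Qed.

(** [idc * x * idc] is again good: its equivariance accounts for the action of H, and associativity
    for the outer action of A ⊗ A. *)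
Lemma hom_expc : hom_crossed comul act (expc n x).
Proof.
have [Fm Fs Fe] := good_idc_mul_idc; have [xm xs xe] := xg.
have el : linear (expc n x) by apply/tlift_linear/multilinear_wl.
split=> // y; apply: tensor_lin_ext.
- move=> k s t; rewrite !(crossed_actCB_lift _ _ el expc_pure).
  apply: blift_fun_linear => aa b; apply: blift_fun_linear => a c.
  apply: tlift_fun_linear => h; apply: tlift_linear.
  apply: (multilinear_wl_comp (G := fun i c => act (h i) c) (mlin_mul_ends a c Fm)) => i.
  exact: linearP.
- by move=> k s t; rewrite el; apply: crossed_act_linear.
move=> v; rewrite (crossed_actCB_pure _ _ el expc_pure Fm) expc_pure.
apply: eq_blift => aa b; apply: eq_blift => a c.
rewrite -Fe -(@hact_comp K H A comul counit act A A (fun d => a ∗ d ∗ c)).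
  by congr hact; apply/funext => w; apply: idc_mul_idc_ends xs.
by move=> k d e; rewrite amul_linearr amul_linearl.
Qed.
End Expansion.
End HomCrossed.
Arguments expc {K A} n x _.

Section Reduction.
Variables (K : fieldType) (H : algType K) (A : assocAlgType K).
Variables (comul : {linear H -> btensor H H}) (counit : {linear H -> K^o}).
Variable act : H -> {linear A -> A}.
Hypothesis bialgH : is_bialgebra comul counit.
Hypothesis modalgA : is_module_algebra comul counit act.
Local Notation C := (conv A (aring A)).
Local Notation hact := (hact comul counit act).

Lemma mul_ends1 (w : seq A) : mul_ends (aone : A) aone w = w.
Proof.
case: w => [|x w] //=; rewrite amul1l; congr (_ :: _).
by elim: w => [|y w IH] //=; rewrite IH amul1r; case: w {IH}.
Qed.

Lemma blift_blift_pure (f : A -> A -> H -> A) a c b :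
  (forall c b, linear (fun a => f a c b)) -> (forall a b, linear (fun c => f a c b)) ->
  (forall a c, linear (fun b => f a c b)) ->
  blift (fun (aa : btensor A A) b => blift (fun a c => f a c b) aa) ((a ⊗ c) ⊗ b) = f a c b.
Proof.
move=> f1 f2 f3; have B d : bilin (fun a c => f a c d) by split=> e; [apply: f1 | apply: f2].
rewrite blift_pure ?blift_pure //; split=> [d|aa]; first exact: blift_linear.
by move=> k d e; apply: blift_fun_linear => u v; apply: f3.
Qed.

Lemma hact1 (W : lmodType K) (F : seq A -> W) w : mlin F -> hact w 1 F = F w.
Proof.
elim: w F => [|a w IH] F Fm /=; first by rewrite (counit1 bialgH) scale1r.
rewrite -blift_sw; last by apply: (hact_bilin modalgA) => // G; apply: (hact_linear modalgA).
rewrite (comul1 bialgH) blift_pure; last first.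
  by apply: (hact_bilin modalgA) => // G; apply: (hact_linear modalgA).
by rewrite IH ?(act_one modalgA) //; apply: mlin_cons.
Qed.

Lemma hact_one_cons (F : seq A -> A) w b : mlin F ->
  hact (aone :: w) b F = hact w b (fun u => F (aone :: u)).
Proof.
move=> Fm; rewrite -[RHS](sw_counitl bialgH b (g := fun b2 => hact w b2 (fun u => F (aone :: u)))).
  rewrite /=; apply: eq_sw => b1 b2; rewrite (act_unit modalgA).
  rewrite -hact_comp; last by move=> k u v; rewrite scalerDr !scalerA mulrC.
  by congr hact; apply/funext => u; apply: (linZ (mlin_head u Fm)).
by apply: (hact_linear modalgA); apply: mlin_cons.
Qed.

Lemma hact_rcons_one (F : seq A -> A) w b : mlin F ->
  hact (w ++ [:: aone]) b F = hact w b (fun u => F (u ++ [:: aone])).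
Proof.
elim: w b F => [|a w IH] b F Fm; first by rewrite hact_one_cons.
by rewrite /=; apply: eq_sw => b1 b2; apply/IH/mlin_cons.
Qed.

(** Elements a ⊗ c ⊗ 1 of X move the outer letters out of [f], which is thus determined by its
    values on 1 ⊗ w ⊗ 1. Elements 1 ⊗ 1 ⊗ b give the equivariance of these values, because b acts on
    the two units by the counit. *)
Lemma hom_good n (f : CB A n -> A) : hom_crossed comul act f ->
  exists2 x : C, good comul counit act n x & f = expc n x.
Proof.
move=> [fl fx].
pose F (w : seq A) := f (if size w == n.+2 then pure (@fw K A n.+2 w) else 0).
have Fm : mlin F by apply: mlin_comp fl _; apply: mlin_pure.
have Fs : supported n.+2 F by move=> w /negPf wn; rewrite /F wn (lin0 fl).
have fF v : f (pure v) = F (wl v) by rewrite /F size_wl eqxx fw_wl.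
(* This is X-linearity of [f] for the element (a ⊗ c) ⊗ b, transported to words. *)
have key a c b w : size w = n.+2 -> hact w b (fun u => F (mul_ends a c u)) = a ∗ act b (F w) ∗ c.
  move=> wn; have := fx ((a ⊗ c) ⊗ b) (pure (@fw K A n.+2 w)).
  rewrite (crossed_actCB_pure bialgH modalgA _ _ fl fF Fm) fF wl_fw //.
  rewrite (@blift_blift_pure (fun a c b => hact w b (fun u => F (mul_ends a c u)))); first last.
  - by move=> d e; apply: (hact_linear modalgA); apply: mlin_mul_ends.
  - move=> d e k u v; rewrite -hact_lin_fun; congr hact; apply/funext => u'.
    apply: (mul_ends_linearr d u' Fm) => u2 u21.
    by rewrite Fs // ltn_eqF // (leq_trans u21).
  - move=> d e k u v; rewrite -hact_lin_fun; congr hact; apply/funext => u'.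
    by apply: (mul_ends_linearl d u' Fm); rewrite Fs.
  move=> ->; rewrite /crossed_act (@blift_blift_pure (fun a c b => a ∗ act b (F w) ∗ c)) //.
  - by move=> d e k u v; rewrite !amul_linearl.
  - by move=> d e k u v; rewrite amul_linearr.
  - by move=> d e k u v; rewrite (act_linear modalgA) amul_linearr amul_linearl.
pose x : C := fun w => F (aone :: w ++ [:: aone]).
have xg : good comul counit act n x.
  split=> [u t k a b|w wn|b w]; rewrite /x.
  - by rewrite -!catA !cat_cons (Fm (aone :: u)).
  - by rewrite Fs //= size_cat addn1 !eqSS.
  have [wn|wn] := eqVneq (size w) n; last first.
    rewrite (Fs (aone :: _)) /= ?size_cat ?addn1 ?eqSS // linear0.
    rewrite (hact_size comul counit act b (erefl (size w))) // => u uw.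
    by rewrite Fs //= size_cat addn1 !eqSS uw.
  have w1n : size (aone :: w ++ [:: aone]) = n.+2 by rewrite /= size_cat addn1 wn.
  have := key aone aone b _ w1n; rewrite amul1l amul1r => <-.
  rewrite (_ : (fun u => F (mul_ends _ _ u)) = F); last by apply/funext => u; rewrite mul_ends1.
  rewrite hact_one_cons // hact_rcons_one //.
  exact: mlin_cons.
exists x => //; apply/funext; apply: tensor_lin_ext => //.
  by have [] := hom_expc bialgH modalgA xg.
move=> v; rewrite (expc_pure bialgH modalgA xg) fF wl_ends idc_mul_idc /x.
set w := wl _; have wn : size w = n by rewrite size_wl.
(* The outer letters are written as their products with the units at the two ends, so that the outer
   action extracts them. *)
have := key (v ord0) (v ord_max) 1 (aone :: w ++ [:: aone]).
rewrite hact1; last exact: mlin_mul_ends.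
rewrite (act_one modalgA) /= rmul_last_cat amul1l amul1r => -> //.
by rewrite size_cat addn1 wn.
Qed.
End Reduction.

(** * Comparison with the face maps and the braces *)

Section InsertionSum.
Variables (T : Type) (V : zmodType).

Lemma ins_short n (y : seq T -> T) (F : seq T -> V) w : (size w < n)%N -> ins n y F w = 0.
Proof.
elim: w F => [|a w IH] F /= wn; rewrite /cutp leqNgt wn /= add0r //.
by rewrite IH ?sgn0 // ltnW.
Qed.

(** The form in which insertions meet face maps and braces, both of which are sums over positions;
    [k] is the number of slots of a function whose composite with [y] has |w| inputs. *)
Lemma ins_sum n (y : seq T -> T) (F : seq T -> V) k w : (size w).+1 = (k + n)%N ->
  ins n y F w = \sum_(i < k) sgn (~~ odd n && odd i)
    (F (take i w ++ y (take n (drop i w)) :: drop (i + n) w)).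
Proof.
elim: k F w => [|k IH] F w wk; first by rewrite big_ord0 ins_short // wk.
have nw : (n <= size w)%N by move: wk; lia.
rewrite big_ord_recl /= andbF take0 drop0 add0n.
case: w wk nw => [|a w] wk nw.
  have k0 : k = 0%N by move: wk nw => /=; lia.
  by rewrite k0 big_ord0 /= /cutp nw !addr0.
rewrite /= {1}/cutp nw; congr (_ + _).
rewrite (IH (fun u => F (a :: u))); last by move: wk => /=; lia.
rewrite (big_morph (sgn (~~ odd n)) (fun x y => sgnD _ x y) (sgn0 V _)).
apply: eq_bigr => i _; rewrite sgn_sgn !add0n; congr sgn.
by case: (odd n); case: (odd i).
Qed.
End InsertionSum.

Section CochainOperations.
Variables (K : fieldType) (H : algType K) (A : assocAlgType K).
Variables (comul : {linear H -> btensor H H}) (counit : {linear H -> K^o}).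
Variable act : H -> {linear A -> A}.
Hypothesis bialgH : is_bialgebra comul counit.
Hypothesis modalgA : is_module_algebra comul counit act.
Local Notation C := (conv A (aring A)).
Local Notation good := (good comul counit act).

Lemma expc_lin n k (x y : C) : expc n (fun w => k *: (x w : A) + y w : A) = k *: expc n x + expc n y.
Proof.
apply/funext => t; rewrite -[RHS]/(k *: expc n x t + expc n y t).
apply: tlift_fun_linear => v; rewrite wl_ends !idc_mul_idc.
by rewrite amul_linearr amul_linearl.
Qed.
Lemma expcD n (x y : C) : expc n (x + y) = expc n x + expc n y.
Proof.
rewrite -[expc n x]scale1r -expc_lin; congr expc; apply/funext => w.
by rewrite scale1r.
Qed.
Lemma expc0 n : expc n (0 : C) = 0 :> (CB A n -> A).
Proof. by have := expcD n 0 0; rewrite addr0 => /eqP; rewrite -subr_eq0 opprD addNKr oppr_eq0 => /eqP. Qed.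
Lemma expcZ n k (x : C) : expc n (fun w => k *: (x w : A) : A) = k *: expc n x.
Proof.
rewrite -[RHS]addr0 -(expc0 n) -expc_lin; congr expc; apply/funext => w.
by rewrite addr0.
Qed.
Lemma expc_sgn n b (x : C) : expc n (sgn b x) = ((-1) ^+ b : K) *: expc n x.
Proof.
rewrite -expcZ; congr expc; apply/funext => w; rewrite conv_sgnE.
by rewrite [RHS]sgnE.
Qed.
Lemma expcB n (x y : C) : expc n (x - y) = expc n x - expc n y.
Proof. by rewrite expcD -[- y]/(sgn true y) expc_sgn expr1 scaleN1r. Qed.
Lemma expc_vbar n (x : C) (v : 'I_n -> A) a b : good n x ->
  expc n x (pure (vbar a v b)) = a ∗ x (wl v) ∗ b.
Proof. by move=> xg; rewrite (expc_pure bialgH modalgA xg) wl_vbar idc_mul_idc. Qed.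

Lemma expc_inj n (x y : C) : good n x -> good n y -> expc n x = expc n y -> x = y.
Proof.
move=> xg yg /(congr1 (fun f => f (pure (vbar aone (@fw K A n _) aone)))) E.
apply/funext => w; have [wn|wn] := eqVneq (size w) n; last first.
  by have [_ xs _] := xg; have [_ ys _] := yg; rewrite xs ?ys.
by have := E w; rewrite !expc_vbar // wl_fw // !amul1l !amul1r.
Qed.

Lemma prodc2 (a b : A) : prodc A [:: a; b] = a ∗ b.
Proof. by rewrite /prodc idc_mul. Qed.

Lemma wl_face n (j : 'I_n.+2) (a : 'I_n.+3 -> A) :
  wl (fun i : 'I_n.+2 => if (i < j)%N then a (inord i)
      else if i == j then a (inord i) ∗ a (inord i.+1) else a (inord i.+1)) =
  take j (wl a) ++ prodc A (take 2 (drop j (wl a))) :: drop (j + 2) (wl a).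
Proof.
have jn := ltn_ord j.
have aE i : (i < n.+3)%N -> a (inord i) = (wl a)`_i.
  by move=> ia; rewrite -[in RHS](inordK ia) nth_wl.
apply: wl_eq => [|i].
  by rewrite size_cat /= size_take size_drop size_wl ltnW // addnS; move: jn; clear; lia.
have iN := ltn_ord i.
rewrite nth_cat size_take size_wl (leq_trans jn) //.
case: ltnP => ij; first by rewrite nth_take // aE // ltnW // ltnS ltnW.
rewrite -val_eqE; case: eqP => [->|/eqP ij'].
  rewrite subnn /= (drop_nth 0) ?size_wl // 1?ltnW // (drop_nth 0) ?size_wl //.
  by rewrite /= take0 prodc2 !aE // ltnW.
have ji : (j < i)%N by rewrite ltn_neqAle eq_sym ij'.
rewrite -(subnSK ji) /= nth_drop aE //; congr (_`_ _); lia.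
Qed.

(** All faces of the complex, the outer ones included, are insertions of [prodc] into
    [idc * x * idc]. By the derivation rule, and as inserting [prodc] into [idc] gives [idc * idc],
    their sum is [idc * cdiff x * idc]. *)
Lemma dCH_expc n (x : C) : good n x -> dCH (expc n x) = expc n.+1 (cdiff x).
Proof.
move=> xg; have [Fm Fs _] := good_idc_mul_idc bialgH modalgA xg.
have [el _] := hom_expc bialgH modalgA xg; have [_ xs _] := xg.
have FE : idc A * cdiff x * idc A = ins 2%N (prodc A) (idc A * x * idc A) :> C.
  have supp2 := @supp_prodc K A.
  rewrite !ins_mul !(ins_idc supp2) !twistM (twist_supp _ (@supp_idc K A)).
  by rewrite {1 3}/prodc /cdiff !(mulrBl, mulrBr, mulrDl, mulrDr, sgnMl, sgnMr, mulrA) /sgn /=; zmod.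
apply/funext => t; rewrite /dCH /= /dCB (lin_sum el).
transitivity (tlift (fun a : 'I_n.+3 -> A => \sum_(j < n.+2) (-1) ^+ j *:
    (idc A * x * idc A : C) (take j (wl a) ++ prodc A (take 2 (drop j (wl a))) :: drop (j + 2) (wl a)) : A) t).
  rewrite tlift_sum; apply: eq_bigr => j _; rewrite tliftZ (linZ el); congr (_ *: _).
  rewrite /face (tlift_comp _ _ el); apply: eq_tlift => a.
  by rewrite (expc_pure bialgH modalgA xg) wl_face.
rewrite /expc FE; apply: eq_tlift => a; rewrite (@ins_sum _ _ _ _ _ n.+2) ?size_wl ?addn2 //.
apply: eq_bigr => j _ /=.
by rewrite -signr_odd sgnE.
Qed.
End CochainOperations.

Lemma exprN1z (K : fieldType) (z : int) : ((-1) ^ z : K) = (-1) ^+ odd (absz z).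
Proof.
case: z => m; first by rewrite -exprnP /= signr_odd.
by rewrite NegzE -exprnN abszN -[(-1) ^+ m.+1]signr_odd invr_sign.
Qed.
Lemma odd_abszM (a b : int) : odd (absz (a * b)) = odd (absz a) && odd (absz b).
Proof. by rewrite abszM oddM. Qed.
Lemma odd_abszB1 n : odd (absz (n%:Z - 1)) = ~~ odd n.
Proof. by case: n => // n; rewrite -addn1 PoszD addrK addn1 /= negbK. Qed.

Section Braces.
Variables (K : fieldType) (H : algType K) (A : assocAlgType K).
Variables (comul : {linear H -> btensor H H}) (counit : {linear H -> K^o}).
Variable act : H -> {linear A -> A}.
Hypothesis bialgH : is_bialgebra comul counit.
Hypothesis modalgA : is_module_algebra comul counit act.
Local Notation C := (conv A (aring A)).
Local Notation good := (good comul counit act).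

Let goodidc := good_idc bialgH modalgA.
Lemma IdcE : Idc A = mkcochain (expc 1 (idc A)).
Proof.
congr mkcochain; apply/funext => t; apply: eq_tlift => v.
rewrite wl_ends idc_mul_idc (_ : wl _ = [:: v (inord 1)]) /=.
  by congr (v _ ∗ _ ∗ v _); apply/val_inj; rewrite /= inordK.
by apply: wl_eq => // i; rewrite (ord1 i).
Qed.
Lemma picE : @pic K A = expc 2 (prodc A).
Proof.
apply/funext => t; apply: eq_tlift => v.
rewrite wl_ends idc_mul_idc (_ : wl _ = [:: v (inord 1); v (inord 2)]).
  rewrite prodc2 -!amulA; congr (v _ ∗ (_ ∗ (_ ∗ v _))); apply/val_inj; rewrite /= inordK //.
by apply: wl_eq => // -[[|[|i]] Hi].
Qed.

Section Composite.
Variables (N : nat) (a : 'I_N.+2 -> A).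
Let w := wl (fun j : 'I_N => a (inord j.+1)).

(** The factor that [gamma] forms from [c] when its inputs start at position [S] of the inner
    word. *)
Let segment (c : cochain A) S : A :=
  tagged c (pure (vbar aone (fun j : 'I_(deg c) => a (inord (S + j)%N.+1)) aone)).

Let nth_w i : (i < N)%N -> w`_i = a (inord i.+1).
Proof. by move=> iN; rewrite -[i]/(nat_of_ord (Ordinal iN)) nth_wl. Qed.

Lemma segment_expc n (y : C) S : good n y -> (S + n <= N)%N ->
  segment (mkcochain (expc n y)) S = y (take n (drop S w)).
Proof.
move=> yg Sn; rewrite /segment /= (expc_vbar bialgH modalgA) // amul1l amul1r; congr y.
apply: wl_eq => [|i]; first by rewrite size_take size_drop size_wl; case: ltngtP; lia.
by rewrite nth_take // nth_drop nth_w // (leq_trans _ Sn) // ltn_add2l.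
Qed.
Let segment_Idc S : (S < N)%N -> segment (Idc A) S = w`_S.
Proof.
move=> SN; rewrite IdcE (segment_expc goodidc) ?addn1 //.
by rewrite (drop_nth 0) ?size_wl //= take0.
Qed.

Lemma wl_insertion k n (y : C) (i : 'I_k) (g : 'I_k -> cochain A) : good n y -> N.+1 = (k + n)%N ->
  (forall l, g l = if l == i then mkcochain (expc n y) else Idc A) ->
  wl (fun l : 'I_k => tagged (g l) (pure (vbar aone
    (fun j : 'I_(deg (g l)) => a (inord (\sum_(l' < k | (l' < l)%N) deg (g l') + j)%N.+1)) aone))) =
  take i w ++ y (take n (drop i w)) :: drop (i + n) w.
Proof.
move=> yg Nk gE; have ik := ltn_ord i.
(* The inputs in front of slot [l]: one for each [Id], while slot [i] consumes [n] of them. *)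
have sE (l : 'I_k) : \sum_(l' < k | (l' < l)%N) deg (g l') = if (l <= i)%N then l : nat else (l.-1 + n)%N.
  pose d j := if j == i :> nat then n else 1%N.
  have -> : \sum_(l' < k | (l' < l)%N) deg (g l') = \sum_(l' < l) d l'.
    rewrite (big_ord_widen k d (ltnW (ltn_ord l))); apply: eq_bigr => j _.
    by rewrite gE /d -val_eqE; case: eqP.
  elim: (nat_of_ord l) => [|j IH]; first by rewrite big_ord0.
  rewrite big_ord_recr /= IH /d; case: (ltngtP j i) => //; lia.
apply: wl_eq => [|l].
  by rewrite size_cat /= size_take size_drop size_wl; case: (ltnP i N); move: ik Nk; clear; lia.
have lk := ltn_ord l.
rewrite sE -/(segment (g l) _) gE -val_eqE nth_cat size_take size_wl.
have iN : (i <= N)%N by move: ik Nk; clear; lia.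
have -> : (if (i < N)%N then i : nat else N) = i by case: ltngtP iN.
case: (ltngtP l i) => [li|il|->].
- by rewrite segment_Idc ?nth_take //; move: li iN; clear; lia.
- rewrite segment_Idc; last by move: il lk Nk; clear; lia.
  rewrite -(subnSK il) /= nth_drop; congr (_`_ _); move: il; clear; lia.
rewrite subnn (segment_expc yg) //; move: ik Nk; clear; lia.
Qed.
End Composite.

Lemma brace1_expc k n (x y : C) : good k x -> good n y ->
  @brace K A (k + n).-1 k (expc k x) 1 [tuple mkcochain (expc n y)] = expc (k + n).-1 (ins n y x).
Proof.
move=> xg yg; have [_ xs _] := xg; rewrite /brace.
(* For k = n = 0 the predecessor is truncated; both sides vanish, as [x] has no slot. *)
have [kn|kn] := posnP (k + n)%N.
  have k0 : k = 0%N by move: kn; lia.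
  rewrite (ins_supp0 n y); last by move: xs; rewrite k0.
  rewrite expc0 big1 // => s _; have := ltn_ord (s ord0).
  by rewrite [X in (_ < X)%N]k0 ltn0.
have Nk : (k + n).-1.+1 = (k + n)%N by rewrite prednK.
(* Insertions of a single cochain correspond to the slots of [x]. *)
rewrite (reindex (fun i : 'I_k => [ffun => i] : {ffun 'I_1 -> 'I_k})) /=; last first.
  exists (fun s => s ord0) => [i _|s _]; first by rewrite ffunE.
  by apply/ffunP => p; rewrite ffunE (ord1 p).
rewrite (eq_bigl xpredT); last first.
  by move=> i; apply/forallP => p; apply/forallP => q; rewrite (ord1 p) (ord1 q).
have fillE (i l : 'I_k) : fill [tuple mkcochain (expc n y)] [ffun => i] l =
    if l == i then mkcochain (expc n y) else Idc A.
  rewrite /fill; case: pickP => [p|/(_ ord0)]; rewrite ffunE eq_sym => ->//.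
  by rewrite (ord1 p).
(* Only copies of [Id] precede slot [i], so there are [i] inputs in front of it. *)
have signE (i : 'I_k) : ((-1) ^ brace_sign [tuple mkcochain (expc n y)] [ffun => i] : K) =
    (-1) ^+ (~~ odd n && odd i).
  rewrite /brace_sign big_ord1 exprN1z odd_abszM odd_abszB1 ffunE; congr (_ ^+ (_ && odd _)).
  rewrite absz_nat (eq_bigr (fun=> 1%N)) => [|l li]; last first.
    by rewrite fillE -val_eqE ltn_eqF.
  by rewrite -(big_ord_widen _ (fun=> 1%N) (ltnW (ltn_ord i))) sum1_card card_ord.
apply/funext => t.
transitivity (tlift (fun a : 'I_(k + n).-1.+2 -> A => \sum_(i < k) ((-1) ^+ (~~ odd n && odd i) : K) *:
   (let w := wl (fun j : 'I_(k + n).-1 => a (inord j.+1)) in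
    a ord0 ∗ x (take i w ++ y (take n (drop i w)) :: drop (i + n) w) ∗ a ord_max)) t).
  rewrite fct_sumE tlift_sum; apply: eq_bigr => i _.
  rewrite signE tliftZ; congr (_ *: _); apply: eq_tlift => a.
  rewrite (expc_vbar bialgH modalgA) //; congr (_ ∗ x _ ∗ _).
  exact: wl_insertion.
apply: eq_tlift => a; rewrite wl_ends idc_mul_idc.
rewrite (@ins_sum _ _ _ _ _ k) ?size_wl //.
set w := wl _; rewrite [in RHS](lin_sum (amul_linearr (a ord0))) (lin_sum (amul_linearl (a ord_max))).
by apply: eq_bigr => i _; rewrite sgnE (lin_sgn (amul_linearr _)) (lin_sgn (amul_linearl _)).
Qed.

Lemma bracket_expc m n (x y : C) : good m x -> good n y ->
  bracket (expc m x) (expc n y) = expc (m + n).-1 (lie m n x y).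
Proof.
move=> xg yg; rewrite /bracket /lie expcB expc_sgn brace1_expc //.
rewrite exprN1z odd_abszM !odd_abszB1; congr (_ - _ *: _).
by rewrite addnC brace1_expc.
Qed.

(** The sign (-1)^m in the cup product and the brace sign (-1)^((n-1)m) combine to (-1)^(mn). *)
Lemma cup_expc m n (x y : C) : good m x -> good n y ->
  cup (expc m x) (expc n y) = expc (m + n)%N (sgn (odd m && odd n) (x * y)).
Proof.
move=> xg yg; rewrite /cup /brace.
pose s0 : {ffun 'I_2 -> 'I_2} := [ffun p => p].
have ord2 (i : 'I_2) : i = ord0 \/ i = ord_max.
  by case: i => [[|[|i]]] Hi //; [left | right]; apply/val_inj.
(* Two cochains fill the two slots of the product in only one order-preserving way. *)
rewrite (big_pred1 s0); last first.
  move=> s; apply/forallP/eqP => [h|-> p]; last first.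
    by apply/forallP => q; rewrite !ffunE implybb.
  have := forallP (h ord0) ord_max => /=.
  have := ltn_ord (s ord_max); case: (ord2 (s ord0)) => e0; case: (ord2 (s ord_max)) => e1; rewrite e0 e1 // => _ _.
  by apply/ffunP => p; rewrite ffunE; case: (ord2 p) => ->.
pose g (i : 'I_2) := if i == ord0 then mkcochain (expc m x) else mkcochain (expc n y).
have fillE i : fill [tuple mkcochain (expc m x); mkcochain (expc n y)] s0 i = g i.
  rewrite /fill /g; case: pickP => [p|/(_ i)]; rewrite ffunE ?eqxx // => /eqP ->.
  by case: (ord2 i) => ->.
have sum0 : \sum_(i < 2 | (i < 0)%N) deg (g i) = 0%N by rewrite big_pred0.
have sum1 : \sum_(i < 2 | (i < 1)%N) deg (g i) = m.
  by rewrite big_mkcond !big_ord_recl big_ord0 /= !addr0.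
have fE : fill [tuple mkcochain (expc m x); mkcochain (expc n y)] s0 = g by apply/funext.
have signE : ((-1) ^ brace_sign [tuple mkcochain (expc m x); mkcochain (expc n y)] s0 : K) =
    (-1) ^+ (~~ odd n && odd m).
  rewrite /brace_sign fE !big_ord_recl big_ord0 addr0 !ffunE /= sum0 mulr0 add0r.
  rewrite (_ : \sum_(i < 2 | _) _ = m); last by rewrite -[RHS]sum1.
  by rewrite exprN1z odd_abszM odd_abszB1.
have gammaE : @gamma K A (m + n)%N 2 (@pic K A) g = expc (m + n)%N (x * y).
  apply/funext => t; apply: eq_tlift => a.
  rewrite picE (expc_vbar bialgH modalgA); last exact: good_prodc.
  rewrite [in RHS]wl_ends idc_mul_idc; congr (_ ∗ _ ∗ _).
  have [_ xs _] := xg; rewrite (supp_mul _ _ xs) /cutp size_wl leq_addr aringME -prodc2.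
  set w := wl (fun j : 'I_(m + n) => a (inord j.+1)).
  have xE : tagged (g ord0) (pure (vbar aone
      (fun j : 'I_(deg (g ord0)) => a (inord (0 + j)%N.+1)) aone)) = x (take m w).
    by rewrite [LHS](segment_expc _ xg) ?drop0 // leq_addr.
  have yE : tagged (g ord_max) (pure (vbar aone
      (fun j : 'I_(deg (g ord_max)) => a (inord (m + j)%N.+1)) aone)) = y (drop m w).
    by rewrite [LHS](segment_expc _ yg) // take_oversize // size_drop size_wl addKn.
  rewrite -xE -yE; congr (prodc A _); apply: wl_eq => // i.
  by case: (ord2 i) => ->; rewrite ?sum0 ?sum1.
rewrite signE fE gammaE scalerA expc_sgn; congr (_ *: _).
by rewrite -signr_odd -signr_addb; case: (odd m); case: (odd n).
Qed.
End Braces.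

(** * Cohomology classes *)

Lemma big_single (V : zmodType) n (i : 'I_n) (F : 'I_n -> V) :
  (forall j, j != i -> F j = 0) -> \sum_(j < n) F j = F i.
Proof. by move=> F0; rewrite (bigD1 i) //= big1 ?addr0 // => j; apply: F0. Qed.

(** * Extension of graded bilinear operations to direct sums *)

Section BilinearExtension.
Variables (K : fieldType) (V : nat -> lmodType K).

Lemma dsum_in_eq n (x : V n) : dsum_in x n = x.
Proof. exact: dfwith_in. Qed.
Lemma dsum_in_neq n (x : V n) m : m != n -> dsum_in x m = 0.
Proof. by move=> mn; rewrite /= dfwith_out // eq_sym. Qed.

Lemma dsum_in_linear n : linear (@dsum_in K V n).
Proof.
move=> k x y; apply: dsum_eq => m.
rewrite -[RHS]/(k *: dsum_in x m + dsum_in y m).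
have [->|mn] := eqVneq m n; first by rewrite !dsum_in_eq.
by rewrite !dsum_in_neq // scaler0 addr0.
Qed.

Lemma dsum_coord_sum (J : Type) (r : seq J) (P : pred J) (F : J -> dsum V) n :
  (\sum_(j <- r | P j) F j) n = \sum_(j <- r | P j) F j n.
Proof. exact: (big_morph (fun u : dsum V => u n)). Qed.

Lemma dsum_decomp (u : dsum V) : exists N, u = \sum_(n < N) dsum_in (u n).
Proof.
have [N uN] := dsum_finite u; exists N; apply: dsum_eq => n.
rewrite dsum_coord_sum; have [Nn|nN] := leqP N n.
  rewrite uN // big1 // => i _; rewrite dsum_in_neq //.
  by rewrite gtn_eqF // (leq_trans _ Nn).
rewrite (@big_single _ _ (Ordinal nN)) => [|i iN]; last by rewrite dsum_in_neq // eq_sym.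
by rewrite [RHS](dsum_in_eq (u n)).
Qed.

Variables (d : nat -> nat -> nat) (B : forall m n, V m -> V n -> V (d m n)).
Hypothesis Bbilin : forall m n, bilin (@B m n).
Hypothesis d_le : forall m n, (d m n <= m + n)%N.
Hypothesis le_d : forall m n, (m <= (d m n).+1)%N /\ (n <= (d m n).+1)%N.

(** By [le_d], components of degree above N + 1 cannot contribute to degree N, so a finite double
    sum suffices. Passing through [dsum_in] and reading off degree N discards the pairs with [d m n]
    different from N, and avoids casts between the spaces. *)
Let coord (u v : dsum V) N : V N :=
  \sum_(m < N.+2) \sum_(n < N.+2) dsum_in (B (u m) (v n)) N.

Fact bext_finite u v : exists M, forall N, (M <= N)%N -> coord u v N = 0.
Proof.
have [M1 u0] := dsum_finite u; have [M2 v0] := dsum_finite v.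
exists (M1 + M2)%N => N MN; rewrite /coord big1 // => m _; rewrite big1 // => n _.
have [/u0 ->|m1] := leqP M1 m.
  by rewrite (lin0 ((Bbilin _ _).1 _)) (lin0 (@dsum_in_linear _)).
have [/v0 ->|n2] := leqP M2 n.
  by rewrite (lin0 ((Bbilin _ _).2 _)) (lin0 (@dsum_in_linear _)).
rewrite dsum_in_neq // gtn_eqF // (leq_ltn_trans (d_le _ _)) //.
by move: MN m1 n2; lia.
Qed.
Definition bext u v : dsum V := DSum (bext_finite u v).

Lemma bext_bilin : bilin bext.
Proof.
have inP k n (x y : V n) N : dsum_in (k *: x + y) N = k *: dsum_in x N + dsum_in y N.
  exact: (congr1 (fun w : dsum V => w N) (dsum_in_linear k x y)).
split=> [v|u] k a b; apply: dsum_eq => N.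
  rewrite -[RHS]/(k *: coord a v N + coord b v N) -[LHS]/(coord _ _ N).
  rewrite /coord scaler_sumr -big_split; apply: eq_bigr => m _.
  rewrite scaler_sumr -big_split; apply: eq_bigr => n _.
  by rewrite -[(k *: a + b) m]/(k *: a m + b m) (Bbilin m n).1 inP.
rewrite -[RHS]/(k *: coord u a N + coord u b N) -[LHS]/(coord _ _ N).
rewrite /coord scaler_sumr -big_split; apply: eq_bigr => m _.
rewrite scaler_sumr -big_split; apply: eq_bigr => n _.
by rewrite -[(k *: a + b) n]/(k *: a n + b n) (Bbilin m n).2 inP.
Qed.

Lemma bext_in m n (x : V m) (y : V n) : bext (dsum_in x) (dsum_in y) = dsum_in (B x y).
Proof.
have B0l m' n' y' : @B m' n' 0 y' = 0 by exact: (lin0 ((Bbilin _ _).1 _)).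
have B0r m' n' x' : @B m' n' x' 0 = 0 by exact: (lin0 ((Bbilin _ _).2 _)).
have in0 k N : @dsum_in K V k 0 N = 0 by rewrite (lin0 (@dsum_in_linear _)).
apply: dsum_eq => N; rewrite [LHS]/(coord _ _ _) /coord.
have [mN|Nm] := ltnP m N.+2; last first.
  rewrite big1 => [|m' _]; last first.
    rewrite big1 // => n' _; rewrite [dsum_in x _]dsum_in_neq ?B0l ?in0 //.
    by rewrite ltn_eqF // (leq_trans (ltn_ord m') Nm).
  rewrite dsum_in_neq //; apply: contraTneq Nm => ->.
  by rewrite -leqNgt; exact: (le_d m n).1.
have [nN|Nn] := ltnP n N.+2; last first.
  rewrite big1 => [|m' _]; last first.
    rewrite big1 // => n' _; rewrite [dsum_in y _]dsum_in_neq ?B0r ?in0 //.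
    by rewrite ltn_eqF // (leq_trans (ltn_ord n') Nn).
  rewrite dsum_in_neq //; apply: contraTneq Nn => ->.
  by rewrite -leqNgt; exact: (le_d m n).2.
rewrite (@big_single _ _ (Ordinal mN)) => [|m' mm']; last first.
  by rewrite big1 // => n' _; rewrite [dsum_in x _]dsum_in_neq ?B0l ?in0.
rewrite (@big_single _ _ (Ordinal nN)) => [|n' nn']; last first.
  by rewrite [dsum_in y _]dsum_in_neq ?B0r ?in0.
by rewrite [dsum_in x _]dsum_in_eq [dsum_in y _]dsum_in_eq.
Qed.
End BilinearExtension.

Section LieProduct.
Variables (K : fieldType) (A : assocAlgType K).
Local Notation C := (conv A (aring A)).
Implicit Types x y z : C.

(** The insertion of [x] into [y * z] obeys the derivation rule exactly by [ins_mul]; only the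
    insertion of [y * z] into [x] needs the homotopy. *)
Lemma lie_mul m n p x y z :
  supported m x -> supported n y -> supported p z -> multiadditive x ->
  cdiff x = 0 -> cdiff y = 0 -> cdiff z = 0 ->
  lie m (n + p)%N x (y * z) =
  sgn (~~ odd m && odd p) (lie m n x y * z) + y * lie m p x z
  + sgn (~~ odd n (+) ~~ odd p (+) (~~ odd p && odd n)) (cdiff (ins2 n y p z x)).
Proof.
move=> xm yn zp xa dx dy dz.
rewrite /lie (ins_cocycle_mul xm yn zp xa dx dy dz) ins_mul (twist_supp _ yn).
rewrite !(mulrBl, mulrBr, sgnMl, sgnMr, sgnD, sgnN, sgn_sgn) oddD.
by case: (odd m); case: (odd n); case: (odd p); rewrite /sgn /=; zmod.
Qed.

Lemma cdiff_lin k x y w :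
  cdiff (fun w => k *: (x w : A) + y w : A) w = k *: (cdiff x w : A) + cdiff y w.
Proof.
rewrite /cdiff !convDE !convNE conv_linr ins_lin.
have -> : twist true (fun w => k *: (x w : A) + y w : A) =
    (fun w => k *: (twist true x w : A) + twist true y w).
  by apply/funext => u; rewrite /twist linear_sgn.
by rewrite conv_linl !scalerBr; zmod.
Qed.

Lemma ins_letters_lin n k y z (x : seq A -> A) w : mlin x ->
  ins n (fun v => k *: (y v : A) + z v : A) x w = k *: ins n y x w + ins n z x w.
Proof.
elim: w x => [|a w IH] x xm /=.
  by rewrite !addr0 /cutp; case: leqP => // _; [rewrite (xm [::]) | rewrite scaler0 addr0].
rewrite IH; last exact: mlin_cons.
rewrite linear_sgn.
have -> : cutp n (fun v t => x ((k *: y v + z v) :: t)) (a :: w) =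
    k *: cutp n (fun v t => x (y v :: t)) (a :: w) + cutp n (fun v t => x (z v :: t)) (a :: w).
  by rewrite /cutp; case: leqP => // _; [rewrite (xm [::]) | rewrite scaler0 addr0].
by rewrite scalerDr addrACA.
Qed.
End LieProduct.

(** * Closed and exact functions on words *)

Section Classes.
Variables (K : fieldType) (H : algType K) (A : assocAlgType K).
Variables (comul : {linear H -> btensor H H}) (counit : {linear H -> K^o}).
Variable act : H -> {linear A -> A}.
Hypothesis bialgH : is_bialgebra comul counit.
Hypothesis modalgA : is_module_algebra comul counit act.
Local Notation C := (conv A (aring A)).
Local Notation good := (good comul counit act).
Local Notation HH := (HH comul act).
Local Notation cocycle := (cocycle comul act).
Implicit Types x y z : C.

Definition closedc n x := good n x /\ cdiff x = 0.
(** The alternative [x = 0] accounts for degree 0, there being no cochains of degree -1. *)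
Definition exactc n x := x = 0 \/ exists m y, [/\ n = m.+1, good m y & x = cdiff y].

Lemma closed_cochain n x : closedc n x -> expc n x \in cocycle n.
Proof.
move=> [xg dx]; apply/asboolP; split; first exact: (hom_expc bialgH modalgA xg).
by rewrite (dCH_expc bialgH modalgA xg) dx expc0.
Qed.
Lemma cochain_closed n f : f \in cocycle n -> exists2 x, closedc n x & f = expc n x.
Proof.
move=> /asboolP [fh fd]; have [x xg fE] := hom_good bialgH modalgA fh.
exists x => //; split=> //; apply: (@expc_inj K H A comul counit act bialgH modalgA n.+1).
- exact: (good_cdiff bialgH modalgA).
- exact: good0.
by rewrite expc0 -(dCH_expc bialgH modalgA xg) -fE.
Qed.

(** Total in [x], with the default 0 when [expc n x] is not a cocycle, so that classes can be
    rewritten without carrying proofs. *)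
Definition cl n x : HH n :=
  \pi_(qspace (@coboundary_submod K H A comul act n)) (insubd (0 : cocycles comul act n) (expc n x)).

Lemma HHclassE n x (xZ : expc n x \in cocycle n) : HHclass xZ = cl n x.
Proof.
suff E : Cocycle xZ = insubd (0 : cocycles comul act n) (expc n x) by rewrite /HHclass E.
by apply/val_inj; rewrite val_insubd xZ.
Qed.

Lemma cl_surj n (u : HH n) : exists2 x, closedc n x & u = cl n x.
Proof.
have [[f fZ] ->] := pi_surj u; have [x xZ fE] := cochain_closed fZ.
by exists x => //; subst f; rewrite -(HHclassE fZ).
Qed.

Lemma closed_lin n k x y : closedc n x -> closedc n y ->
  closedc n (fun w => k *: (x w : A) + y w : A).
Proof.
move=> [xg dx] [yg dy]; split; first exact: good_lin.
by apply/funext => w; rewrite cdiff_lin dx dy scaler0 addr0.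
Qed.

Lemma cl_lin n k x y : closedc n x -> closedc n y ->
  cl n (fun w => k *: (x w : A) + y w : A) = k *: cl n x + cl n y.
Proof.
move=> xZ yZ; rewrite /cl -pi_linear.
set u := insubd _ _; set v := insubd _ (expc n x); set w := insubd _ (expc n y).
suff -> : u = k *: v + w by [].
apply/val_inj; rewrite val_insubd (closed_cochain (closed_lin k xZ yZ)).
rewrite -[RHS]/(k *: val v + val w).
by rewrite !val_insubd !closed_cochain // expc_lin.
Qed.

Lemma cl_exact n x : closedc n x -> (cl n x = 0 <-> exactc n x).
Proof.
move=> xZ; have [xg _] := xZ.
have E : cl n x = 0 <-> is_coboundary comul act (expc n x).
  rewrite -(lin0 (@pi_linear _ _ _ (@coboundary_submod K H A comul act n))).
  split=> [/eqP|cb].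
    by rewrite pi_eqE => /asboolP; rewrite subr0 val_insubd closed_cochain.
  by apply/eqP; rewrite pi_eqE; apply/asboolP; rewrite subr0 val_insubd closed_cochain.
rewrite {}E; split.
  case: n xZ xg => [|n] _ xg /=.
    move=> x0; left; apply: (expc_inj bialgH modalgA xg (good0 _ _ _ _)).
    by rewrite x0 expc0.
  case=> g /(hom_good bialgH modalgA)[y yg ->]; rewrite (dCH_expc bialgH modalgA yg) => xE.
  right; exists n, y; split=> //.
  exact: (expc_inj bialgH modalgA xg (good_cdiff bialgH modalgA yg)).
case=> [->|[m [y [nE yg ->]]]].
  rewrite expc0; case: (n) => [//|k].
  exists 0; first exact: hom_crossed0.
  apply/funext => t; rewrite -[RHS]/((0 : CB A k -> A) (dCB t)) //.
rewrite nE; exists (expc m y); first exact: (hom_expc bialgH modalgA yg).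
by rewrite (dCH_expc bialgH modalgA yg).
Qed.

Lemma cl_eq n x y : closedc n x -> closedc n y -> exactc n (x - y) -> cl n x = cl n y.
Proof.
move=> xZ yZ; have := closed_lin (-1) yZ xZ.
have -> : (fun w => -1 *: (y w : A) + x w : A) = x - y :> C.
  by apply/funext => w; rewrite scaleN1r addrC.
move=> dZ /(cl_exact dZ).2 E; apply/eqP; rewrite -subr_eq0 addrC -scaleN1r -cl_lin //.
by rewrite -E; apply/eqP; congr cl; apply/funext => w; rewrite scaleN1r addrC.
Qed.

Lemma cdiff0 : cdiff (0 : C) = 0.
Proof. by apply: (addrI (cdiff (0 : C))); rewrite -cdiffD !addr0. Qed.

(** Homotopies have degree N - 1; for N = 0, where the predecessor is truncated, the homotopy has to
    be zero. *)
Lemma exact_pred N w : good N.-1 w -> (N = 0%N -> w = 0) -> exactc N (cdiff w).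
Proof.
case: N => [|N] wg w0; last by right; exists N, w.
by left; rewrite w0 // cdiff0.
Qed.

Lemma cdiff_sgn b x : cdiff (sgn b x) = sgn b (cdiff x).
Proof.
case: b => //=; apply/eqP; rewrite -subr_eq0 opprK -cdiffD addNr cdiff0 //.
Qed.

Lemma exact_sgn n b x : exactc n x -> exactc n (sgn b x).
Proof.
case=> [->|[m [y [nE yg ->]]]]; first by left; rewrite sgn0.
by right; exists m, (sgn b y); split=> //; [apply: good_sgn | rewrite cdiff_sgn].
Qed.

Lemma closed_mul m n x y : closedc m x -> closedc n y -> closedc (m + n)%N (x * y).
Proof.
move=> [xg dx] [yg dy]; split; first exact: (good_conv bialgH modalgA).
by rewrite cdiffM dx dy mul0r mulr0 addr0.
Qed.
Lemma closed_sgn n b x : closedc n x -> closedc n (sgn b x).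
Proof. by move=> [xg dx]; split; [apply: good_sgn | rewrite cdiff_sgn dx sgn0]. Qed.
Lemma exact_mull m n x y : exactc m x -> closedc n y -> exactc (m + n)%N (x * y).
Proof.
case=> [->|[k [w [-> wg ->]]]] [yg dy]; first by left; rewrite mul0r.
right; exists (k + n)%N, (w * y); split; [by [] | exact: (good_conv bialgH modalgA) |].
by rewrite cdiffM dy mulr0 addr0.
Qed.
Lemma exact_mulr m n x y : closedc m x -> exactc n y -> exactc (m + n)%N (x * y).
Proof.
move=> [xg dx] [->|[k [w [-> wg ->]]]]; first by left; rewrite mulr0.
(* The sign (-1)^m undoes the twist of [x] in the Leibniz rule. *)
right; exists (m + k)%N, (sgn (odd m) (x * w)).
have [_ xs _] := xg; split; first by rewrite addnS.
  exact/good_sgn/(good_conv bialgH modalgA).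
by rewrite cdiff_sgn cdiffM dx mul0r add0r (twist_supp _ xs) sgnMl sgn_sgn addbb.
Qed.

Lemma lie0l m n y : good n y -> lie m n 0 y = 0.
Proof.
by move=> [ym _ _]; rewrite /lie ins_zero ins_0 ?sgn0 ?subr0 //; apply: mlin_multiadditive.
Qed.
Lemma lie0r m n x : good m x -> lie m n x 0 = 0.
Proof. by move=> xg; rewrite lie_antisym lie0l // sgn0 oppr0. Qed.
Lemma cdiff_lieE m n x y : good m x -> good n y -> cdiff (lie m n x y) =
  sgn (~~ odd n) (lie m.+1 n (cdiff x) y) + lie m n.+1 x (cdiff y).
Proof.
by move=> [xm xs _] [ym ys _]; apply: cdiff_lie => //; apply: mlin_multiadditive.
Qed.
Lemma closed_lie m n x y : closedc m x -> closedc n y -> closedc (m + n).-1 (lie m n x y).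
Proof.
move=> [xg dx] [yg dy]; split; first exact: (good_lie bialgH modalgA).
by rewrite cdiff_lieE // dx dy lie0l // lie0r // sgn0 addr0.
Qed.
Lemma exact_liel m n x y : exactc m x -> closedc n y -> exactc (m + n).-1 (lie m n x y).
Proof.
case=> [->|[k [w [-> wg ->]]]] [yg dy]; first by left; apply: lie0l.
(* Since [y] is closed, only one term of [cdiff_lieE] survives; its sign is absorbed into the
   primitive. *)
have -> : lie k.+1 n (cdiff w) y = cdiff (sgn (~~ odd n) (lie k n w y)).
  by rewrite cdiff_sgn cdiff_lieE // dy lie0r // addr0 sgn_sgn addbb.
rewrite addSn; apply: exact_pred; first exact/good_sgn/(good_lie bialgH modalgA).
have [_ ws _] := wg; have [_ ys _] := yg.
by move=> /eqP; rewrite addn_eq0 => /andP[/eqP k0 /eqP n0]; subst k n; rewrite lie_supp0 ?sgn0.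
Qed.
Lemma exact_lier m n x y : closedc m x -> exactc n y -> exactc (m + n).-1 (lie m n x y).
Proof.
move=> xZ ye; rewrite lie_antisym addnC; apply: (exact_sgn true).
exact/exact_sgn/exact_liel.
Qed.
End Classes.

Section ClassOperations.
Variables (K : fieldType) (H : algType K) (A : assocAlgType K).
Variables (comul : {linear H -> btensor H H}) (counit : {linear H -> K^o}).
Variable act : H -> {linear A -> A}.
Hypothesis bialgH : is_bialgebra comul counit.
Hypothesis modalgA : is_module_algebra comul counit act.
Local Notation C := (conv A (aring A)).
Local Notation HH := (HH comul act).
Local Notation closedc := (closedc comul counit act).
Local Notation exactc := (exactc comul counit act).
Local Notation cl := (cl comul act).
Local Notation lin k x y := ((fun w => k *: (x w : A) + y w : A) : C).

Definition rep n (u : HH n) : C := s2val (cid2 (cl_surj bialgH modalgA u)).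
Lemma rep_closed n (u : HH n) : closedc n (rep u).
Proof. exact: (s2valP (cid2 (cl_surj bialgH modalgA u))). Qed.
Lemma repK n (u : HH n) : cl n (rep u) = u.
Proof. exact/esym/(s2valP' (cid2 (cl_surj bialgH modalgA u))). Qed.

Section Induced.
Variables (d : nat -> nat -> nat) (op : nat -> nat -> C -> C -> C).
Hypothesis op_closed : forall m n x y, closedc m x -> closedc n y -> closedc (d m n) (op m n x y).
Hypothesis op_exactl : forall m n x y, exactc m x -> closedc n y -> exactc (d m n) (op m n x y).
Hypothesis op_exactr : forall m n x y, closedc m x -> exactc n y -> exactc (d m n) (op m n x y).
Hypothesis op_linl : forall m n k x x' y, closedc m x -> closedc m x' -> closedc n y ->
  op m n (lin k x x') y = lin k (op m n x y) (op m n x' y).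
Hypothesis op_linr : forall m n k x y y', closedc m x -> closedc n y -> closedc n y' ->
  op m n x (lin k y y') = lin k (op m n x y) (op m n x y').

Definition class_op m n (u : HH m) (v : HH n) : HH (d m n) := cl (d m n) (op m n (rep u) (rep v)).

(** Independence of the representatives is checked in one argument at a time: two representatives
    differ by an exact function, which [op] sends to an exact one. *)
Lemma class_opE m n x y : closedc m x -> closedc n y ->
  class_op (cl m x) (cl n y) = cl (d m n) (op m n x y).
Proof.
have cl_sub n' x' y' : closedc n' x' -> closedc n' y' -> cl n' (lin (-1) x' y') = 0 -> cl n' x' = cl n' y'.
  move=> xZ yZ; rewrite (cl_lin bialgH modalgA) // scaleN1r addrC => /eqP.
  by rewrite subr_eq0 => /eqP.
have sub_cl n' x' y' : closedc n' x' -> closedc n' y' -> cl n' x' = cl n' y' -> exactc n' (lin (-1) x' y').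
  move=> xZ yZ xy; apply/(cl_exact bialgH modalgA (closed_lin (-1) xZ yZ)).
  by rewrite (cl_lin bialgH modalgA) // xy scaleN1r addNr.
move=> xZ yZ; have uZ := rep_closed (cl m x); have vZ := rep_closed (cl n y).
rewrite /class_op; transitivity (cl (d m n) (op m n x (rep (cl n y)))).
  apply: cl_sub; try exact: op_closed; rewrite -op_linl //.
  apply/(cl_exact bialgH modalgA); first exact/op_closed/vZ/closed_lin.
  by apply: op_exactl => //; apply: sub_cl => //; rewrite repK.
apply: cl_sub; try exact: op_closed; rewrite -op_linr //.
apply/(cl_exact bialgH modalgA); first exact/op_closed/closed_lin.
by apply: op_exactr => //; apply: sub_cl => //; rewrite repK.
Qed.

Lemma class_op_bilin m n : bilin (@class_op m n).
Proof.
split=> [v|u] k a b.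
  rewrite -(repK v) -(repK a) -(repK b).
  rewrite -(cl_lin bialgH modalgA) ?class_opE ?op_linl ?(cl_lin bialgH modalgA) //;
    try exact: rep_closed; try (apply: op_closed; exact: rep_closed).
  by apply: closed_lin; apply: rep_closed.
rewrite -(repK u) -(repK a) -(repK b).
rewrite -(cl_lin bialgH modalgA) ?class_opE ?op_linr ?(cl_lin bialgH modalgA) //;
  try exact: rep_closed; try (apply: op_closed; exact: rep_closed).
by apply: closed_lin; apply: rep_closed.
Qed.

Hypothesis d_le : forall m n, (d m n <= m + n)%N.
Hypothesis le_d : forall m n, (m <= (d m n).+1)%N /\ (n <= (d m n).+1)%N.

Lemma induced_op : exists2 f : dsum HH -> dsum HH -> dsum HH, bilin f &
  forall m n x y, closedc m x -> closedc n y ->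
    f (dsum_in (cl m x)) (dsum_in (cl n y)) = dsum_in (cl (d m n) (op m n x y)).
Proof.
exists (bext class_op_bilin d_le); first exact: bext_bilin.
by move=> m n x y xZ yZ; rewrite bext_in // class_opE.
Qed.
End Induced.

(** The sign is the total sign computed in [cup_expc]. *)
Definition cup_op m n x y : C := sgn (odd m && odd n) (x * y).

Lemma induced_cup : exists2 f : dsum HH -> dsum HH -> dsum HH, bilin f &
  forall m n x y, closedc m x -> closedc n y ->
    f (dsum_in (cl m x)) (dsum_in (cl n y)) = dsum_in (cl (m + n)%N (cup_op m n x y)).
Proof.
apply: (@induced_op addn cup_op) => //.
- by move=> m n x y xZ yZ; apply/closed_sgn/(closed_mul bialgH modalgA).
- by move=> m n x y xe yZ; apply/exact_sgn/(exact_mull bialgH modalgA).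
- by move=> m n x y xZ ye; apply/exact_sgn/(exact_mulr bialgH modalgA).
- move=> m n k x x' y _ _ _; apply/funext => w.
  by rewrite /cup_op !conv_sgnE conv_linl linear_sgn.
- move=> m n k x y y' _ _ _; apply/funext => w.
  by rewrite /cup_op !conv_sgnE conv_linr linear_sgn.
- by move=> m n; lia.
Qed.

Lemma induced_lie : exists2 f : dsum HH -> dsum HH -> dsum HH, bilin f &
  forall m n x y, closedc m x -> closedc n y ->
    f (dsum_in (cl m x)) (dsum_in (cl n y)) = dsum_in (cl (m + n).-1 (lie m n x y)).
Proof.
apply: (@induced_op (fun m n => (m + n).-1) (@lie K A)).
- by move=> m n x y xZ yZ; apply: (closed_lie bialgH modalgA).
- by move=> m n x y xe yZ; apply: (exact_liel bialgH modalgA).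
- by move=> m n x y xZ ye; apply: (exact_lier bialgH modalgA).
- move=> m n k x x' y _ _ [[ym _ _] _]; apply/funext => w.
  rewrite /lie !convDE !convNE !conv_sgnE ins_lin ins_letters_lin // linear_sgn.
  by rewrite scalerBr; zmod.
- move=> m n k x y y' [[xm _ _] _] _ _; apply/funext => w.
  rewrite /lie !convDE !convNE !conv_sgnE ins_lin ins_letters_lin // linear_sgn.
  by rewrite scalerBr; zmod.
- by move=> m n; lia.
- by move=> m n; lia.
Qed.

Lemma dsum_cl_rep (u : dsum HH) : exists N (x : nat -> C), (forall n, closedc n (x n)) /\
  u = \sum_(n < N) dsum_in (cl n (x n)).
Proof.
have [N uE] := dsum_decomp u; exists N, (fun n => rep (u n)); split=> [n|].
  exact: rep_closed.
by rewrite [LHS]uE; apply: eq_bigr => n _; rewrite repK.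
Qed.

Local Notation dcl n x := (dsum_in (cl n x) : dsum HH).

Lemma dcl0 n : dcl n 0 = 0.
Proof.
have Z0 : closedc n 0 by split; [apply: good0 | apply: cdiff0].
by rewrite (cl_exact bialgH modalgA Z0).2 ?(lin0 (@dsum_in_linear _ _ _)) //; left.
Qed.
(** Truncated predecessors can make the degrees of iterated operations disagree, but only where the
    function vanishes. *)
Lemma dcl_deg n n' x : (n != n' -> x = 0) -> dcl n x = dcl n' x.
Proof. by have [->//|_ ->//] := eqVneq n n'; rewrite !dcl0. Qed.
Lemma dclP n k x y : closedc n x -> closedc n y -> dcl n (lin k x y) = k *: dcl n x + dcl n y.
Proof. by move=> xZ yZ; rewrite (cl_lin bialgH modalgA) // dsum_in_linear. Qed.
Lemma dclD n x y : closedc n x -> closedc n y -> dcl n (x + y) = dcl n x + dcl n y.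
Proof.
move=> xZ yZ; rewrite -[dcl n x]scale1r -dclP //.
by congr (dsum_in (cl _ _)); apply/funext => w; rewrite scale1r.
Qed.
Lemma dcl_sgn n z x : closedc n x -> ((-1) ^ z : K) *: dcl n x = dcl n (sgn (odd (absz z)) x).
Proof.
move=> xZ; rewrite exprN1z sgnE; case: (odd _) => //.
have Z0 : closedc n 0 by split; [apply: good0 | apply: cdiff0].
rewrite /sgn -[LHS]addr0 -(dcl0 n) -scaleN1r -dclP //.
by congr (dsum_in (cl _ _)); apply/funext => w; rewrite scaleN1r addr0.
Qed.
Lemma dcl_eq n x y : closedc n x -> closedc n y -> exactc n (x - y) -> dcl n x = dcl n y.
Proof. by move=> xZ yZ xy; congr dsum_in; apply: (cl_eq bialgH modalgA). Qed.
End ClassOperations.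

(** * The axioms of a Gerstenhaber algebra *)

Section GAlgebra.
Variables (K : fieldType) (H : algType K) (A : assocAlgType K).
Variables (comul : {linear H -> btensor H H}) (counit : {linear H -> K^o}).
Variable act : H -> {linear A -> A}.
Hypothesis bialgH : is_bialgebra comul counit.
Hypothesis modalgA : is_module_algebra comul counit act.
Local Notation C := (conv A (aring A)).
Local Notation HH := (HH comul act).
Local Notation closedc := (closedc comul counit act).
Local Notation exactc := (exactc comul counit act).
Local Notation cl := (cl comul act).
Local Notation dcl n x := (dsum_in (cl n x) : dsum HH).

Variables cupH brk : dsum HH -> dsum HH -> dsum HH.
Hypothesis cup_bilin : bilin cupH.
Hypothesis brk_bilin : bilin brk.
Hypothesis cupE : forall m n x y, closedc m x -> closedc n y ->
  cupH (dcl m x) (dcl n y) = dcl (m + n)%N (cup_op m n x y).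
Hypothesis brkE : forall m n x y, closedc m x -> closedc n y ->
  brk (dcl m x) (dcl n y) = dcl (m + n).-1 (lie m n x y).

Let cZ m n x y : closedc m x -> closedc n y -> closedc (m + n)%N (cup_op m n x y).
Proof. by move=> xZ yZ; apply/closed_sgn/(closed_mul bialgH modalgA). Qed.
Let lZ m n x y : closedc m x -> closedc n y -> closedc (m + n).-1 (lie m n x y).
Proof. exact: (closed_lie bialgH modalgA). Qed.

Lemma par_pred m n : (0 < m + n)%N -> odd (m + n).-1 = ~~ (odd m (+) odd n).
Proof. by case: m => [|m] /=; [case: n => //= n; rewrite negbK | rewrite addSn /= oddD negb_add; case: (odd m); case: (odd n)]. Qed.

Lemma lie_deg0 m n x y : closedc m x -> closedc n y -> (m + n)%N = 0%N -> lie m n x y = 0.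
Proof.
move=> [[_ xs _] _] [[_ ys _] _] /eqP; rewrite addn_eq0 => /andP[/eqP m0 /eqP n0].
by subst m n; apply: lie_supp0.
Qed.

Lemma cup_assoc m n p x y z : closedc m x -> closedc n y -> closedc p z ->
  cupH (dcl m x) (cupH (dcl n y) (dcl p z)) = cupH (cupH (dcl m x) (dcl n y)) (dcl p z).
Proof.
move=> xZ yZ zZ; rewrite !cupE //; try exact: cZ.
rewrite addnA; congr (dsum_in (cl _ _)).
rewrite /cup_op !sgnMr !sgnMl !sgn_sgn !oddD mulrA; congr sgn.
by case: (odd m); case: (odd n); case: (odd p).
Qed.

Lemma cup_comm m n x y : closedc m x -> closedc n y ->
  cupH (dcl m x) (dcl n y) = ((-1) ^ (m%:Z * n%:Z) : K) *: cupH (dcl n y) (dcl m x).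
Proof.
move=> xZ yZ; rewrite !cupE // (dcl_sgn bialgH modalgA); last exact: cZ.
rewrite odd_abszM /= addnC; apply: (dcl_eq bialgH modalgA).
- by rewrite addnC; apply: cZ.
- exact/closed_sgn/cZ.
have [xg dx] := xZ; have [yg dy] := yZ; have [xm xs _] := xg; have [_ ys _] := yg.
have := cocycle_commut xs ys (mlin_multiadditive xm) dx dy => E.
have -> : cup_op m n x y - sgn (odd m && odd n) (cup_op n m y x) =
    sgn (~~ odd n) (cdiff (ins n y x)) :> C.
  rewrite /cup_op E sgnD !sgn_sgn addbb; case: (odd m); case: (odd n); rewrite /sgn /=; zmod.
(* The homotopy [ins n y x] has degree [(m + n).-1], and it vanishes for m = 0. *)
apply: exact_sgn; apply: (exact_pred (counit := counit)).
  by rewrite addnC; apply: (good_ins bialgH modalgA).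
by move=> /eqP; rewrite addn_eq0 => /andP[_ /eqP m0]; subst m; apply: ins_supp0.
Qed.

Lemma brk_antisym m n x y : closedc m x -> closedc n y ->
  brk (dcl m x) (dcl n y) = - ((-1) ^ ((m%:Z - 1) * (n%:Z - 1)) : K) *: brk (dcl n y) (dcl m x).
Proof.
move=> xZ yZ; rewrite !brkE // scaleNr (dcl_sgn bialgH modalgA); last exact: lZ.
rewrite odd_abszM !odd_abszB1 addnC -scaleN1r -[X in X *: _](expr1z (-1 : K)).
rewrite (dcl_sgn bialgH modalgA); last exact/closed_sgn/lZ.
by rewrite lie_antisym.
Qed.

Lemma brk_jacobi m n p x y z : closedc m x -> closedc n y -> closedc p z ->
  brk (dcl m x) (brk (dcl n y) (dcl p z)) = brk (brk (dcl m x) (dcl n y)) (dcl p z)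
  + ((-1) ^ ((m%:Z - 1) * (n%:Z - 1)) : K) *: brk (dcl n y) (brk (dcl m x) (dcl p z)).
Proof.
move=> xZ yZ zZ; rewrite !brkE //; try exact: lZ.
(* The common degree of the three double brackets. One of them can have another degree only if its
   inner bracket is taken between two elements of degree 0, and then it is zero. *)
pose N := (m + n + p).-2.
have [[xm xs _] _] := xZ; have [[ym ys _] _] := yZ; have [[zm zs _] _] := zZ.
have l0r k k' u : closedc k u -> lie k k' u 0 = 0 by move=> [ug _]; apply: (lie0r _ ug).
have l0l k k' u : closedc k' u -> lie k k' 0 u = 0 by move=> [ug _]; apply: (lie0l _ ug).
have d1 : (m + (n + p).-1).-1 != N -> lie m (n + p).-1 x (lie n p y z) = 0.
  by move=> dN; rewrite (lie_deg0 yZ zZ) ?l0r //; move: dN; rewrite /N; lia.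
have d2 : ((m + n).-1 + p).-1 != N -> lie (m + n).-1 p (lie m n x y) z = 0.
  by move=> dN; rewrite (lie_deg0 xZ yZ) ?l0l //; move: dN; rewrite /N; lia.
have d3 : (n + (m + p).-1).-1 != N -> lie n (m + p).-1 y (lie m p x z) = 0.
  by move=> dN; rewrite (lie_deg0 xZ zZ) ?l0r //; move: dN; rewrite /N; lia.
have Z2 : closedc N (lie (m + n).-1 p (lie m n x y) z).
  have [<-|/d2 ->] := eqVneq ((m + n).-1 + p).-1 N; first exact/lZ/zZ/lZ.
  by split; [apply: good0 | apply: cdiff0].
have Z3 : closedc N (lie n (m + p).-1 y (lie m p x z)).
  have [<-|/d3 ->] := eqVneq (n + (m + p).-1).-1 N; first exact/lZ/lZ.
  by split; [apply: good0 | apply: cdiff0].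
rewrite (dcl_deg bialgH modalgA d1) (dcl_deg bialgH modalgA d2) (dcl_deg bialgH modalgA d3).
rewrite (dcl_sgn bialgH modalgA _ Z3) -(dclD bialgH modalgA Z2); last exact: closed_sgn.
rewrite odd_abszM !odd_abszB1; congr (dsum_in (cl _ _)).
by apply: lie_jacobi => //; apply: mlin_multiadditive.
Qed.

Lemma brk_cup m n p x y z : closedc m x -> closedc n y -> closedc p z ->
  brk (dcl m x) (cupH (dcl n y) (dcl p z)) = cupH (brk (dcl m x) (dcl n y)) (dcl p z)
  + ((-1) ^ ((m%:Z - 1) * n%:Z) : K) *: cupH (dcl n y) (brk (dcl m x) (dcl p z)).
Proof.
move=> xZ yZ zZ; rewrite !brkE // !cupE // ?brkE //; try exact: lZ; try exact: cZ.
(* Here too the degrees agree unless a bracket of two elements of degree 0, hence zero, occurs as a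
   factor. *)
pose N := (m + n + p).-1.
have [xg dx] := xZ; have [yg dy] := yZ; have [zg dz] := zZ.
have [xm xs _] := xg; have [ym ys _] := yg; have [zm zs _] := zg.
have Z0 k : closedc k 0 by split; [apply: good0 | apply: cdiff0].
have d1 : ((m + n).-1 + p)%N != N -> lie m n x y = 0.
  by move=> dN; rewrite (lie_deg0 xZ yZ) //; move: dN; rewrite /N; lia.
have d2 : (n + (m + p).-1)%N != N -> lie m p x z = 0.
  by move=> dN; rewrite (lie_deg0 xZ zZ) //; move: dN; rewrite /N; lia.
have E1 : cup_op (m + n).-1 p (lie m n x y) z =
    sgn (~~ (odd m (+) odd n) && odd p) (lie m n x y * z).
  rewrite /cup_op; have [mn|mn] := posnP (m + n)%N; last by rewrite par_pred.
  by rewrite (lie_deg0 xZ yZ mn) mul0r !sgn0.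
have E2 : cup_op n (m + p).-1 y (lie m p x z) =
    sgn (odd n && ~~ (odd m (+) odd p)) (y * lie m p x z).
  rewrite /cup_op; have [mn|mn] := posnP (m + p)%N; last by rewrite par_pred.
  by rewrite (lie_deg0 xZ zZ mn) mulr0 !sgn0.
have Z1 : closedc N (lie m n x y * z).
  have [<-|/d1 ->] := eqVneq ((m + n).-1 + p)%N N; last by rewrite mul0r; apply: Z0.
  exact/(closed_mul bialgH modalgA)/zZ/lZ.
have Z2 : closedc N (y * lie m p x z).
  have [<-|/d2 ->] := eqVneq (n + (m + p).-1)%N N; last by rewrite mulr0; apply: Z0.
  exact/(closed_mul bialgH modalgA)/lZ.
rewrite E1 E2 addnA.
rewrite (@dcl_deg _ _ _ _ _ _ bialgH modalgA ((m + n).-1 + p)%N N); last by move=> /d1 ->; rewrite mul0r sgn0.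
rewrite (@dcl_deg _ _ _ _ _ _ bialgH modalgA (n + (m + p).-1)%N N); last by move=> /d2 ->; rewrite mulr0 sgn0.
rewrite (dcl_sgn bialgH modalgA); last exact: closed_sgn.
rewrite -(dclD bialgH modalgA); try exact: closed_sgn; last exact/closed_sgn/closed_sgn.
apply: (dcl_eq bialgH modalgA).
- by rewrite /N -addnA; apply: lZ => //; apply: cZ.
- have closedD u v : closedc N u -> closedc N v -> closedc N (u + v).
    by move=> [ug du] [vg dv]; split; [apply: goodD | rewrite cdiffD du dv addr0].
  by apply: closedD; do ?apply: closed_sgn.
have := lie_mul xs ys zs (mlin_multiadditive xm) dx dy dz => E.
have lsgn b u : lie m (n + p) x (sgn b u) = sgn b (lie m (n + p) x u).
  rewrite /lie ins_letters_sgn; last exact: mlin_multiadditive.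
  case: b => //=; rewrite /sgn; have := insB m x 0 u; rewrite ins_zero !sub0r => ->.
  by case: ifP => _; zmod.
rewrite {1}/cup_op lsgn E odd_abszM odd_abszB1 /= sgn_sgn.
set D := cdiff _; set b := (X in sgn X D).
have -> : sgn (odd n && odd p) (sgn (~~ odd m && odd p) (lie m n x y * z) + y * lie m p x z + sgn b D)
  - (sgn (~~ (odd m (+) odd n) && odd p) (lie m n x y * z) +
   sgn (~~ odd m && odd n (+) odd n && ~~ (odd m (+) odd p)) (y * lie m p x z)) =
  sgn (odd n && odd p) (sgn b D).
  by case: (odd m); case: (odd n); case: (odd p); rewrite /sgn /=; zmod.
(* All products have cancelled, and the coboundary of x{y, z} is left. If N = 0 then m < 2, so x{y,
   z} has too few slots and is zero. *)
apply/exact_sgn/exact_sgn/(exact_pred (counit := counit)).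
  exact: (good_ins2 bialgH modalgA).
by rewrite /N => mnp; apply: (@ins2_supp01 _ _ _ _ _ _ _ m) => //; move: mnp; lia.
Qed.

Lemma dsum_lin_ext (f g : dsum HH -> dsum HH) : linear f -> linear g ->
  (forall n x, closedc n x -> f (dcl n x) = g (dcl n x)) -> f =1 g.
Proof.
move=> fl gl fg u; have [N [x [xZ ->]]] := dsum_cl_rep bialgH modalgA u.
by rewrite (lin_sum fl) (lin_sum gl); apply: eq_bigr => n _; apply: fg.
Qed.

Lemma G_algebra : is_G_algebra cupH brk.
Proof.
have clS n (u : HH n) := cl_surj bialgH modalgA u.
have [cl1 cl2] := cup_bilin; have [bl1 bl2] := brk_bilin.
split=> //.
- move=> m n x y; have [x' xZ ->] := clS _ x; have [y' yZ ->] := clS _ y.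
  by rewrite cupE //; exists (cl (m + n)%N (cup_op m n x' y')).
(* Associativity is stated for all elements of the direct sum; linearity in each argument in turn
   reduces it to homogeneous classes. *)
- move=> u v w.
  apply: (@dsum_lin_ext (fun u => cupH u (cupH v w)) (fun u => cupH (cupH u v) w)).
  + exact: cl1.
  + by move=> k a b; rewrite !cl1.
  move=> m x xZ; apply: (@dsum_lin_ext (fun v => cupH (dcl m x) (cupH v w))
    (fun v => cupH (cupH (dcl m x) v) w)).
  + by move=> k a b; rewrite cl1 cl2.
  + by move=> k a b; rewrite cl2 cl1.
  move=> n y yZ; apply: (@dsum_lin_ext (fun w => cupH (dcl m x) (cupH (dcl n y) w))
    (fun w => cupH (cupH (dcl m x) (dcl n y)) w)).
  + by move=> k a b; rewrite !cl2.
  + exact: cl2.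
  by move=> p z zZ; apply: cup_assoc.
- move=> m n x y; have [x' xZ ->] := clS _ x; have [y' yZ ->] := clS _ y.
  exact: cup_comm.
- move=> x y; have [x' xZ ->] := clS _ x; have [y' yZ ->] := clS _ y.
  by rewrite brkE // (lie_deg0 xZ yZ) // (dcl0 bialgH modalgA).
- move=> m n x y _; have [x' xZ ->] := clS _ x; have [y' yZ ->] := clS _ y.
  by rewrite brkE //; exists (cl (m + n).-1 (lie m n x' y')).
- move=> m n x y; have [x' xZ ->] := clS _ x; have [y' yZ ->] := clS _ y.
  exact: brk_antisym.
- move=> m n p x y z; have [x' xZ ->] := clS _ x; have [y' yZ ->] := clS _ y.
  by have [z' zZ ->] := clS _ z; apply: brk_jacobi.
- move=> m n p x y z; have [x' xZ ->] := clS _ x; have [y' yZ ->] := clS _ y.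
  by have [z' zZ ->] := clS _ z; apply: brk_cup.
Qed.
End GAlgebra.

Theorem corollary6p3 (K : fieldType) (H : algType K) (A : assocAlgType K)
    (comul : {linear H -> btensor H H}) (counit : {linear H -> K^o})
    (act : H -> {linear A -> A})
    (bialgH : is_bialgebra comul counit)
    (modalgA : is_module_algebra comul counit act) :
  exists cupHH brkHH :
      dsum (HH comul act) -> dsum (HH comul act) -> dsum (HH comul act),
    is_G_algebra cupHH brkHH /\
    forall (m n : nat) (x : CB A m -> A) (y : CB A n -> A)
        (xZ : x \in cocycle comul act m) (yZ : y \in cocycle comul act n),
      (exists cZ : cup x y \in cocycle comul act (m + n),
         cupHH (dsum_in (HHclass xZ)) (dsum_in (HHclass yZ)) =
         dsum_in (HHclass cZ)) /\
      (exists bZ : bracket x y \in cocycle comul act (m + n).-1,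
         brkHH (dsum_in (HHclass xZ)) (dsum_in (HHclass yZ)) =
         dsum_in (HHclass bZ)).
Proof.
have [cupHH cup_bilin cupE] := induced_cup bialgH modalgA.
have [brkHH brk_bilin brkE] := induced_lie bialgH modalgA.
exists cupHH, brkHH; split; first exact: (G_algebra bialgH modalgA).
move=> m n f g fZ gZ.
have [x xC fE] := cochain_closed bialgH modalgA fZ.
have [y yC gE] := cochain_closed bialgH modalgA gZ.
(* With both cocycles expressed by functions on words, the given cochain operations become [cup_op]
   and [lie], for which the induced operations are known. *)
subst f g; rewrite !HHclassE cupE // brkE //.
have [xg _] := xC; have [yg _] := yC.
rewrite (cup_expc bialgH modalgA xg yg) (bracket_expc bialgH modalgA xg yg).
have cC := closed_sgn (odd m && odd n) (closed_mul bialgH modalgA xC yC).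
have lC := closed_lie bialgH modalgA xC yC.
split.
  by exists (closed_cochain bialgH modalgA cC); rewrite HHclassE.
by exists (closed_cochain bialgH modalgA lC); rewrite HHclassE.
Qed.
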